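(* Assume that $m=\sum_{k\ge 0}kp_k\in(0,1)$ and $\sum_{k=1}^\infty k(\log k)p_k<\infty$. Then for any $\rho\in\mathbb{R}$ there exists a constant $C_*(\rho)\in(0,\infty)$ such that for any $x>0$, $$\lim_{y\to\infty}e^{(\rho+\sqrt{2\alpha+\rho^2})y}\,\mathbb{P}_x\big(\widetilde{M}^{-\rho}>y\big)=2\,C_*(\rho)\,e^{\rho x}\sinh\big(x\sqrt{2\alpha+\rho^2}\big).$$
   Context: Branching Brownian motion with drift $-\rho\in\mathbb{R}$: at time $0$ there is one particle at $x$, which moves as a Brownian motion with drift $-\rho$ (unit variance). After an exponential time of parameter $\beta>0$, independent of the motion, it dies and is replaced at its death position by $k$ offspring with probability $p_k$, $k\ge0$; the offspring evolve independently in the same way. $\mathbb{P}_x$ denotes the law. $N_t^{-\rho}$ is the set of particles alive at time $t$; for $u\in N_t^{-\rho}$ and $s\le t$, $X_u(s)$ is the position at time $s$ of $u$ or of its ancestor alive at time $s$. $m:=\sum_{k\ge0}kp_k$ is the mean offspring number, assumed to satisfy $m\in(0,1)$ (subcritical case), and $\alpha:=\beta(1-m)\in(0,\infty)$. In the branching killed Brownian motion, particles are killed (along with their descendants) upon hitting the origin. Its maximal position at time $t$ and all-time maximal position are $$\widetilde{M}_t^{-\rho}:=\max\{X_u(t):u\in N_t^{-\rho},\ \min_{s\le t}X_u(s)>0\},\qquad \widetilde{M}^{-\rho}:=\max_{t\ge0}\widetilde{M}_t^{-\rho},$$ with the convention $\max\emptyset=-\infty$ and the maximum over $t$ understood as a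 supremum. *)

(* Defs.v *)
(* MathComp-Analysis development: branching Brownian motion over an arbitrary
   [R : realType], built on the Ulam-Harris tree. *)
From HB Require Import structures.
From mathcomp Require Import all_boot all_order all_algebra.
From mathcomp Require Import all_classical all_reals all_analysis.

Set Implicit Arguments.
Unset Strict Implicit.
Unset Printing Implicit Defensive.

Import Order.TTheory GRing.Theory Num.Theory.
Import numFieldNormedType.Exports.

Local Open Scope classical_set_scope.
Local Open Scope ring_scope.

Definition sinh (R : realType) (z : R) : R := (expR z - expR (- z)) / 2.

Definition is_pmf (R : realType) (p : nat -> R) : Prop :=
  (forall k, 0 <= p k) /\ (\sum_(0 <= k <oo) (p k)%:E = 1)%E.

Definition offspring_mean (R : realType) (p : nat -> R) : \bar R :=
  (\sum_(0 <= k <oo) (k%:R * p k)%:E)%E.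

Section independence.
Context {R : realType} {d : measure_display} {T : measurableType d}.

Definition sigma_of {d' : measure_display} {T' : measurableType d'}
    (X : T -> T') : set (set T) :=
  preimage_set_system setT X measurable.

Definition mutually_independent (P : probability T R) (I : Type)
    (F : I -> set (set T)) : Prop :=
  forall (n : nat) (j : 'I_n -> I), injective j ->
  forall A : 'I_n -> set T, (forall k, F (j k) (A k)) ->
    P (\bigcap_(k in setT) A k) = (\prod_(k < n) P (A k))%E.

(* [normal_prob] takes a standard deviation; only times [t >= 0] matter. *)
Definition standard_brownian_motion (P : probability T R)
    (W : R -> {RV P >-> R}) : Prop :=
  [/\ forall w, W 0 w = 0,
      forall w, {within `[0, +oo[, continuous (fun t => W t w)},
      (forall s t : R, 0 <= s -> s < t -> forall A : set R, measurable A ->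
        P ((fun w => W t w - W s w) @^-1` A)
        = normal_prob 0 (Num.sqrt (t - s)) A) &
      (forall t : nat -> R, 0 <= t 0%N -> nondecreasing_seq t ->
        mutually_independent P
          (fun k => sigma_of (fun w => W (t k.+1) w - W (t k) w)))].

End independence.

(* A particle is named by the list of birth ranks on its ancestral line, most
   recent first: [::] is the initial particle and [i :: v] the child number [i]
   (counted from 0) of [v]. *)
Definition particle := seq nat.

Inductive source : Type :=
  | LifetimeOf of particle
  | OffspringOf of particle
  | MotionOf of particle.

(* The random inputs of the process.  They are attached to every label of the
   tree; only those of the particles that are actually born are used, and the
   motion of a particle only up to its lifetime. *)
Record branching_inputs (R : realType) (beta : R) (p : nat -> R)
    (d : measure_display) (T : measurableType d) (P : probability T R) :=
  BranchingInputs {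
  lifetime : particle -> {RV P >-> R};
  offspring : particle -> {RV P >-> nat};
  motion : particle -> R -> {RV P >-> R};
  lifetime_gt0 : forall u w, 0 < lifetime u w;
  lifetime_law : forall u (A : set R), measurable A ->
    P (lifetime u @^-1` A) = exponential_prob beta A;
  offspring_law : forall u k, P (offspring u @^-1` [set k]) = (p k)%:E;
  motion_law : forall u, standard_brownian_motion (motion u);
  inputs_independent : mutually_independent P (fun e : source =>
    match e with
    | LifetimeOf u => sigma_of (lifetime u)
    | OffspringOf u => sigma_of (offspring u)
    | MotionOf u =>
        <<s \bigcup_(t in [set t : R | 0 <= t]) sigma_of (motion u t) >>
    end)
}.

Section branching_brownian_motion.
Context {R : realType} {beta : R} {p : nat -> R} {d : measure_display}
  {T : measurableType d} {P : probability T R}.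
Variables (N : branching_inputs beta p P) (rho x : R).

Fixpoint birth_time (u : particle) (w : T) : R :=
  if u is _ :: v then birth_time v w + lifetime N v w else 0.

Definition death_time (u : particle) (w : T) : R :=
  birth_time u w + lifetime N u w.

Fixpoint is_born (u : particle) (w : T) : bool :=
  if u is i :: v then is_born v w && (i < offspring N v w)%N else true.

Definition displacement (u : particle) (a : R) (w : T) : R :=
  motion N u a w - rho * a.

Fixpoint birth_place (u : particle) (w : T) : R :=
  if u is _ :: v
  then birth_place v w + displacement v (lifetime N v w) w
  else x.

(* X_u(s): the position at time [s] of [u], or of its ancestor alive at [s]. *)
Fixpoint position (u : particle) (s : R) (w : T) : R :=
  if birth_time u w <= s
  then birth_place u w + displacement u (s - birth_time u w) w
  else if u is _ :: v then position v s w else x.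

Definition population (t : R) (w : T) : set particle :=
  [set u | is_born u w /\ birth_time u w <= t < death_time u w].

Definition killed_population (t : R) (w : T) : set particle :=
  [set u | population t w u /\
           forall s, 0 <= s <= t -> 0 < position u s w].

(* [ereal_sup set0] is [-oo], the convention for an empty population. *)
Definition killed_max_position (t : R) (w : T) : \bar R :=
  ereal_sup [set (position u t w)%:E | u in killed_population t w].

Definition killed_all_time_max (w : T) : \bar R :=
  ereal_sup [set killed_max_position t w | t in [set t : R | 0 <= t]].

End branching_brownian_motion.

(* Main.v *)
Require Import Defs.
From HB Require Import structures.
From mathcomp Require Import all_boot all_order all_algebra.
From mathcomp Require Import all_classical all_reals all_analysis.
From mathcomp Require Import measurable_realfun ring lra.

Set Implicit Arguments.
Unset Strict Implicit.
Unset Printing Implicit Defensive.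

Import Order.TTheory GRing.Theory Num.Theory.
Import numFieldNormedType.Exports.

Local Open Scope classical_set_scope.
Local Open Scope ring_scope.


(** Write [gamma := sqrt (2 alpha + rho^2)], [lam := rho + gamma], [mu := rho - gamma],
    [g u := \sum_k p_k (1 - (1 - u)^k)] and [eta u := 2 beta (m u - g u)].  Formally the
    probability [u x] of exceeding [y] from [x] solves [u''/2 - rho u' = beta (u - g u)],
    that is [u'' = 2 rho u' + 2 alpha u + eta u], with [u 0 = 0] and [u y = 1].

    Let [V (a, x)] be the solution of this equation with [V (a, 0) = 0] and initial slope
    [a], and [a L] the slope for which [V (a L, L) = 1].  Conditioning on the lifetime and
    the path of one particle gives a recursion over generations for the probability of
    exceeding [y]; by a stopped random walk approximation of that path,
    [V (a (y + eps), x + eps)] is a supersolution of the recursion and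
    [V (a (y + 2 eps), x) - V (a (y + 2 eps), eps)] a subsolution, so that they enclose the
    probability.

    The comparison [V (a, x) <= V (a e^(- lam h), x + h)] shows that [e^(lam L) a L] is
    nonincreasing in [L].  Its limit is positive because [\sum_j eta (e_j) / e_j] converges
    for [e_j := e^(- lam j)], which is where [\sum_k k (log k) p_k < oo] enters.  Since
    [V (a, x) / a] tends to [(e^(lam x) - e^(mu x)) / (lam - mu) =
    e^(rho x) sinh (gamma x) / gamma] as [a] tends to [0], multiplying both bounds by
    [e^(lam y)] and letting [y] and then [eps] go to their limits gives the result. *)

(** * Linear differential comparison *)

(** The linear part factors as [(d/dx - mu)(d/dx - lam)], which turns the second-order equation into
    a triangular first-order system for [V] and [V' - mu V]. Comparison of solutions then consists
    of Gronwall arguments, and no maximum principle is called for.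

    The process side avoids stochastic calculus. On a grid of step [mesh n] the exponential lifetime
    becomes a geometric number of steps, so a discrete supersolution inequality suffices, and
    Fatou's lemma removes the grid. Fatou yields only upper bounds; the lower bound on the
    probability is therefore obtained as an upper bound on the expected payoff of failure. The
    gaussian increments enter only through their exponential moments.

    An upper bound passes to all generations by induction from 0. A lower bound has no such start:
    its error is 1 at generation 0 and gets multiplied by [m] at each generation, so [m < 1] removes
    it in the limit. *)

Section derivatives.
Context {R : realType}.
Implicit Types (f df : R -> R) (a b k x : R).

Lemma is_derive_continuous f x d : is_derive x 1 f d -> {for x, continuous f}.
Proof.
by move=> [fd _]; exact/differentiable_continuous/derivable1_diffP.
Qed.

Lemma ge0_derive_le f df a b : a <= b ->
  (forall x, a <= x <= b -> is_derive x 1 f (df x)) ->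
  (forall x, a <= x <= b -> 0 <= df x) -> f a <= f b.
Proof.
move=> ab fd df0.
have [x xab E] : exists2 x, x \in `[a, b]%R & f b - f a = df x * (b - a).
  apply: MVT_segment => // [x xab|].
    by apply: fd; move: xab; rewrite in_itv/= => /andP[/ltW -> /ltW ->].
  apply: continuous_in_subspaceT => x; rewrite inE/= in_itv/= => xab.
  exact: is_derive_continuous (fd _ xab).
by rewrite -subr_ge0 E mulr_ge0 ?subr_ge0// df0 //; move: xab; rewrite in_itv.
Qed.

Lemma is_derive_expRMl f k x d : is_derive x 1 f d ->
  is_derive x 1 (fun t => expR (k * t) * f t) (expR (k * x) * (k * f x + d)).
Proof.
move=> fd.
have h : is_derive x 1 (fun t => expR (k * t)) (k * expR (k * x)).
  have h1 : is_derive x 1 (fun t : R => k * t) k.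
    have -> : (fun t : R => k * t) = k \*: (@id R).
      by apply/funext => t.
    by apply: is_derive_eq; rewrite /GRing.scale/= mulr1.
  by have := @is_derive1_comp _ expR _ x _ _ (is_derive_expR _) h1; rewrite mulrC.
have := @is_deriveM _ _ (fun t => expR (k * t)) f x 1 _ _ h fd.
move=> [D1 D2]; split; first exact: D1.
by rewrite [LHS]D2 /GRing.scale/=; ring.
Qed.

Lemma is_derive_expR_scale k x :
  is_derive x 1 (fun t : R => expR (k * t)) (k * expR (k * x)).
Proof.
have := @is_derive_expRMl (cst 1) k x 0 (is_derive_cst _ _ _).
have -> : (fun t : R => expR (k * t) * cst 1 t) = (fun t => expR (k * t)).
  by apply/funext => t /=; rewrite mulr1.
by rewrite /= mulr1 addr0 mulrC.
Qed.

Lemma is_derive_affine f g x (d1 d2 k : R) : is_derive x 1 f d1 -> is_derive x 1 g d2 ->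
  is_derive x 1 (fun t => f t + k * g t) (d1 + k * d2).
Proof.
move=> fd gd; have -> : (fun t => f t + k * g t) = f + k \*: g by apply/funext.
exact: is_deriveD.
Qed.

Lemma is_derive_shift f x h d : is_derive (x + h) 1 f d ->
  is_derive x 1 (fun t => f (t + h)) d.
Proof.
move=> fd.
have h1 : is_derive x 1 (fun t : R => t + h) 1.
  have -> : (fun t : R => t + h) = (@id R) + cst h by apply/funext.
  by apply: is_derive_eq; rewrite addr0.
by have := @is_derive1_comp _ f _ x _ _ fd h1; rewrite mulr1.
Qed.

Lemma is_derive_ext f g x d : f =1 g -> is_derive x 1 f d -> is_derive x 1 g d.
Proof. by move=> /funext ->. Qed.

(* Gronwall: [e^{-kx} f x] is nondecreasing. *)
Lemma linear_comparison f df k b : 0 <= b ->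
  (forall x, 0 <= x <= b -> is_derive x 1 f (df x)) ->
  (forall x, 0 <= x <= b -> k * f x <= df x) -> 0 <= f 0 -> 0 <= f b.
Proof.
move=> b0 fd dfk f0.
suff : expR (- k * 0) * f 0 <= expR (- k * b) * f b.
  rewrite mulr0 expR0 mul1r => /(le_trans f0).
  by rewrite pmulr_rge0// expR_gt0.
apply: (ge0_derive_le (f := fun t => expR (- k * t) * f t) b0) => x xb.
  exact: is_derive_expRMl (fd _ xb).
by rewrite mulr_ge0 ?expR_ge0// mulNr addrC subr_ge0 dfk.
Qed.

Lemma linear_comparisonB f g df dg k b : 0 <= b ->
  (forall x, 0 <= x <= b -> is_derive x 1 f (df x)) ->
  (forall x, 0 <= x <= b -> is_derive x 1 g (dg x)) ->
  (forall x, 0 <= x <= b -> k * (g x - f x) <= dg x - df x) ->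
  f 0 <= g 0 -> f b <= g b.
Proof.
move=> b0 fd gd h h0.
have := @linear_comparison (fun t => g t + (-1) * f t) _ k b b0
  (fun x xb => is_derive_affine (-1) (gd x xb) (fd x xb)).
rewrite /= !mulN1r !subr_ge0; apply => // x xb.
by rewrite !mulN1r; exact: h.
Qed.

Lemma nd_lipschitz_continuous f k : 0 <= k -> {homo f : x y / x <= y} ->
  (forall x y, x <= y -> f y - f x <= k * (y - x)) -> continuous f.
Proof.
move=> k_ge0 f_nd f_lip x; apply/cvgrPdist_lt => e e0.
have K1 : 0 < k + 1 by rewrite ltr_wpDl.
near=> t.
have xt : `|x - t| < e / (k + 1).
  by near: t; apply: cvgr_dist_lt => //; rewrite divr_gt0.
rewrite ltr_pdivlMr// in xt; apply: le_lt_trans xt.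
have [le|/ltW le] := leP x t.
  rewrite distrC ger0_norm ?subr_ge0 ?f_nd// (le_trans (f_lip _ _ le))//.
  rewrite distrC (ger0_norm (x := t - x)) ?subr_ge0//.
  by rewrite mulrC ler_wpM2l ?subr_ge0// lerDl.
rewrite ger0_norm ?subr_ge0 ?f_nd// (le_trans (f_lip _ _ le))//.
rewrite (ger0_norm (x := x - t)) ?subr_ge0//.
by rewrite mulrC ler_wpM2l ?subr_ge0// lerDl.
Unshelve. all: by end_near. Qed.

(** Continuity on [[0, oo)], phrased through the clamp [Num.max 0] so that results about functions
    on the whole line apply; values of [f] at negative arguments never enter. *)
Definition continuous_ge0 f := continuous (fun x => f (Num.max 0 x)).

Lemma continuous_maxl (c : R) : continuous (fun x : R => Num.max c x).
Proof.
have -> : (fun x : R => Num.max c x) = (fun x => (c + x + `|c - x|) / 2).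
  by apply/funext => x; rewrite maxr_absE.
move=> x; apply: cvgM; last exact: cvg_cst.
apply: cvgD; first by apply: cvgD; [exact: cvg_cst|exact: cvg_id].
by apply: cvg_norm; apply: cvgB; [exact: cvg_cst|exact: cvg_id].
Qed.

(** The integral starts at [-1] and not at 0 so that 0 is an interior point: the derivative there is
    two-sided, as [is_derive] demands. On [[-1, 0]] the clamped integrand is the constant [f 0],
    which is subtracted. *)
Definition primitive f x :=
  (\int[lebesgue_measure]_(t in `[(-1)%R, x]) f (Num.max 0 t))%R - f 0.

Lemma is_derive_primitive f x : continuous_ge0 f -> 0 <= x ->
  is_derive x 1 (primitive f) (f x).
Proof.
move=> cf x0.
have fi u : lebesgue_measure.-integrable `[-1, u] (EFin \o (fun t => f (Num.max 0 t))).
  apply: continuous_compact_integrable; first exact: segment_compact.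
  exact: continuous_subspaceT.
have x1 : x < x + 1 by rewrite ltrDl.
have x2 : -1 < x by rewrite (lt_le_trans _ x0)// ltrN10.
have [D1 D2] := @continuous_FTC1_closed _ (fun t => f (Num.max 0 t)) (-1) x (x + 1)
   x1 (fi _) x2 (cf x).
have h : is_derive x 1 (fun x => (\int[lebesgue_measure]_(t in `[(-1)%R, x]) f (Num.max 0 t))%R) (f x).
  by split; [exact: D1| rewrite -derive1E D2 max_r].
have := @is_deriveB _ _ _ _ _ _ _ _ _ h (is_derive_cst (f 0) x 1).
by rewrite subr0; apply: is_derive_ext.
Qed.

Lemma primitive0 f : primitive f 0 = 0.
Proof.
rewrite /primitive (@eq_Rintegral _ _ _ _ _ (cst (f 0))); last first.
  by move=> x; rewrite inE/= in_itv/= => /andP[_ x0]; rewrite max_l.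
rewrite Rintegral_cst//= lebesgue_measure_itv/= lte_fin ltrN10/=.
by rewrite sub0r opprK mulr1 subrr.
Qed.

Lemma derive_continuous_ge0 f df : (forall x, 0 <= x -> is_derive x 1 f (df x)) ->
  continuous_ge0 f.
Proof.
move=> fd x; apply: (@continuous_comp R R R (fun x => Num.max 0 x) f x); first exact: continuous_maxl.
by apply: is_derive_continuous (fd _ _); rewrite le_max lexx.
Qed.

Lemma continuous_ge0M f g : continuous_ge0 f -> continuous_ge0 g ->
  continuous_ge0 (fun x => f x * g x).
Proof. by move=> cf cg x; apply: cvgM; [exact: cf|exact: cg]. Qed.

Lemma continuous_ge0_comp f (h : R -> R) : continuous h -> continuous_ge0 f ->
  continuous_ge0 (h \o f).
Proof. by move=> ch cf x; apply: (@continuous_comp R R R (fun x => f (Num.max 0 x)) h); [exact: cf|exact: ch]. Qed.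

(* The solution of [y' = k y + f], [y 0 = a]. *)
Definition duhamel k a f x := expR (k * x) * (a + primitive (fun t => expR (- k * t) * f t) x).

Lemma duhamel0 k a f : duhamel k a f 0 = a.
Proof. by rewrite /duhamel mulr0 expR0 primitive0 mul1r addr0. Qed.

Lemma is_derive_duhamel k a f x : continuous_ge0 f -> 0 <= x ->
  is_derive x 1 (duhamel k a f) (k * duhamel k a f x + f x).
Proof.
move=> cf x0.
have cg : continuous_ge0 (fun t => expR (- k * t) * f t).
  apply: continuous_ge0M => //; apply: (derive_continuous_ge0 (df := fun t => - k * expR (- k * t))) => t _.
  exact: is_derive_expR_scale.
have h := is_derive_primitive cg x0.
have := @is_derive_affine (cst a) _ x _ _ 1 (is_derive_cst _ _ _) h.
move=> /(@is_derive_expRMl _ k x) H.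
have -> : duhamel k a f =
  fun t => expR (k * t) * (cst a t + 1 * primitive (fun t => expR (- k * t) * f t) t).
  by apply/funext => t; rewrite /duhamel mul1r.
apply: is_derive_eq => /=.
rewrite add0r !mul1r /duhamel; set e := expR (k * x); set e' := expR (- k * x).
have ee : e * e' = 1 by rewrite -expRD mulNr subrr expR0.
by rewrite mulrDr (mulrA e e') ee mul1r mulrCA.
Qed.

End derivatives.

(** * The nonlinear equation *)

Section nonlinear_ode.
Context {R : realType} (lam mu K : R) (eta : R -> R).
Hypotheses (lam_gt0 : 0 < lam) (mu_lt : mu < lam) (K_ge0 : 0 <= K)
  (eta0 : eta 0 = 0) (eta_nd : {homo eta : x y / x <= y})
  (eta_lip : forall x y, x <= y -> eta y - eta x <= K * (y - x)).
Implicit Types (f g U D dU dD : R -> R) (a b c x : R).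

(** Rate of the weight [expR (theta * x)] in which [step] contracts by 1/2: [theta - lam >= K]
    absorbs the Lipschitz constant of [eta], and [theta - mu >= 2] gives the factor. *)
Let theta := lam + K + 2.

Lemma eta_ge0 x : 0 <= x -> 0 <= eta x.
Proof. by rewrite -[X in X <= eta _]eta0; exact: eta_nd. Qed.

Lemma eta_continuous : continuous eta.
Proof. exact: nd_lipschitz_continuous K_ge0 eta_nd eta_lip. Qed.

(** Inverts [(d/dx - mu)(d/dx - lam)] by two successive first-order linear problems; [a] is the
    initial value of the inner one. *)
Let step a f := duhamel mu 0 (duhamel lam a (eta \o f)).

Let cstep1 a f : continuous_ge0 f -> continuous_ge0 (duhamel lam a (eta \o f)).
Proof.
move=> cf; apply: derive_continuous_ge0 => x x0.
by apply: is_derive_duhamel => //; apply: continuous_ge0_comp => //; exact: eta_continuous.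
Qed.

Let cstep a f : continuous_ge0 f -> continuous_ge0 (step a f).
Proof.
move=> cf; apply: derive_continuous_ge0 => x x0.
by apply: is_derive_duhamel => //; exact: cstep1.
Qed.

Let step1D a f x : continuous_ge0 f -> 0 <= x ->
  is_derive x 1 (duhamel lam a (eta \o f)) (lam * duhamel lam a (eta \o f) x + eta (f x)).
Proof.
by move=> cf x0; apply: is_derive_duhamel => //; apply: continuous_ge0_comp => //; exact: eta_continuous.
Qed.

Let stepD a f x : continuous_ge0 f -> 0 <= x ->
  is_derive x 1 (step a f) (mu * step a f x + duhamel lam a (eta \o f) x).
Proof. by move=> cf x0; apply: is_derive_duhamel => //; exact: cstep1. Qed.

(** The system is triangular: Gronwall applies first to [D], whose inequality does not involve [U],
    and then to [U]. *)
Let step_le a f U D dU dD b : continuous_ge0 f ->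
  (forall x, 0 <= x -> is_derive x 1 U (dU x)) ->
  (forall x, 0 <= x -> is_derive x 1 D (dD x)) ->
  (forall x, 0 <= x -> mu * U x + D x <= dU x) ->
  (forall x, 0 <= x -> lam * D x + eta (f x) <= dD x) ->
  0 <= U 0 -> a <= D 0 -> 0 <= b -> step a f b <= U b.
Proof.
move=> cf Ud Dd hU hD U0 D0 b0.
have D1 x : 0 <= x -> duhamel lam a (eta \o f) x <= D x.
  move=> x0; apply: (linear_comparisonB (k := lam) x0
    (fun t tx => step1D a cf (andP tx).1) (fun t tx => Dd t (andP tx).1)).
    by move=> t /andP[t0 _]; have := hD t t0; lra.
  by rewrite duhamel0.
apply: (linear_comparisonB (k := mu) b0
    (fun t tx => stepD a cf (andP tx).1) (fun t tx => Ud t (andP tx).1)).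
  by move=> t /andP[t0 _]; have := hU t t0; have := D1 t t0; lra.
by rewrite /step duhamel0.
Qed.

(** Monotonicity of [eta] gives the order; its Lipschitz bound makes [step a f] plus half the
    weighted error a supersolution for [g]. *)
Let step_contract a f g c b : continuous_ge0 f -> continuous_ge0 g -> 0 <= c ->
  (forall x, 0 <= x -> f x <= g x <= f x + c * expR (theta * x)) -> 0 <= b ->
  step a f b <= step a g b <= step a f b + c / 2 * expR (theta * b).
Proof.
move=> cf cg c0 fg b0; apply/andP; split.
  apply: (step_le cf (fun x => stepD a cg) (fun x => step1D a cg)) => //.
  - by move=> x x0; rewrite lerD2l; apply: eta_nd; case/andP: (fg x x0).
  - by rewrite /step duhamel0.
  - by rewrite duhamel0.
have := @step_le a g (fun t => step a f t + c / 2 * expR (theta * t))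
    (fun t => duhamel lam a (eta \o f) t + c * expR (theta * t)) _ _ b cg
    (fun x px => is_derive_affine (c / 2) (stepD a cf px) (is_derive_expR_scale theta x))
    (fun x px => is_derive_affine c (step1D a cf px) (is_derive_expR_scale theta x)).
rewrite /=; apply => //.
- move=> x x0; rewrite -subr_ge0.
  suff : 0 <= c * expR (theta * x) * (theta - mu - 2) by lra.
  by rewrite mulr_ge0 ?mulr_ge0 ?expR_ge0// /theta; have := mu_lt; have := K_ge0; lra.
- move=> x x0; have /andP[h1 h2] := fg x x0.
  have /(le_trans _) := eta_lip h1.
  have h3 : K * (g x - f x) <= K * (c * expR (theta * x)).
    by apply: ler_wpM2l => //; lra.
  have h4 : 0 <= c * expR (theta * x) by rewrite mulr_ge0 ?expR_ge0.
  have h5 := eta_lip h1.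
  by rewrite /theta in h3 h4 *; move=> _; nra.
- by rewrite /step duhamel0 add0r mulr0 expR0 mulr1 divr_ge0.
- by rewrite duhamel0 mulr0 expR0 mulr1 lerDl.
Qed.

(** Started from 0, so that the iterates increase and stay below every nonnegative supersolution.
    The limit is then the least one, which [kpp_le] exploits. *)
Let picard a n := iter n (step a) (cst 0).

Let picard_continuous a n : continuous_ge0 (picard a n).
Proof. by elim: n => [|n IH]; [move=> x; exact: cvg_cst|exact: cstep]. Qed.

Let picard_le a U D dU dD n b :
  (forall x, 0 <= x -> is_derive x 1 U (dU x)) ->
  (forall x, 0 <= x -> is_derive x 1 D (dD x)) ->
  (forall x, 0 <= x -> mu * U x + D x <= dU x) ->
  (forall x, 0 <= x -> lam * D x + eta (U x) <= dD x) ->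
  (forall x, 0 <= x -> 0 <= U x) -> a <= D 0 -> 0 <= b -> picard a n b <= U b.
Proof.
move=> Ud Dd hU hD U0 D0; elim: n b => [|n IH] b b0; first exact: U0.
apply: (step_le (@picard_continuous a n) Ud Dd) => //; last exact: U0.
by move=> x x0; apply: le_trans (hD x x0); rewrite lerD2l; apply: eta_nd; exact: IH.
Qed.

Let picard_bound a n x : 0 <= a -> 0 <= x -> picard a n x <= a * expR (theta * x).
Proof.
move=> a0 x0.
have ge0 c y : 0 <= c -> 0 <= c * (a * expR (theta * y)).
  by move=> c0; rewrite mulr_ge0 ?mulr_ge0 ?expR_ge0.
have tm : 2 <= theta - mu by rewrite /theta; have := mu_lt; have := K_ge0; lra.
have := @picard_le a (fun t => 0 + a * expR (theta * t))
  (fun t => 0 + (a * (theta - mu)) * expR (theta * t)) _ _ n x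
  (fun x px => is_derive_affine _ (is_derive_cst (0:R) x 1) (is_derive_expR_scale theta x))
  (fun x px => is_derive_affine _ (is_derive_cst (0:R) x 1) (is_derive_expR_scale theta x)).
rewrite /= => H; rewrite -[leRHS]add0r; apply: H => //.
- by move=> y y0; lra.
- move=> y y0; rewrite !add0r.
  have h1 : 0 <= a * expR (theta * y) by rewrite mulr_ge0// expR_ge0.
  have := eta_lip h1; rewrite eta0 subr0 => h2.
  have h3 : 0 <= (a * expR (theta * y)) * ((theta - lam) * (theta - mu) - K).
    rewrite mulr_ge0// /theta; have := K_ge0.
    by move: tm; rewrite /theta => tm k0; nra.
  by nra.
- by move=> y y0; rewrite add0r mulr_ge0// expR_ge0.
- by rewrite mulr0 expR0 mulr1 add0r; nra.
Qed.

Let picard_step a n x : 0 <= a -> 0 <= x ->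
  picard a n x <= picard a n.+1 x <= picard a n x + a / 2 ^+ n * expR (theta * x).
Proof.
move=> a0; elim: n x => [|n IH] x x0.
  rewrite /= divr1 add0r; apply/andP; split; last exact: (@picard_bound a 1).
  have h := @step_contract a (cst 0) (picard a 1) a x.
  have D0 t : 0 <= t -> 0 <= duhamel lam a (eta \o cst 0) t.
    move=> t0; apply: (linear_comparison (k := lam) t0 (fun s st => step1D a (@picard_continuous a 0) (andP st).1)).
      by move=> s _ /=; rewrite eta0 addr0.
    by rewrite duhamel0.
  apply: (linear_comparison (k := mu) x0 (fun s st => stepD a (@picard_continuous a 0) (andP st).1)).
    by move=> s /andP[s0 _] /=; rewrite lerDl D0.
  by rewrite /step duhamel0.
have -> : a / 2 ^+ n.+1 = a / 2 ^+ n / 2 by rewrite exprS invfM mulrA mulrAC.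
have := @step_contract a (picard a n) (picard a n.+1) (a / 2 ^+ n) x (@picard_continuous a n) (@picard_continuous a n.+1).
apply => //.
by rewrite divr_ge0// exprn_ge0.
Qed.

Let picard_addn a n k x : 0 <= a -> 0 <= x ->
  picard a n x <= picard a (n + k) x <= picard a n x + a / 2 ^+ n * (2 - 2 / 2 ^+ k) * expR (theta * x).
Proof.
move=> a0 x0; elim: k => [|k /andP[IH1 IH2]].
  by rewrite addn0 expr0 divr1 subrr mulr0 mul0r addr0 lexx.
have /andP[h1 h2] := picard_step (n + k) a0 x0.
rewrite addnS (le_trans IH1 h1)/= (le_trans h2)// (le_trans (lerD IH2 (lexx _)))//.
rewrite -addrA lerD2l -mulrDl ler_pM2r ?expR_gt0// exprD invfM mulrA -mulrDr.
rewrite ler_wpM2l ?divr_ge0 ?exprn_ge0// exprS.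
have -> : 2 / (2 * 2 ^+ k) = (2 ^+ k)^-1 :> R.
  by rewrite invfM mulrA divff ?mul1r// pnatr_eq0.
by lra.
Qed.

Let V a x := limn (fun n => picard a n x).

Let is_cvg_picard a x : 0 <= a -> 0 <= x -> cvgn (fun n => picard a n x).
Proof.
move=> a0 x0; apply: nondecreasing_is_cvgn.
  by apply/nondecreasing_seqP => n; case/andP: (picard_step n a0 x0).
by exists (a * expR (theta * x)) => _ [n _ <-]; exact: picard_bound.
Qed.

Let V_picard a n x : 0 <= a -> 0 <= x ->
  picard a n x <= V a x <= picard a n x + 2 * a / 2 ^+ n * expR (theta * x).
Proof.
move=> a0 x0; have c := is_cvg_picard a0 x0; apply/andP; split.
  apply: limr_ge => //; exists n => // m /= nm.
  by rewrite -(subnKC nm); case/andP: (picard_addn n (m - n) a0 x0).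
apply: limr_le => //; exists n => // m /= nm.
rewrite -(subnKC nm); case/andP: (picard_addn n (m - n) a0 x0) => _ /le_trans; apply.
rewrite lerD2l ler_pM2r ?expR_gt0// mulrC -mulrA; apply: ler_wpM2r.
  by rewrite divr_ge0 ?exprn_ge0.
by rewrite gerBl divr_ge0 ?exprn_ge0.
Qed.

Let V_continuous a : 0 <= a -> continuous_ge0 (V a).
Proof.
move=> a0 x; apply/cvgrPdist_lt => e e0.
(* [B] dominates the weighted error on [[0, Num.max 0 x + 1]], so that a single Picard iterate is
   uniformly close to [V a] near [x]. *)
pose B := 2 * a * expR (theta * (Num.max 0 x + 1)) + 1.
have th0 : 0 <= theta by rewrite /theta; have := lam_gt0; have := K_ge0; lra.
have B0 : 0 < B by rewrite ltr_wpDl// mulr_ge0 ?expR_ge0// mulr_ge0.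
have [n nB] : exists n, B / 2 ^+ n < e / 3.
  have : (fun n => B * 2^-1 ^+ n) @ \oo --> B * 0.
    by apply: cvgM; [exact: cvg_cst|apply: cvg_expr; rewrite ger0_norm; lra].
  rewrite mulr0 => /cvgrPdist_lt/(_ (e / 3)); case; first by rewrite divr_gt0.
  move=> n _ /(_ n (leqnn _)); rewrite /= sub0r normrN ger0_norm ?exprVn; last first.
    by rewrite mulr_ge0 ?ltW// invr_ge0 exprn_ge0.
  by exists n.
have close t : 0 <= t -> t <= Num.max 0 x + 1 -> `|V a t - picard a n t| < e / 3.
  move=> t0 tx; have /andP[h1 h2] := V_picard n a0 t0.
  rewrite ger0_norm ?subr_ge0//; apply: le_lt_trans nB.
  rewrite lerBlDl (le_trans h2)// lerD2l mulrAC ler_pM2r ?invr_gt0 ?exprn_gt0// /B.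
  by rewrite ler_wpDr// ler_wpM2l ?mulr_ge0// ler_expR ler_wpM2l.
have e3 : 0 < e / 3 by rewrite divr_gt0.
have /cvgrPdist_lt/(_ _ e3) pc := @picard_continuous a n x.
near=> t.
have mt : Num.max 0 t <= Num.max 0 x + 1.
  have : `|x - t| < 1 by near: t; exact: cvgr_dist_lt.
  rewrite distrC => /(le_lt_trans (ler_norm _)); rewrite ltrBlDl.
  by rewrite ge_max => /ltW tx; rewrite addr_ge0 ?le_max ?lexx//= (le_trans tx)// lerD2r le_max lexx orbT.
have h1 := close _ (_ : 0 <= Num.max 0 x) (_ : Num.max 0 x <= _).
have h2 : `|V a (Num.max 0 x) - picard a n (Num.max 0 x)| < e / 3.
  by apply: h1; rewrite ?le_max ?lexx// lerDl.
have h3 : `|V a (Num.max 0 t) - picard a n (Num.max 0 t)| < e / 3.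
  by apply: close => //; rewrite le_max lexx.
have h4 : `|picard a n (Num.max 0 x) - picard a n (Num.max 0 t)| < e / 3.
  by near: t; exact: pc.
have -> : V a (Num.max 0 x) - V a (Num.max 0 t) =
  (V a (Num.max 0 x) - picard a n (Num.max 0 x)) +
  (picard a n (Num.max 0 x) - picard a n (Num.max 0 t)) -
  (V a (Num.max 0 t) - picard a n (Num.max 0 t)) by ring.
rewrite (le_lt_trans (ler_normB _ _))// (le_lt_trans (lerD (ler_normD _ _) (lexx _)))//.
by lra.
Unshelve. all: by end_near. Qed.

Let V_step a x : 0 <= a -> 0 <= x -> V a x = step a (V a) x.
Proof.
move=> a0 x0; have c := is_cvg_picard a0 x0.
have h n : picard a n.+1 x <= step a (V a) x <= picard a n.+1 x + a / 2 ^+ n * expR (theta * x).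
  have := @step_contract a (picard a n) (V a) (2 * a / 2 ^+ n) x (@picard_continuous a n) (V_continuous a0).
  have -> : 2 * a / 2 ^+ n / 2 = a / 2 ^+ n by field; rewrite expf_neq0.
  apply => //; first by rewrite divr_ge0 ?mulr_ge0// exprn_ge0.
  by move=> t t0; exact: V_picard.
have l1 : (fun n => picard a n.+1 x) @ \oo --> V a x.
  have c' : (fun n => picard a n x) @ \oo --> V a x by exact: c.
  by move: c'; rewrite -(cvg_shiftS (fun n => picard a n x)).
have l2 : (fun n => picard a n.+1 x + a * expR (theta * x) * (2^-1) ^+ n) @ \oo --> V a x + a * expR (theta * x) * 0.
  apply: cvgD => //; apply: cvgM; first exact: cvg_cst.
  by apply: cvg_expr; rewrite ger0_norm; lra.
rewrite mulr0 addr0 in l2.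
have l3 : (fun=> step a (V a) x) @ \oo --> V a x.
  apply: (squeeze_cvgr _ l1 l2); near=> n.
  by have := h n; rewrite [a / _ * _]mulrAC exprVn.
by apply: (cvg_unique _ l3) => //; exact: cvg_cst.
Unshelve. all: by end_near. Qed.

(* [kpp a] solves [V'' = (lam + mu) V' - lam mu V + eta V] with [V 0 = 0] and [V' 0 = a];
   [kpp_slope a] is [V' - mu V]. *)
Definition kpp_slope a := duhamel lam a (eta \o V a).

Definition kpp a := duhamel mu 0 (kpp_slope a).

Let kppE a x : 0 <= a -> 0 <= x -> V a x = kpp a x.
Proof. exact: V_step. Qed.

Lemma is_derive_kpp a x : 0 <= a -> 0 <= x ->
  is_derive x 1 (kpp a) (mu * kpp a x + kpp_slope a x).
Proof. by move=> a0 px; apply: stepD => //; exact: V_continuous. Qed.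

Lemma is_derive_kpp_slope a x : 0 <= a -> 0 <= x ->
  is_derive x 1 (kpp_slope a) (lam * kpp_slope a x + eta (kpp a x)).
Proof. by move=> a0 px; rewrite -kppE//; apply: step1D => //; exact: V_continuous. Qed.

Lemma kpp0 a : kpp a 0 = 0. Proof. exact: duhamel0. Qed.

Lemma kpp_slope0 a : kpp_slope a 0 = a. Proof. exact: duhamel0. Qed.

(** The source of the later comparisons in slope and position: shifted, scaled or perturbed
    solutions are inserted as [U], with [D] in the role of [U' - mu U]. *)
Lemma kpp_le a U D dU dD b : 0 <= a ->
  (forall x, 0 <= x -> is_derive x 1 U (dU x)) ->
  (forall x, 0 <= x -> is_derive x 1 D (dD x)) ->
  (forall x, 0 <= x -> mu * U x + D x <= dU x) ->
  (forall x, 0 <= x -> lam * D x + eta (U x) <= dD x) ->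
  (forall x, 0 <= x -> 0 <= U x) -> a <= D 0 -> 0 <= b -> kpp a b <= U b.
Proof.
move=> a0 Ud Dd hU hD U0 D0 b0; rewrite -kppE//.
apply: limr_le; first exact: is_cvg_picard.
by apply: nearW => n; exact: picard_le Ud Dd hU hD U0 D0 b0.
Qed.

Lemma kpp_ge0 a x : 0 <= a -> 0 <= x -> 0 <= kpp a x.
Proof. by move=> a0 px; rewrite -kppE//; case/andP: (V_picard 0 a0 px). Qed.

Lemma kpp_le_exp a x : 0 <= a -> 0 <= x -> kpp a x <= a * expR (theta * x).
Proof.
move=> a0 px; rewrite -kppE//; apply: limr_le; first exact: is_cvg_picard.
by apply: nearW => n; exact: picard_bound.
Qed.

Lemma kpp_slope_ge a x : 0 <= a -> 0 <= x -> a * expR (lam * x) <= kpp_slope a x.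
Proof.
move=> a0 px; rewrite -[leLHS]add0r.
apply: (linear_comparisonB (k := lam) px (f := fun t => 0 + a * expR (lam * t))
  (fun t _ => is_derive_affine a (is_derive_cst (0 : R) t 1) (is_derive_expR_scale lam t))
  (fun t tx => is_derive_kpp_slope a0 (andP tx).1)) => [t /andP[t0 _]|].
  by have := eta_ge0 (kpp_ge0 a0 t0); lra.
by rewrite kpp_slope0 mulr0 expR0 mulr1 add0r.
Qed.

Lemma kpp_slope_ge0 a x : 0 <= a -> 0 <= x -> 0 <= kpp_slope a x.
Proof. by move=> a0 px; rewrite (le_trans _ (kpp_slope_ge a0 px))// mulr_ge0// expR_ge0. Qed.

Lemma kpp_lin_ge a x : 0 <= a -> 0 <= x ->
  a * ((expR (lam * x) - expR (mu * x)) / (lam - mu)) <= kpp a x.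
Proof.
move=> a0 px; have g0 : lam - mu != 0 by rewrite gt_eqF// subr_gt0.
have -> : a * ((expR (lam * x) - expR (mu * x)) / (lam - mu)) =
   0 + a / (lam - mu) * expR (lam * x) + (- (a / (lam - mu))) * expR (mu * x) by field.
apply: (linear_comparisonB (k := mu) px
  (f := fun t => 0 + a / (lam - mu) * expR (lam * t) + (- (a / (lam - mu))) * expR (mu * t))
  (fun t _ => is_derive_affine _ (is_derive_affine _ (is_derive_cst (0 : R) t 1) (is_derive_expR_scale lam t)) (is_derive_expR_scale mu t))
  (fun t tx => is_derive_kpp a0 (andP tx).1)) => [t /andP[t0 _]|].
  have := kpp_slope_ge a0 t0.
  have -> : a * expR (lam * t) = (a / (lam - mu) * expR (lam * t)) * (lam - mu) by field.
  by lra.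
by rewrite kpp0 !mulr0 expR0; lra.
Qed.

(** The difference [E] of the two sides satisfies [E' = mu E + eta (kpp a x)] and starts from [a],
    hence stays nonnegative. In terms of [V] this says [V' >= lam V]. *)
Lemma kpp_gap a x : 0 <= a -> 0 <= x -> (lam - mu) * kpp a x <= kpp_slope a x.
Proof.
move=> a0 px; rewrite -[leLHS]add0r.
apply: (linear_comparisonB (k := mu) px (f := fun t => 0 + (lam - mu) * kpp a t)
  (fun t tx => is_derive_affine _ (is_derive_cst (0 : R) t 1) (is_derive_kpp a0 (andP tx).1))
  (fun t tx => is_derive_kpp_slope a0 (andP tx).1)) => [t /andP[t0 _]|].
  by have := eta_ge0 (kpp_ge0 a0 t0); lra.
by rewrite kpp_slope0 kpp0; lra.
Qed.

(** [V' >= lam V], integrated. Read backwards from a point where [V = 1], it forces exponential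
    decay towards 0. *)
Lemma kpp_growth a x y : 0 <= a -> 0 <= x -> x <= y ->
  kpp a x <= kpp a y * expR (- lam * (y - x)).
Proof.
move=> a0 px xy.
have : expR (- lam * x) * kpp a x <= expR (- lam * y) * kpp a y.
  apply: (ge0_derive_le (f := fun t => expR (- lam * t) * kpp a t) xy
   (fun t tx => is_derive_expRMl (- lam) (is_derive_kpp a0 (le_trans px (andP tx).1)))) => t /andP[xt _].
  rewrite mulr_ge0 ?expR_ge0//.
  by have := kpp_gap a0 (le_trans px xt); lra.
rewrite mulrBr expRB mulrA ler_pdivlMr ?expR_gt0// mulrC [X in _ -> _ <= X]mulrC.
by [].
Qed.

Lemma kpp_ndx a x y : 0 <= a -> 0 <= x -> x <= y -> kpp a x <= kpp a y.
Proof.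
move=> a0 x0 xy; apply: (le_trans (kpp_growth a0 x0 xy)).
rewrite ler_piMr ?(kpp_ge0 a0 (le_trans x0 xy))// -[leRHS]expR0 ler_expR mulNr oppr_le0.
by rewrite mulr_ge0 ?subr_ge0// ltW.
Qed.

Lemma kpp_slope_growth a x y k : 0 <= a -> 0 <= x -> x <= y ->
  (forall t, x <= t <= y -> eta (kpp a t) <= k * kpp_slope a t) ->
  kpp_slope a y <= kpp_slope a x * expR ((lam + k) * (y - x)).
Proof.
move=> a0 px xy h.
have : expR (- (lam + k) * x) * (0 + (-1) * kpp_slope a x) <= expR (- (lam + k) * y) * (0 + (-1) * kpp_slope a y).
  apply: (ge0_derive_le (f := fun t => expR (- (lam + k) * t) * (0 + (-1) * kpp_slope a t)) xy
   (fun t tx => is_derive_expRMl (- (lam + k)) (is_derive_affine (-1) (is_derive_cst (0 : R) t 1) (is_derive_kpp_slope a0 (le_trans px (andP tx).1))))) => t tx.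
  rewrite mulr_ge0 ?expR_ge0//.
  by have := h t tx; rewrite /=; lra.
rewrite !add0r !mulN1r !mulrN lerN2 !mulNr !expRN mulrBr expRB mulrA.
by rewrite mulrC [X in _ <= X -> _]mulrC ler_pdivrMr ?expR_gt0// mulrAC.
Qed.

Lemma kpp_nd a1 a2 x : 0 <= a1 -> a1 <= a2 -> 0 <= x -> kpp a1 x <= kpp a2 x.
Proof.
move=> a0 a12 px; have a20 := le_trans a0 a12.
apply: (kpp_le a0 (fun t => is_derive_kpp a20) (fun t => is_derive_kpp_slope a20)) => //.
  by move=> t; exact: kpp_ge0.
by rewrite kpp_slope0.
Qed.

Lemma kpp_lipschitz a1 a2 x : 0 <= a1 -> a1 <= a2 -> 0 <= x ->
  kpp a2 x <= kpp a1 x + (a2 - a1) * expR (theta * x).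
Proof.
move=> a0 a12 px; have a20 := le_trans a0 a12.
have d0 : 0 <= a2 - a1 by rewrite subr_ge0.
have tm : 2 <= theta - mu by rewrite /theta; have := mu_lt; have := K_ge0; lra.
have := @kpp_le a2 (fun t => kpp a1 t + (a2 - a1) * expR (theta * t))
  (fun t => kpp_slope a1 t + ((a2 - a1) * (theta - mu)) * expR (theta * t)) _ _ x a20
  (fun t pt => is_derive_affine _ (is_derive_kpp a0 pt) (is_derive_expR_scale theta t))
  (fun t pt => is_derive_affine _ (is_derive_kpp_slope a0 pt) (is_derive_expR_scale theta t)).
apply => //=.
- by move=> t t0; lra.
- move=> t t0; have h1 : 0 <= (a2 - a1) * expR (theta * t) by rewrite mulr_ge0 ?expR_ge0.
  have := @eta_lip (kpp a1 t) (kpp a1 t + (a2 - a1) * expR (theta * t)).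
  rewrite lerDl => /(_ h1); rewrite addrAC subrr add0r => h2.
  have h3 : 0 <= ((a2 - a1) * expR (theta * t)) * ((theta - lam) * (theta - mu) - K).
    rewrite mulr_ge0// /theta; have := K_ge0.
    by move: tm; rewrite /theta => tm k0; nra.
  by nra.
- by move=> t t0; rewrite addr_ge0 ?kpp_ge0// mulr_ge0// expR_ge0.
- by rewrite kpp_slope0 mulr0 expR0 mulr1; nra.
Qed.

(** At abscissa [h] the solution started from [a e^(- lam h)] is nonnegative and its [kpp_slope] has
    grown back to at least [a]; from there on it is a supersolution of the problem with slope
    [a]. *)
Lemma kpp_shift a h x : 0 <= a -> 0 <= h -> 0 <= x ->
  kpp a x <= kpp (a * expR (- lam * h)) (x + h).
Proof.
move=> a0 h0 px; set c := a * _.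
have c0 : 0 <= c by rewrite mulr_ge0 ?expR_ge0.
have th t : 0 <= t -> 0 <= t + h by move=> t0; rewrite addr_ge0.
have := @kpp_le a (fun t => kpp c (t + h)) (fun t => kpp_slope c (t + h)) _ _ x a0
 (fun t pt => is_derive_shift (is_derive_kpp c0 (th t pt)))
 (fun t pt => is_derive_shift (is_derive_kpp_slope c0 (th t pt))).
apply => //=.
- by move=> t t0; rewrite kpp_ge0// th.
- rewrite add0r; apply: le_trans (kpp_slope_ge c0 h0).
  by rewrite /c -mulrA -expRD mulNr addNr expR0 mulr1.
Qed.

(** On the range of values reached up to [x] the nonlinearity acts at most with rate [k]; for small
    [k] this brings [V (a, x) / a] close to the linear solution. *)
Lemma kpp_small a x k : 0 <= a -> 0 <= x -> 0 <= k ->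
  (forall u, 0 <= u -> u <= a * expR (theta * x) -> eta u <= k * u) ->
  kpp a x <= a * ((expR (lam * x) - expR (mu * x)) / (lam - mu)) + k * a * expR (theta * x).
Proof.
move=> a0 px k0 hk.
have g0 : lam - mu != 0 by rewrite gt_eqF// subr_gt0.
have th0 : 0 <= theta by rewrite /theta; have := lam_gt0; have := K_ge0; lra.
have hD t : 0 <= t <= x -> kpp_slope a t <= 0 + a * expR (lam * t) + k * a * expR (theta * t).
  move=> /andP[t0 tx].
  apply: (linear_comparisonB (k := lam) t0
    (g := fun t => 0 + a * expR (lam * t) + k * a * expR (theta * t))
    (fun s sx => is_derive_kpp_slope a0 (andP sx).1)
    (fun s _ => is_derive_affine _ (is_derive_affine _ (is_derive_cst (0 : R) s 1) (is_derive_expR_scale lam s)) (is_derive_expR_scale theta s)))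
    => [s /andP[s0 sx]|].
    have h1 : kpp a s <= a * expR (theta * s) by exact: kpp_le_exp.
    have h2 : a * expR (theta * s) <= a * expR (theta * x).
      by rewrite ler_wpM2l// ler_expR ler_wpM2l// (le_trans sx).
    have h3 := hk _ (kpp_ge0 a0 s0) (le_trans h1 h2).
    have h4 : k * kpp a s <= k * (a * expR (theta * s)) by rewrite ler_wpM2l.
    have h5 : 0 <= (k * a * expR (theta * s)) * (theta - lam - 1).
      by rewrite mulr_ge0 ?mulr_ge0 ?expR_ge0// /theta; have := K_ge0; lra.
    by lra.
  by rewrite kpp_slope0 !mulr0 expR0; nra.
have -> : a * ((expR (lam * x) - expR (mu * x)) / (lam - mu)) + k * a * expR (theta * x) =
   0 + a / (lam - mu) * expR (lam * x) + (- (a / (lam - mu))) * expR (mu * x)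
   + k * a * expR (theta * x) by field.
apply: (linear_comparisonB (k := mu) px
  (g := fun t => 0 + a / (lam - mu) * expR (lam * t) + (- (a / (lam - mu))) * expR (mu * t) + k * a * expR (theta * t))
  (fun t tx => is_derive_kpp a0 (andP tx).1)
  (fun t _ => is_derive_affine _ (is_derive_affine _ (is_derive_affine _ (is_derive_cst (0 : R) t 1) (is_derive_expR_scale lam t)) (is_derive_expR_scale mu t)) (is_derive_expR_scale theta t)))
   => [t tx|].
  have := hD t tx.
  have -> : a * expR (lam * t) = (a / (lam - mu) * expR (lam * t)) * (lam - mu) by field.
  have h5 : 0 <= (k * a * expR (theta * t)) * (theta - mu - 1).
    by rewrite mulr_ge0 ?mulr_ge0 ?expR_ge0// /theta; have := K_ge0; have := mu_lt; lra.
  by lra.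
by rewrite kpp0 !mulr0 expR0; nra.
Qed.

Hypothesis eta_star : forall c u, 0 <= c <= 1 -> 0 <= u -> eta (c * u) <= c * eta u.

(** By [eta_star] the multiple [c V] is itself a supersolution. This is a quantitative strict
    monotonicity in the slope: scaling the slope by [c] scales the value by at most [c]. *)
Lemma kpp_star a c x : 0 <= a -> 0 <= c <= 1 -> 0 <= x -> kpp (c * a) x <= c * kpp a x.
Proof.
move=> a0 /andP[c0 c1] px; have ca0 : 0 <= c * a by rewrite mulr_ge0.
have := @kpp_le (c * a) (fun t => 0 + c * kpp a t) (fun t => 0 + c * kpp_slope a t) _ _ x ca0
  (fun t pt => is_derive_affine c (is_derive_cst (0 : R) t 1) (is_derive_kpp a0 pt))
  (fun t pt => is_derive_affine c (is_derive_cst (0 : R) t 1) (is_derive_kpp_slope a0 pt)).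
rewrite /= => H; rewrite -[leRHS]add0r; apply: H => //.
- by move=> t t0; lra.
- move=> t t0; have := @eta_star c (kpp a t); rewrite c0 c1 => /(_ isT (kpp_ge0 a0 t0)).
  by rewrite !add0r; lra.
- by move=> t t0; rewrite add0r mulr_ge0 ?kpp_ge0.
- by rewrite add0r kpp_slope0.
Qed.

End nonlinear_ode.

(** * Shooting: solutions that take the value 1 at a given point *)

Section shooting.
Context {R : realType} (lam mu K : R) (eta : R -> R).
Hypotheses (lam_gt0 : 0 < lam) (mu_lt : mu < lam) (K_ge0 : 0 <= K)
  (eta0 : eta 0 = 0) (eta_nd : {homo eta : x y / x <= y})
  (eta_lip : forall x y, x <= y -> eta y - eta x <= K * (y - x))
  (eta_star : forall c u, 0 <= c <= 1 -> 0 <= u -> eta (c * u) <= c * eta u).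
Variable Theta : R.
Hypothesis eta_sum : forall n : nat,
  \sum_(0 <= j < n) eta (expR (- lam * j%:R)) / expR (- lam * j%:R) <= Theta.

Local Notation kpp := (kpp lam mu eta).
Local Notation kpp_slope := (kpp_slope lam mu eta).
Let theta := lam + K + 2.
Let s (x : R) := (expR (lam * x) - expR (mu * x)) / (lam - mu).

Let g_gt0 : 0 < lam - mu. Proof. by rewrite subr_gt0. Qed.

Let s_gt0 x : 0 < x -> 0 < s x.
Proof. by move=> x0; rewrite divr_gt0// subr_gt0 ltr_expR ltr_pM2r. Qed.

Let ratio j := eta (expR (- lam * j%:R)) / expR (- lam * j%:R).

Let ratio_ge0 j : 0 <= ratio j.
Proof. by rewrite divr_ge0 ?expR_ge0// (eta_ge0 eta0 eta_nd)// expR_ge0. Qed.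

(** Star-shapedness makes [eta u / u] nondecreasing, so its value at the right end bounds it. *)
Let eta_ratio (j : nat) u : 0 <= u -> u <= expR (- lam * j%:R) -> eta u <= ratio j * u.
Proof.
move=> u0 uj; rewrite /ratio; set e := expR _ in uj *.
have e0 : 0 < e by exact: expR_gt0.
have c01 : 0 <= u / e <= 1.
  by rewrite divr_ge0 ?(ltW e0)//= ler_pdivrMr// mul1r.
have := eta_star c01 (ltW e0); rewrite divfK ?gt_eqF// => /le_trans; apply.
by rewrite mulrAC [leRHS]mulrAC (mulrC u).
Qed.

Lemma shootP (L : R) : 0 < L -> exists a, 0 < a /\ kpp a L = 1.
Proof.
(* [A] is the slope for which the linear lower bound already reaches 1 at [L]. Below, the slope is
   clamped at 0 because the estimates concern nonnegative slopes. *)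
move=> L0; pose A := (s L)^-1.
have A0 : 0 < A by rewrite invr_gt0 s_gt0.
have f0 : kpp 0 L = 0.
  apply/eqP; rewrite eq_le.
  rewrite (kpp_ge0 lam_gt0 mu_lt K_ge0 eta0 eta_nd eta_lip) ?(ltW L0)// andbT.
  by have := kpp_le_exp lam_gt0 mu_lt K_ge0 eta0 eta_nd eta_lip (lexx 0) (ltW L0); rewrite mul0r.
have fA : 1 <= kpp A L.
  have := kpp_lin_ge lam_gt0 mu_lt K_ge0 eta0 eta_nd eta_lip (ltW A0) (ltW L0).
  by rewrite -/(s L) mulVf// gt_eqF// s_gt0.
have cf : {within `[0, A], continuous (fun a => kpp (Num.max 0 a) L)}.
  apply: continuous_subspaceT => a; apply/cvgrPdist_lt => e e0.
  have B0 : 0 < expR (theta * L) by exact: expR_gt0.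
  near=> t.
  have ct : `|Num.max 0 a - Num.max 0 t| < e / expR (theta * L).
    near: t; have /cvgrPdist_lt := @continuous_maxl R 0 a; apply.
    by rewrite divr_gt0.
  rewrite ltr_pdivlMr// in ct; apply: le_lt_trans ct.
  have m0 (u : R) : 0 <= Num.max 0 u by rewrite le_max lexx.
  have [le|/ltW le] := leP (Num.max 0 a) (Num.max 0 t).
    rewrite distrC (distrC (Num.max 0 a)) !ger0_norm ?subr_ge0//; last first.
      exact: (kpp_nd lam_gt0 mu_lt K_ge0 eta0 eta_nd eta_lip) (ltW L0).
    rewrite lerBlDl; exact: (kpp_lipschitz lam_gt0 mu_lt K_ge0 eta0 eta_nd eta_lip) (ltW L0).
  rewrite !ger0_norm ?subr_ge0//; last first.
    exact: (kpp_nd lam_gt0 mu_lt K_ge0 eta0 eta_nd eta_lip) (ltW L0).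
  rewrite lerBlDl; exact: (kpp_lipschitz lam_gt0 mu_lt K_ge0 eta0 eta_nd eta_lip) (ltW L0).
have [|a aA E] := @IVT _ _ 0 A 1 (ltW A0) cf.
  rewrite maxxx f0 (max_r (ltW A0)) minEle maxEle.
  by rewrite (le_trans ler01 fA) ler01.
have a0 : 0 <= a by move: aA; rewrite in_itv/= => /andP[].
rewrite max_r// in E; exists a; split => //.
rewrite lt_neqAle a0 andbT; apply/eqP => a0'.
by move: E; rewrite -a0' f0 => /eqP; rewrite eq_sym oner_eq0.
Unshelve. all: by end_near. Qed.

Definition shoot (L : R) : R := xget 0 [set a | 0 < a /\ kpp a L = 1].

Lemma shoot_spec L : 0 < L -> 0 < shoot L /\ kpp (shoot L) L = 1.
Proof.
move=> /shootP[a ha].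
exact: (@xgetI _ 0 [set a | 0 < a /\ kpp a L = 1] a ha).
Qed.

Let shoot_gt0 L (L0 : 0 < L) : 0 < shoot L := (shoot_spec L0).1.

Let kpp_shoot L (L0 : 0 < L) : kpp (shoot L) L = 1 := (shoot_spec L0).2.

Let amp L := shoot L * expR (lam * L).

Let amp_nincr L1 L2 : 0 < L1 -> L1 <= L2 -> amp L2 <= amp L1.
Proof.
move=> L10 L12; have L20 := lt_le_trans L10 L12.
have [a10 a20] := (shoot_gt0 L10, shoot_gt0 L20).
pose b := shoot L1 * expR (- lam * (L2 - L1)).
have b0 : 0 < b by rewrite mulr_gt0// expR_gt0.
suff ab : shoot L2 <= b.
  rewrite /amp (le_trans (ler_wpM2r (expR_ge0 _) ab))// /b -mulrA -expRD.
  by rewrite ler_pM2l// ler_expR; lra.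
rewrite leNgt; apply/negP => ba.
have h : 1 <= kpp b L2.
  have := @kpp_shift _ lam mu K eta lam_gt0 mu_lt K_ge0 eta0 eta_nd eta_lip
    (shoot L1) (L2 - L1) L1 (ltW a10).
  by rewrite subr_ge0 L12 (ltW L10) kpp_shoot// [L1 + _]addrC subrK; apply.
(* With [c < 1], scaling the solution of slope [shoot L2] down to slope [b] leaves a value at most
   [c] at [L2], against the value at least 1 found in [h]. *)
pose c := b / shoot L2.
have c1 : c < 1 by rewrite ltr_pdivrMr// mul1r.
have c0 : 0 <= c by rewrite divr_ge0 ?ltW.
have := @kpp_star _ lam mu K eta lam_gt0 mu_lt K_ge0 eta0 eta_nd eta_lip eta_star
  (shoot L2) c L2 (ltW a20).
rewrite c0 (ltW c1) (ltW L20) => /(_ isT isT).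
by rewrite kpp_shoot// mulr1 /c divfK ?gt_eqF// leNgt (lt_le_trans c1 h).
Qed.

(** Follow [kpp_slope] from [L] back to 0 in unit steps. At distance at least [n] from [L] the
    solution is at most [e^(- lam n)], so [eta V <= ratio n * V], and by [kpp_gap] the growth rate
    of the slope exceeds [lam] by at most [ratio n / (lam - mu)]. These excesses sum to at most
    [Theta / (lam - mu)], while the slope is at least [lam - mu] at [L] and equals [shoot L] at
    0. *)
Let amp_ge L : 0 < L -> (lam - mu) * expR (- (Theta / (lam - mu))) <= amp L.
Proof.
move=> L0; have a0 := shoot_gt0 L0.
(* Clamped at 0, so that the last step may be shorter than 1 and all further ones are empty. *)
pose xn (n : nat) := Num.max 0 (L - n%:R).
have step n : kpp_slope (shoot L) L <= kpp_slope (shoot L) (xn n) *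
   expR (lam * (L - xn n)) * expR ((\sum_(0 <= j < n) ratio j) / (lam - mu)).
  elim: n => [|n IH].
    by rewrite big_geq// mul0r /xn subr0 (max_r (ltW L0)) subrr mulr0 expR0 !mulr1.
  apply: (le_trans IH); rewrite big_nat_recr//= mulrDl.
  have x0 : 0 <= xn n.+1 by rewrite le_max lexx.
  have xx : xn n.+1 <= xn n.
    have h : L - n.+1%:R <= L - n%:R by rewrite lerB// ler_nat.
    by rewrite /xn ge_max !le_max lexx h orbT.
  have x1 : xn n - xn n.+1 <= 1.
    rewrite /xn; have -> : L - n.+1%:R = L - n%:R - 1 by rewrite -natr1; ring.
    by case: (leP 0 (L - n%:R)) => ?; case: (leP 0 (L - n%:R - 1)) => ?; lra.
  have h : kpp_slope (shoot L) (xn n) <= kpp_slope (shoot L) (xn n.+1) *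
      expR ((lam + ratio n / (lam - mu)) * (xn n - xn n.+1)).
    have [Ln|Ln] := leP (L - n%:R) 0.
      have -> : xn n = 0 by rewrite /xn max_l.
      have -> : xn n.+1 = 0.
        by rewrite /xn max_l// (le_trans _ Ln)// lerB// ler_nat.
      by rewrite subrr mulr0 expR0 mulr1.
    apply: (kpp_slope_growth lam_gt0 mu_lt K_ge0 eta0 eta_nd eta_lip (ltW a0) x0 xx) => t /andP[xt tx].
    have t0 := le_trans x0 xt.
    have tL : t <= L - n%:R by move: tx; rewrite /xn (max_r (ltW Ln)).
    have tL' : t <= L by rewrite (le_trans tL)// gerBl.
    have k1 : kpp (shoot L) t <= expR (- lam * n%:R).
      rewrite (le_trans (kpp_growth lam_gt0 mu_lt K_ge0 eta0 eta_nd eta_lip (ltW a0) t0 tL'))//.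
      by rewrite kpp_shoot// mul1r ler_expR !mulNr lerN2 ler_wpM2l ?(ltW lam_gt0)//; lra.
    have k0 := kpp_ge0 lam_gt0 mu_lt K_ge0 eta0 eta_nd eta_lip (ltW a0) t0.
    rewrite (le_trans (eta_ratio k0 k1))// -mulrA ler_wpM2l// ler_pdivlMl//.
    exact: (kpp_gap lam_gt0 mu_lt K_ge0 eta0 eta_nd eta_lip (ltW a0)).
  have r0 : 0 <= ratio n / (lam - mu) by rewrite divr_ge0// ltW.
  have d0 : 0 <= kpp_slope (shoot L) (xn n.+1).
    exact: (kpp_slope_ge0 lam_gt0 mu_lt K_ge0 eta0 eta_nd eta_lip (ltW a0)).
  move: h d0; move: (kpp_slope _ (xn n)) (kpp_slope _ (xn n.+1)) => X Y h Y0.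
  move: (_ / (lam - mu)) (ratio n / (lam - mu)) r0 h => S r r0 h.
  rewrite -!mulrA -!expRD (le_trans (ler_wpM2r (expR_ge0 _) h))// -mulrA -expRD.
  rewrite ler_wpM2l// ler_expR.
  by have := ler_wpM2l r0 x1; rewrite mulr1 mulrDl; lra.
have [n Ln] : exists n : nat, L <= n%:R.
  by exists (Num.truncn L).+1; rewrite ltW// truncnS_gt.
have := step n.
have -> : xn n = 0 by rewrite /xn max_l// subr_le0.
rewrite kpp_slope0 subr0 -/(amp L) => h.
have h1 : lam - mu <= kpp_slope (shoot L) L.
  have := kpp_gap lam_gt0 mu_lt K_ge0 eta0 eta_nd eta_lip (ltW a0) (ltW L0).
  by rewrite kpp_shoot// mulr1.
rewrite expRN ler_pdivrMr ?expR_gt0// (le_trans h1)// (le_trans h)//.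
rewrite ler_wpM2l//; first by rewrite mulr_ge0 ?expR_ge0// ltW.
by rewrite ler_expR ler_pM2r ?invr_gt0//; exact: eta_sum.
Qed.

(** The ratios are nonincreasing with bounded partial sums, so [j.+1 * ratio j <= Theta]. *)
Let ratio_small (e : R) : 0 < e -> exists j, ratio j <= e.
Proof.
move=> e0; pose j := (Num.truncn (Theta / e)); exists j.
have nincr i : (i <= j)%N -> ratio j <= ratio i.
  move=> ij; rewrite {1}/ratio ler_pdivrMr ?expR_gt0//.
  apply: eta_ratio; first exact: expR_ge0.
  by rewrite ler_expR !mulNr lerN2 ler_wpM2l ?ler_nat// ltW.
have h : ratio j * j.+1%:R <= Theta.
  apply: le_trans (eta_sum j.+1).
  rewrite -[X in _ * X%:R]subn0 mulr_natr -sumr_const_nat.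
  by rewrite big_nat [leRHS]big_nat; apply: ler_sum => i /andP[_ ij]; exact: nincr.
have h2 : Theta / e < j.+1%:R by exact: truncnS_gt.
rewrite ltr_pdivrMr// in h2.
have j0 : 0 < j.+1%:R :> R by rewrite ltr0n.
by rewrite -(ler_pM2r j0) (le_trans h)// ltW// mulrC.
Qed.

Theorem kpp_shoot_limit : exists2 C : R, 0 < C & forall x : R, 0 < x ->
  expR (lam * L) * kpp (shoot L) x @[L --> +oo] --> C * s x.
Proof.
pose c := (lam - mu) * expR (- (Theta / (lam - mu))).
have c0 : 0 < c by rewrite mulr_gt0// expR_gt0.
(* The sign and the clamp at 1 make a function that is nondecreasing and bounded on the whole line,
   to which monotone convergence applies. *)
pose f L := - amp (Num.max 1 L).
have m1 (L : R) : 0 < Num.max 1 L by rewrite lt_max ltr01.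
have fnd : {homo f : n m / n <= m}.
  move=> L1 L2 L12; rewrite lerN2 amp_nincr//.
  by rewrite ge_max !le_max lexx L12 orbT.
have fub : ubound (range f) (- c).
  by move=> _ [L _ <-]; rewrite lerN2; exact: amp_ge.
have fub' : has_ubound (range f) by exists (- c).
have fcvg := nondecreasing_cvgr fnd fub'.
have supc : sup (range f) <= - c.
  by apply: ge_sup => //; exists (f 0), 0.
exists (- sup (range f)) => [|x x0]; first by rewrite oppr_gt0 (le_lt_trans supc)// oppr_lt0.
set C := - sup _.
have acvg : amp L @[L --> +oo] --> C.
  have h : - f L @[L --> +oo] --> C by exact: cvgN.
  apply: cvg_trans h; apply: near_eq_cvg; near=> L.
  have L1 : 1 <= L by near: L; exact: nbhs_pinfty_ge.
  by rewrite /f opprK (max_r L1).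
have C0 : 0 < C by rewrite oppr_gt0 (le_lt_trans supc)// oppr_lt0.
pose B := (C + 1) * expR (theta * x).
have B0 : 0 < B by rewrite mulr_gt0 ?expR_gt0// addr_gt0.
apply/cvgrPdist_lt => e e0.
(* The error of [kpp_small], multiplied by [e^(lam L)], is [ratio j * amp L * e^(theta x)], hence at
   most [ratio j * B] once [amp L < C + 1]. First [j] makes this at most [e / 2]; then [L] is taken
   so large that the solution up to [x] stays below [e^(- lam j)]. *)
have [j je] : exists j, ratio j <= e / 2 / B by apply: ratio_small; rewrite !divr_gt0.
have acvg_s : amp L * s x @[L --> +oo] --> C * s x by apply: cvgM => //; exact: cvg_cst.
near=> L.
have L1 : 1 <= L by near: L; exact: nbhs_pinfty_ge.
have L0 : 0 < L by apply: lt_le_trans L1.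
have a0 := shoot_gt0 L0.
have h1 : `|C * s x - amp L * s x| < e / 2.
  by near: L; move/cvgrPdist_lt : acvg_s; apply; rewrite divr_gt0.
have h2 : amp L < C + 1.
  near: L; have /cvgrPdist_lt/(_ 1 ltr01) := acvg; apply: filterS => L.
  by rewrite distrC => /(le_lt_trans (ler_norm _)); rewrite ltrBlDl.
have h3 : shoot L * expR (theta * x) <= expR (- lam * j%:R).
  have : (theta * x + lam * j%:R + ln (C + 1)) / lam < L.
    by near: L; apply: nbhs_pinfty_gt; exact: num_real.
  rewrite ltr_pdivrMr// => hL.
  have : shoot L <= (C + 1) * expR (- (lam * L)).
    by rewrite expRN ler_pdivlMr ?expR_gt0// ltW.
  move=> /(ler_wpM2r (expR_ge0 (theta * x)))/le_trans; apply.
  rewrite -[X in X * _ * _]lnK ?posrE ?addr_gt0// -!expRD ler_expR mulNr.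
  by move: hL; lra.
have r0 := ratio_ge0 j.
have lo := kpp_lin_ge lam_gt0 mu_lt K_ge0 eta0 eta_nd eta_lip (ltW a0) (ltW x0).
have hi : kpp (shoot L) x <= shoot L * s x + ratio j * shoot L * expR (theta * x).
  apply: (kpp_small lam_gt0 mu_lt K_ge0 eta0 eta_nd eta_lip (ltW a0) (ltW x0) r0) => u u0 hu.
  by apply: eta_ratio => //; exact: le_trans hu h3.
rewrite -/(s x) in lo.
have eL := expR_gt0 (lam * L).
have lo' : amp L * s x <= expR (lam * L) * kpp (shoot L) x.
  by rewrite /amp mulrAC mulrC ler_pM2l.
have hi' : expR (lam * L) * kpp (shoot L) x <= amp L * s x + e / 2.
  rewrite -(ler_pM2l eL) in hi; apply: (le_trans hi).
  rewrite mulrDr /amp [X in X <= _]addrC [X in _ <= X]addrC; apply: lerD; last first.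
    by rewrite mulrA (mulrC (expR _)).
  have -> : expR (lam * L) * (ratio j * shoot L * expR (theta * x)) =
     ratio j * (amp L * expR (theta * x)) by rewrite /amp; ring.
  have : amp L * expR (theta * x) <= B by rewrite ler_pM2r ?expR_gt0// ltW.
  move=> /(ler_wpM2l r0)/le_trans; apply.
  by rewrite -ler_pdivlMr.
move: h1; rewrite !ltr_norml => /andP[h11 h12].
by apply/andP; split; lra.
Unshelve. all: by end_near. Qed.

End shooting.

(** * The offspring law *)

Section offspring_function.
Context {R : realType} (p : nat -> R).
Hypothesis p_pmf : is_pmf p.
Variable m : R.
Hypothesis m_mean : offspring_mean p = m%:E.

Definition offspring_avg (F : nat -> R) : \bar R :=
  (\sum_(0 <= k <oo) (p k * F k)%:E)%E.

Local Notation avg := offspring_avg.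

Let p_ge0 k : 0 <= p k. Proof. exact: p_pmf.1. Qed.

Lemma le_offspring_avg (F G : nat -> R) : (forall k, 0 <= F k <= G k) -> (avg F <= avg G)%E.
Proof.
move=> FG; apply: lee_nneseries => k _.
  by rewrite lee_fin mulr_ge0//; case/andP: (FG k).
by rewrite lee_fin ler_wpM2l//; case/andP: (FG k).
Qed.

Lemma offspring_avg_ge0 (F : nat -> R) : (forall k, 0 <= F k) -> (0 <= avg F)%E.
Proof. by move=> F0; apply: nneseries_ge0 => k _ _; rewrite lee_fin mulr_ge0. Qed.

Lemma offspring_avgD (F G : nat -> R) : (forall k, 0 <= F k) -> (forall k, 0 <= G k) ->
  avg (fun k => F k + G k) = (avg F + avg G)%E.
Proof.
move=> F0 G0; rewrite /offspring_avg -nneseriesD; last 2 first.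
  by move=> k _ _; rewrite lee_fin mulr_ge0.
  by move=> k _ _; rewrite lee_fin mulr_ge0.
by apply: eq_eseriesr => k _; rewrite mulrDr.
Qed.

Lemma offspring_avgZ (c : R) (F : nat -> R) : (forall k, 0 <= F k) ->
  avg (fun k => c * F k) = (c%:E * avg F)%E.
Proof.
move=> F0; rewrite /offspring_avg -nneseriesZl; last first.
  by move=> k _; rewrite lee_fin mulr_ge0.
by apply: eq_eseriesr => k _; rewrite -EFinM mulrCA.
Qed.

Lemma offspring_avg_cst (c : R) : 0 <= c -> avg (fun=> c) = c%:E.
Proof.
move=> c0; have -> : (fun=> c) = (fun k : nat => c * (fun=> 1) k) by apply/funext => k; rewrite mulr1.
rewrite offspring_avgZ// /offspring_avg.
under eq_eseriesr do rewrite mulr1.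
by rewrite p_pmf.2 mule1.
Qed.

Lemma offspring_avg_id : avg (fun k => k%:R) = m%:E.
Proof. by rewrite -m_mean; apply: eq_eseriesr => k _; rewrite mulrC. Qed.

Lemma offspring_avg_fin (F : nat -> R) : (forall k, 0 <= F k <= 1) -> (fine (avg F))%:E = avg F.
Proof.
move=> F01; rewrite fineK// ge0_fin_numE; last first.
  by apply: offspring_avg_ge0 => k; case/andP: (F01 k).
by apply: (le_lt_trans (le_offspring_avg F01)); rewrite offspring_avg_cst ?ltry.
Qed.

(** Clipping extends the success functions from [[0, 1]] to the whole line while keeping them
    monotone and Lipschitz, as the hypotheses on [eta] require. *)
Let clip (u : R) : R := Num.max 0 (Num.min u 1).

Let clip01 u : 0 <= clip u <= 1.
Proof. by rewrite /clip le_max lexx/= ge_max ler01/= ge_min lexx orbT. Qed.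

Let clip_le u v : u <= v -> clip u <= clip v.
Proof.
rewrite /clip => uv; case: (leP u 1) => ?; case: (leP v 1) => ?;
  repeat match goal with |- context[Num.max ?a ?b] => case: (leP a b) => ? end;
  by lra.
Qed.

Let clip_lip u v : u <= v -> clip v - clip u <= v - u.
Proof.
rewrite /clip => uv; case: (leP u 1) => ?; case: (leP v 1) => ?;
  repeat match goal with |- context[Num.max ?a ?b] => case: (leP a b) => ? end;
  by lra.
Qed.

Let clipM c u : 0 <= c <= 1 -> 0 <= u -> c * clip u <= clip (c * u).
Proof.
move=> /andP[c0 c1] u0; rewrite /clip.
have cu : 0 <= c * u by rewrite mulr_ge0.
have cu' : c * u <= u by rewrite ler_piMl.
by case: (leP u 1) => h1; case: (leP (c * u) 1) => h2; rewrite ?max_r//; nra.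
Qed.

(* The probability that at least one of [k] independent subpopulations,
   each with probability [u], succeeds. *)
Definition some_of (k : nat) (u : R) : R := 1 - (1 - clip u) ^+ k.

Lemma some_of01 k u : 0 <= some_of k u <= 1.
Proof.
have /andP[h0 h1] := clip01 u.
by rewrite /some_of subr_ge0 gerBl exprn_ge0 ?subr_ge0//= exprn_ile1 ?subr_ge0// gerBl.
Qed.

Lemma some_ofE k u : 0 <= u <= 1 -> some_of k u = 1 - (1 - u) ^+ k.
Proof. by move=> /andP[u0 u1]; rewrite /some_of /clip min_l// max_r. Qed.

Let some_ofS k u : some_of k.+1 u = clip u + (1 - clip u) * some_of k u.
Proof. by rewrite /some_of exprS; ring. Qed.

Let some_of_nd k u v : u <= v -> some_of k u <= some_of k v.
Proof.
move=> uv; rewrite lerB// lerXn2r ?nnegrE ?subr_ge0 ?lerB ?clip_le//.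
  by case/andP: (clip01 v).
by case/andP: (clip01 u).
Qed.

Let some_of_lip k u v : u <= v -> some_of k v <= some_of k u + k%:R * (v - u).
Proof.
move=> uv; suff : some_of k v <= some_of k u + k%:R * (clip v - clip u).
  by move/le_trans; apply; rewrite lerD2l ler_wpM2l// clip_lip.
elim: k => [|k IH]; first by rewrite /some_of !expr0 mul0r addr0.
have /andP[u0 u1] := clip01 u; have /andP[v0 v1] := clip01 v.
have /andP[s0 s1] := some_of01 k v; have := clip_le uv.
rewrite !some_ofS -natr1; move: IH; set x := some_of k v; set y := some_of k u.
move: (clip u) (clip v) u0 u1 v0 v1 => a b a0 a1 b0 b1 IH ab.
have k0 : 0 <= k%:R * (b - a) by rewrite mulr_ge0// subr_ge0.
have h : (1 - a) * (x - y) <= k%:R * (b - a).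
  have [yx|/ltW xy] := leP y x; last by nra.
  by rewrite (@le_trans _ _ (1 * (x - y)))// ?ler_wpM2r ?subr_ge0 ?gerBl//; lra.
have bx : 0 <= (b - a) * x by rewrite mulr_ge0// subr_ge0.
by lra.
Qed.

(** Concavity of [1 - (1 - u)^k] on [[0, 1]] together with its value 0 at 0; clipping is compatible
    with it by [clipM]. *)
Let some_of_star k c u : 0 <= c <= 1 -> 0 <= u -> c * some_of k u <= some_of k (c * u).
Proof.
move=> c01 u0; have h := clipM c01 u0.
have /andP[u1 u2] := clip01 u; have /andP[v1 v2] := clip01 (c * u).
case/andP: c01 => c0 c1.
have {h} h : (1 - clip (c * u)) ^+ k <= (1 - c * clip u) ^+ k.
  by rewrite lerXn2r ?nnegrE ?subr_ge0 ?lerB// mulr_ile1.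
suff {h} h2 : (1 - c * clip u) ^+ k <= 1 - c * (1 - (1 - clip u) ^+ k).
  by rewrite /some_of; lra.
move: (clip u) u1 u2 => a a0 a1.
elim: k => [|k IH]; first by rewrite !expr0 subrr mulr0 subr0.
rewrite !exprS; move: IH.
have : 0 <= (1 - a) ^+ k <= 1 by rewrite exprn_ge0 ?subr_ge0// exprn_ile1 ?subr_ge0// gerBl.
have : 0 <= (1 - c * a) ^+ k by rewrite exprn_ge0 ?subr_ge0 ?mulr_ile1.
move: ((1 - a) ^+ k) ((1 - c * a) ^+ k) => y x x0 /andP[y0 y1] IH.
have ca : 0 <= 1 - c * a by rewrite subr_ge0 mulr_ile1.
have := ler_wpM2l ca IH.
have : 0 <= a * c * (1 - c) * (1 - y) by rewrite !mulr_ge0 ?subr_ge0.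
by nra.
Qed.

Definition offspring_success (u : R) : R := fine (avg (some_of^~ u)).
Local Notation g := offspring_success.

Lemma offspring_successE u : (g u)%:E = avg (some_of^~ u).
Proof. by apply: offspring_avg_fin => k; exact: some_of01. Qed.

Lemma offspring_success01 u : 0 <= g u <= 1.
Proof.
rewrite -!lee_fin offspring_successE; apply/andP; split.
  by apply: offspring_avg_ge0 => k; case/andP: (some_of01 k u).
rewrite -(offspring_avg_cst ler01).
by apply: le_offspring_avg => k; exact: some_of01.
Qed.

Lemma offspring_success0 : g 0 = 0.
Proof.
rewrite /offspring_success.
have -> : (some_of^~ 0) = (fun=> 0).
  apply/funext => k; rewrite /some_of /clip.
  by rewrite min_l// maxxx subr0 expr1n subrr.
by rewrite offspring_avg_cst.
Qed.

Lemma offspring_success_nd u v : u <= v -> g u <= g v.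
Proof.
move=> uv; rewrite -lee_fin !offspring_successE; apply: le_offspring_avg => k.
by rewrite some_of_nd// andbT; case/andP: (some_of01 k u).
Qed.

Lemma offspring_success_lip u v : u <= v -> g v - g u <= m * (v - u).
Proof.
move=> uv; have d0 : 0 <= v - u by rewrite subr_ge0.
rewrite lerBlDl -lee_fin EFinD EFinM !offspring_successE -offspring_avg_id muleC.
rewrite -offspring_avgZ// -offspring_avgD//; last 2 first.
  by move=> k; case/andP: (some_of01 k u).
  by move=> k; rewrite mulr_ge0.
apply: le_offspring_avg => k; rewrite mulrC some_of_lip// andbT.
by case/andP: (some_of01 k v).
Qed.

Lemma offspring_success_star c u : 0 <= c <= 1 -> 0 <= u -> c * g u <= g (c * u).
Proof.
move=> c01 u0; rewrite -lee_fin EFinM !offspring_successE -offspring_avgZ; last first.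
  by move=> k; case/andP: (some_of01 k u).
apply: le_offspring_avg => k; rewrite some_of_star// andbT mulr_ge0//.
  by case/andP: c01.
by case/andP: (some_of01 k u).
Qed.

Let second_order k e : 0 <= e <= 1 -> k%:R * e - some_of k e <= k%:R ^+ 2 * e ^+ 2.
Proof.
move=> /andP[e0 e1].
suff : (1 - e) ^+ k <= 1 - k%:R * e + k%:R ^+ 2 * e ^+ 2.
  by rewrite /some_of /clip min_l// max_r//; lra.
elim: k => [|k IH]; first by rewrite expr0 expr2 !mul0r subr0 addr0.
rewrite exprS -natr1; have e1' : 0 <= 1 - e by rewrite subr_ge0.
have := ler_wpM2l e1' IH.
have : 0 <= k%:R :> R by [].
move: ((1 - e) ^+ k) (k%:R : R) => x y y0 h; apply: (le_trans h).
rewrite -subr_ge0.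
have : 0 <= y ^+ 2 * (e ^+ 2 * e) by rewrite !mulr_ge0 ?sqr_ge0.
have : 0 <= y * e ^+ 2 by rewrite mulr_ge0 ?sqr_ge0.
have : 0 <= e ^+ 2 by rewrite sqr_ge0.
by nra.
Qed.

(** Bound for [(k e - some_of k e) / e]: the trivial bound [k] and the second-order bound [k^2 e],
    which cross at [k e = 1]. *)
Let defect k (e : R) : R := Num.min k%:R (k%:R ^+ 2 * e).

Let defect_ge0 k e : 0 <= e -> 0 <= defect k e.
Proof. by move=> e0; rewrite /defect le_min ler0n mulr_ge0 ?sqr_ge0. Qed.

Let defect_avg e : 0 < e -> e <= 1 -> (((m * e - g e) / e)%:E <= avg (defect^~ e))%E.
Proof.
move=> e0 e1; have e01 : 0 <= e <= 1 by rewrite (ltW e0).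
rewrite mulrC EFinM -[leRHS]mul1e -(mulVf (lt0r_neq0 e0)) EFinM -muleA.
apply: lee_wpmul2l; first by rewrite lee_fin invr_ge0 ltW.
rewrite -offspring_avgZ; last by move=> k; exact: defect_ge0 (ltW e0).
rewrite EFinB leeBlDl// offspring_successE EFinM -offspring_avg_id muleC.
rewrite -offspring_avgZ// -offspring_avgD; last 2 first.
  by move=> k; case/andP: (some_of01 k e).
  by move=> k; rewrite mulr_ge0 ?(ltW e0)// defect_ge0 ?ltW.
apply: le_offspring_avg => k; rewrite mulr_ge0 ?(ltW e0)//=.
rewrite -lerBlDl /defect minr_pMr ?(ltW e0)// le_min; apply/andP; split.
  by rewrite gerBl; case/andP: (some_of01 k e).
by have := second_order k e01; rewrite expr2; lra.
Qed.

Variable lam : R.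
Hypothesis lam_gt0 : 0 < lam.
Hypothesis p_klogk : (\sum_(1 <= k <oo) (k%:R * ln k%:R * p k)%:E < +oo)%E.

Let q := expR (- lam).
Let q1 : q < 1. Proof. by rewrite /q -expR0 ltr_expR oppr_lt0. Qed.
(** It collects [k] times the number of summands before decay sets in, at most [ln k / lam + 1], and
    [k] times a geometric series of ratio [q]. *)
Let bound (k : nat) : R := lam^-1 * (k%:R * ln k%:R) + (1 + (1 - q)^-1) * k%:R.

Let bound_ge0 k : 0 <= bound k.
Proof.
have h : 0 <= (1 - q)^-1 by rewrite invr_ge0 subr_ge0 ltW.
rewrite addr_ge0// mulr_ge0 ?addr_ge0//; first by rewrite invr_ge0 ltW.
by case: k => [|k]; rewrite ?mul0r// mulr_ge0// ln_ge0 ?ler1n.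
Qed.

(* The summands are at most [k], and decay geometrically once [k e^{-lam j} <= 1],
   i.e. for [j >= ln k / lam]. *)
Let sum_defect k n : \sum_(0 <= j < n) defect k (expR (- lam * j%:R)) <= bound k.
Proof.
case: k => [|k].
  by rewrite big1 ?bound_ge0// => j _; rewrite /defect expr2 !mul0r minxx.
have k0 : 0 < k.+1%:R :> R by [].
set kR := k.+1%:R in k0 *.
have l0 : 0 <= ln kR / lam by rewrite divr_ge0 ?(ltW lam_gt0)// ln_ge0// /kR ler1n.
pose J := (Num.truncn (ln kR / lam)).+1.
have J1 : ln kR / lam < J%:R by exact: truncnS_gt.
have J2 : J%:R <= ln kR / lam + 1.
  by rewrite /J -natr1 lerD2r truncn_le.
have q0 : 0 <= q by exact: expR_ge0.
have q1' : 0 < 1 - q by rewrite subr_gt0.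
have e0 j : 0 <= expR (- lam * j%:R) by exact: expR_ge0.
have small n' : (n' <= J)%N -> \sum_(0 <= j < n') defect k.+1 (expR (- lam * j%:R)) <= kR * J%:R.
  move=> nJ; apply: (@le_trans _ _ (kR * n'%:R)); last by rewrite ler_pM2l// ler_nat.
  rewrite mulr_natr -[X in _ *+ X]subn0 -sumr_const_nat; apply: ler_sum => j _.
  by rewrite /defect ge_min lexx.
have large i : \sum_(0 <= j < J + i) defect k.+1 (expR (- lam * j%:R)) <=
    kR * J%:R + kR * ((1 - q ^+ i) / (1 - q)).
  elim: i => [|i IH]; first by rewrite addn0 expr0 subrr mul0r mulr0 addr0 small.
  rewrite addnS big_nat_recr//=.
  have h : defect k.+1 (expR (- lam * (J + i)%:R)) <= kR * q ^+ i.
    rewrite /defect ge_min; apply/orP; right; rewrite expr2 -mulrA ler_pM2l//.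
    rewrite natrD mulrDr expRD mulrA /q -expRM_natr ler_piMl ?expR_ge0//.
    rewrite -[X in X * _]lnK// -expRD -[leRHS]expR0 ler_expR mulNr subr_le0 mulrC.
    by rewrite -ler_pdivrMr// ltW.
  apply: (le_trans (lerD IH h)); rewrite -addrA lerD2l -mulrDr ler_pM2l//.
  rewrite -{2}[q ^+ i](mulfK (lt0r_neq0 q1')) -mulrDl ler_pM2r ?invr_gt0// exprS.
  by lra.
have final : kR * J%:R + kR * (1 - q)^-1 <= bound k.+1.
  have := ler_wpM2l (ltW k0) J2; rewrite /bound -/kR; lra.
have [nJ|/ltnW Jn] := leqP n J.
  apply: (le_trans (small _ nJ)); apply: le_trans final.
  by rewrite lerDl mulr_ge0 ?(ltW k0)// invr_ge0 ltW.
rewrite -(subnKC Jn); apply: (le_trans (large _)); apply: le_trans final.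
rewrite lerD2l ler_pM2l// ler_piMl ?invr_ge0 ?(ltW q1')//.
by rewrite gerBl exprn_ge0.
Qed.

Let bound_fin : (avg bound < +oo)%E.
Proof.
have h : 0 <= (1 - q)^-1 by rewrite invr_ge0 subr_ge0 ltW.
have kl k : 0 <= k%:R * ln k%:R :> R.
  by case: k => [|k]; rewrite ?mul0r// mulr_ge0// ln_ge0 ?ler1n.
rewrite /bound offspring_avgD; last 2 first.
  by move=> k; rewrite mulr_ge0// invr_ge0 ltW.
  by move=> k; rewrite mulr_ge0// addr_ge0.
rewrite !offspring_avgZ// offspring_avg_id lte_add_pinfty ?ltry//.
rewrite lte_mul_pinfty ?lee_fin ?invr_ge0 ?(ltW lam_gt0)//.
(* The moment hypothesis sums from [k = 1] and the average from [k = 0], where the term is 0. *)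
rewrite /offspring_avg (nneseries_split _ 1%N); last first.
  by move=> k _; rewrite lee_fin mulr_ge0.
rewrite add0n big_nat1 !mul0r mulr0 add0e.
under eq_eseriesr do rewrite mulrC.
exact: p_klogk.
Qed.

(** The sum over [j] is exchanged with the average over [k]: for fixed [k] about [ln k / lam] scales
    contribute [k] each, so the total is of order [k log k]. The moment condition enters here. *)
Lemma offspring_defect_sum : exists C : R, forall n : nat,
  \sum_(0 <= j < n) (m * expR (- lam * j%:R) - g (expR (- lam * j%:R))) / expR (- lam * j%:R) <= C.
Proof.
exists (fine (avg bound)) => n.
have fin : avg bound \is a fin_num by rewrite ge0_fin_numE// offspring_avg_ge0.
rewrite -lee_fin fineK//.
apply: (@le_trans _ _ (avg (fun k => \sum_(0 <= j < n) defect k (expR (- lam * j%:R))))); last first.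
  apply: le_offspring_avg => k; rewrite sum_defect andbT.
  by apply: sumr_ge0 => j _; rewrite defect_ge0 ?expR_ge0.
elim: n => [|n IH].
  rewrite big_geq//; apply: offspring_avg_ge0 => k.
  by apply: sumr_ge0 => j _; rewrite defect_ge0 ?expR_ge0.
rewrite big_nat_recr//= EFinD.
under [X in (_ <= avg X)%E]eq_fun do rewrite big_nat_recr//=.
rewrite offspring_avgD; last 2 first.
  by move=> k; apply: sumr_ge0 => j _; rewrite defect_ge0 ?expR_ge0.
  by move=> k; rewrite defect_ge0 ?expR_ge0.
apply: leeD => //; apply: defect_avg; first exact: expR_gt0.
by rewrite -expR0 ler_expR mulNr oppr_le0 mulr_ge0// ltW.
Qed.

End offspring_function.

(** * Independence of blocks and freezing *)

Section block_independence.
Context {R : realType} {d : measure_display} {T : measurableType d}.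
Variable P : probability T R.

Definition independent_classes (G H : set (set T)) : Prop :=
  forall A B, G A -> H B -> P (A `&` B) = (P A * P B)%E.

Lemma independent_classesC G H : independent_classes G H -> independent_classes H G.
Proof. by move=> GH A B HA GB; rewrite setIC GH// muleC. Qed.

(** For fixed [B] in [H], the probability of the intersection with [B] and the product with [P B]
    are two finite measures that agree on the pi-system [G], hence on the sigma-algebra it
    generates. *)
Lemma independent_classes_sigma (G H : set (set T)) :
  G `<=` measurable -> H `<=` measurable -> setI_closed G -> G setT ->
  independent_classes G H -> independent_classes <<s G >> H.
Proof.
move=> Gm Hm GI GT GH A B sA HB.
have mB := Hm _ HB.
have PB0 : 0 <= fine (P B) by exact: fine_ge0.
pose m1 : {measure set T -> \bar R} := mrestr P mB.
pose m2 : {measure set T -> \bar R} := mscale (NngNum PB0) P.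
suff : m1 A = m2 A by rewrite /m1 /m2 /= /mrestr /mscale/= fineK ?fin_num_measure// muleC.
apply: (@g_sigma_algebra_measure_unique _ R T G Gm (fun _ : nat => setT) (fun=> GT) _ m1 m2 GI _ _ A sA) => //.
- by apply/seteqP; split => // x _; exists 0%N.
- move=> X GX; rewrite /m1 /m2 /= /mrestr /mscale/= GH// fineK ?fin_num_measure// muleC.
  by [].
- move=> _; apply: le_lt_trans (ltry 1); apply: probability_le1.
  exact: measurableI.
Qed.

Variables (J : eqType) (F : J -> set (set T)).
Hypotheses (Fm : forall i, F i `<=` measurable) (FI : forall i, setI_closed (F i))
  (FT : forall i, F i setT) (Findep : mutually_independent P F).

Let cap (s : seq J) (f : J -> set T) : set T := \bigcap_(i in [set` s]) f i.

Let cap_prob s f : uniq s -> (forall i, F i (f i)) -> P (cap s f) = (\prod_(i <- s) P (f i))%E.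
Proof.
move=> us Ff; case: s us => [|i0 s'] us; first by rewrite /cap set_nil bigcap_set0 big_nil probability_setT.
set s := i0 :: s'.
pose j (k : 'I_(size s)) := nth i0 s k.
have jinj : injective j.
  move=> k l /eqP; rewrite /j nth_uniq// => /eqP ?; exact/val_inj.
have := Findep jinj (fun k => Ff (j k)).
rewrite (big_nth i0) big_mkord => <-; congr (P _).
rewrite /cap; apply/seteqP; split => [w h k _|w h i /= si].
  by apply: h => /=; exact: mem_nth.
have si' : (index i s < size s)%N by rewrite index_mem.
by have := h (Ordinal si') I; rewrite /j /= nth_index.
Qed.

(** Finite intersections of events with indices in [A]: a pi-system containing all [F i] with [i] in
    [A], on which independence is a finite product formula. *)
Let block (A : set J) : set (set T) :=
  [set X | exists s f, [/\ forall i, F i (f i), forall i, i \in s -> A i & X = cap s f]].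

Let block_m A : block A `<=` measurable.
Proof.
move=> _ [s [f [Ff _ ->]]]; apply: fin_bigcap_measurable => // i _.
exact: Fm (Ff i).
Qed.

Let block_T A : block A setT.
Proof. by exists [::], (fun=> setT); split => //; rewrite /cap set_nil bigcap_set0. Qed.

(** Padding by [setT] writes intersections over different lists as intersections over all indices,
    so that two of them combine index by index. *)
Let merge (s : seq J) (f : J -> set T) i := if i \in s then f i else setT.

Let merge_F s f : (forall i, F i (f i)) -> forall i, F i (merge s f i).
Proof. by move=> Ff i; rewrite /merge; case: ifP. Qed.

Let merge_cap s f : cap s f = \bigcap_i merge s f i.
Proof.
apply/seteqP; split => [w h i _|w h i /= si]; last by have := h i I; rewrite /merge si.
by rewrite /merge; case: ifPn => // si; exact: h.
Qed.

Let block_I A : setI_closed (block A).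
Proof.
move=> _ _ [s [f [Ff sA ->]]] [t [g [Fg tA ->]]].
exists (s ++ t), (fun i => merge s f i `&` merge t g i); split.
- by move=> i; apply: FI; exact: merge_F.
- by move=> i; rewrite mem_cat => /orP[/sA|/tA].
- rewrite !merge_cap; apply/seteqP; split => [w [h1 h2] i _|w h].
    by rewrite {1}/merge; case: ifP => // _; split; [exact: h1|exact: h2].
  split=> i _; have := h i I; rewrite /merge mem_cat; case: (i \in s) => //=.
  - by case.
  - by case: (i \in t) => // -[].
  - by case: (i \in t) => // -[].
Qed.

Let block_F A i : A i -> F i `<=` block A.
Proof.
move=> Ai X FX; exists [:: i], (fun j => if j == i then X else setT); split.
- by move=> j; case: eqP => [->|].
- by move=> j; rewrite inE => /eqP ->.
- apply/seteqP; split => [w Xw j /=|w /(_ i)]; last by rewrite /= inE eqxx; exact.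
  by rewrite inE => ->.
Qed.

Let block_indep A B : A `&` B = set0 -> independent_classes (block A) (block B).
Proof.
move=> AB _ _ [s [f [Ff sA ->]]] [t [g [Fg tB ->]]].
pose h i := if i \in s then f i else g i.
have Fh i : F i (h i) by rewrite /h; case: ifP.
(* Lists may repeat an index whereas [mutually_independent] speaks of injective families, hence
   [undup]. *)
have capu u k : cap u k = cap (undup u) k.
  by rewrite /cap; congr bigcap; apply/seteqP; split => i /=; rewrite mem_undup.
have st i : i \in s -> i \in t -> False.
  by move=> /sA Ai /tB Bi; have : (A `&` B) i by []; rewrite AB.
have capf : cap (undup s) f = cap (undup s) h.
  rewrite /cap; apply: eq_bigcapr => i /=.
  by rewrite mem_undup /h => ->.
have capg : cap (undup t) g = cap (undup t) h.
  rewrite /cap; apply: eq_bigcapr => i /=.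
  by rewrite mem_undup /h => it; case: ifP => // si; case: (st i).
rewrite (capu s) (capu t) capf capg.
have -> : cap (undup s) h `&` cap (undup t) h = cap (undup s ++ undup t) h.
  rewrite /cap; apply/seteqP; split => [w [h1 h2] i /=|w h1].
    by rewrite mem_cat => /orP[]; [exact: h1|exact: h2].
  by split => i /= si; apply: h1; rewrite /= mem_cat si ?orbT.
rewrite !cap_prob ?undup_uniq//; last first.
  rewrite cat_uniq !undup_uniq andbT/=; apply/hasPn => i; rewrite !mem_undup => it.
  by apply/negP => si; exact: st si it.
by rewrite big_cat.
Qed.

Definition sigma_block (A : set J) : set (set T) := \bigcup_(i in A) F i.

Lemma sigma_block_measurable A : sigma_block A `<=` measurable.
Proof. by move=> X [i _]; exact: Fm. Qed.

Lemma sigma_block_independent (A B : set J) : A `&` B = set0 ->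
  independent_classes <<s sigma_block A >> <<s sigma_block B >>.
Proof.
move=> AB.
have sub C : <<s sigma_block C >> `<=` <<s block C >>.
  by apply: sub_sigma_algebra2 => X [i Ci FX]; exact: block_F FX.
have mB : <<s block B >> `<=` measurable.
  by apply: smallest_sub; [exact: sigma_algebra_measurable|exact: block_m].
move=> X Y /sub sX /sub sY; move: X Y sX sY.
apply: independent_classes_sigma => //.
apply: independent_classesC; apply: independent_classes_sigma => //.
by apply: independent_classesC; exact: block_indep.
Qed.

End block_independence.

(** The identity, read as a random variable into the same space with a coarser sigma-algebra:
    [freezing], a statement about random variables, thereby covers independent
    sub-sigma-algebras. *)
Lemma measurable_id_sigma {d : measure_display} {T : measurableType d}
    (G : set (set T)) : G `<=` measurable ->
  measurable_fun setT (id : T -> g_sigma_algebraType G).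
Proof.
move=> Gm _ Y mY; rewrite setTI preimage_id.
by apply: (smallest_sub _ Gm) mY; exact: sigma_algebra_measurable.
Qed.

(** * Freezing one of two independent variables *)

Section freezing.
Context {R : realType} {d dA dB : measure_display} {T : measurableType d}
  {TA : measurableType dA} {TB : measurableType dB}.
Variables (P : probability T R) (fA : T -> TA) (fB : T -> TB).
Hypotheses (mA : measurable_fun setT fA) (mB : measurable_fun setT fB).

Let XA : {mfun T >-> TA} := HB.pack fA (isMeasurableFun.Build _ _ _ _ _ mA).
Let XB : {mfun T >-> TB} := HB.pack fB (isMeasurableFun.Build _ _ _ _ _ mB).

Let measurable_diag : measurable_fun setT (fun w : T => (XA w, XB w)).
Proof. exact: measurable_fun_pair. Qed.

Let XAB : {mfun T >-> (TA * TB)%type} := HB.pack (fun w : T => (XA w, XB w))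
  (isMeasurableFun.Build _ _ _ _ _ measurable_diag).

Variable F : TA * TB -> \bar R.
Hypotheses (mF : measurable_fun setT F) (F0 : forall z, (0 <= F z)%E).

Lemma measurable_frozen : measurable_fun setT (fun a => \int[P]_w' F (a, fB w'))%E.
Proof.
have -> : (fun a => \int[P]_w' F (a, fB w'))%E =
  (fun a => \int[distribution P XB]_b F (a, b))%E.
  apply/funext => a /=; rewrite ge0_integral_distribution//.
  by apply: measurableT_comp => //; exact: measurable_pair1.
exact: (@measurable_fun_fubini_tonelli_F _ _ _ _ _ (distribution P XB) F mF F0).
Qed.

Hypothesis AB : forall A B, measurable A -> measurable B ->
  P (fA @^-1` A `&` fB @^-1` B) = (P (fA @^-1` A) * P (fB @^-1` B))%E.

(** Independence on rectangles identifies the joint law of [fA] and [fB] with the product of their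
    laws; Tonelli then integrates over [fB] with [fA] fixed. *)
Lemma freezing : (\int[P]_w F (fA w, fB w) = \int[P]_w \int[P]_w' F (fA w, fB w'))%E.
Proof.
transitivity (\int[distribution P XAB]_z F z)%E.
  by rewrite ge0_integral_distribution.
transitivity (\int[(distribution P XA \x distribution P XB)%E]_z F z)%E.
  apply: eq_measure_integral => A mA' _; apply/esym.
  by apply: product_measure_unique => // B C mB' mC; exact: AB.
rewrite fubini_tonelli1// /fubini_F ge0_integral_distribution//; last 2 first.
  exact: (@measurable_fun_fubini_tonelli_F _ _ _ _ _ (distribution P XB) F mF F0).
  by move=> w; apply: integral_ge0.
apply: eq_integral => w _ /=; rewrite ge0_integral_distribution//.
by apply: measurableT_comp => //; exact: measurable_pair1.
Qed.

End freezing.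

(** * Paths and their discretisation *)

Section paths.
Context {R : realType}.
Implicit Types (X : R -> R) (y L t e z : R) (xi Y : nat -> R).

Definition positive_until X t := forall s, 0 <= s <= t -> 0 < X s.

(** The time is strictly below [L] because a particle no longer belongs to the population at its
    death time. *)
Definition hits y X L := exists t, [/\ 0 <= t < L, y < X t & positive_until X t].

Lemma continuous_ge0P X : continuous_ge0 X -> forall t e, 0 <= t -> 0 < e ->
  exists2 r, 0 < r & forall s, 0 <= s -> `|s - t| < r -> `|X s - X t| < e.
Proof.
move=> cX t e t0 e0.
have /cvgrPdist_lt/(_ e e0) := cX t; rewrite /= (max_r t0).
move=> /nbhs_ballP[r /= r0 h]; exists r => // s s0 st.
have ts : ball t r s by rewrite /ball/= distrC.
by have := h _ ts; rewrite /= (max_r s0) distrC.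
Qed.

(* Value at time [min k sigma] of the walk with increments [xi], read off by
   [Phi], where [sigma] is the first exit time from [D]. *)
Fixpoint stopped (D : R -> bool) (Phi : R -> R) k z xi : R :=
  if k is k'.+1 then
    if D z then stopped D Phi k' (z + xi 0%N) (fun l => xi l.+1) else Phi z
  else Phi z.

Lemma stopped_cases D Phi k z xi Y : (forall i, Y i = z + \sum_(0 <= l < i) xi l) ->
  exists i, [/\ (i <= k)%N, stopped D Phi k z xi = Phi (Y i),
    (forall j, (j < i)%N -> D (Y j)) & ((i < k)%N -> ~~ D (Y i))].
Proof.
elim: k z xi Y => [|k IH] z xi Y YE.
  by exists 0%N; split => //=; rewrite YE big_geq// addr0.
have Y0 : Y 0%N = z by rewrite YE big_geq// addr0.
have [Dz|nDz] := boolP (D z); last first.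
  by exists 0%N; split => //=; rewrite ?Y0// (negbTE nDz).
have [|i [ik sE iD iN]] := IH (z + xi 0%N) (fun l => xi l.+1) (fun i => Y i.+1).
  by move=> i; rewrite YE big_nat_recl// addrA.
exists i.+1; split => //=; first by rewrite Dz.
by case=> [|j]; [rewrite Y0|rewrite ltnS => /iD].
Qed.

Lemma stopped_ge0 D Phi k z xi : (forall x, 0 <= Phi x) -> 0 <= stopped D Phi k z xi.
Proof. by move=> Phi0; elim: k z xi => [|k IH] z xi //=; case: ifP. Qed.

Definition mesh (n : nat) : R := n.+1%:R^-1.

Lemma mesh_gt0 n : 0 < mesh n. Proof. by rewrite invr_gt0. Qed.

Lemma mesh_small r : 0 < r -> exists n0, forall n, (n0 <= n)%N -> mesh n < r.
Proof.
move=> r0; exists (Num.truncn r^-1) => n n0.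
rewrite /mesh invf_plt ?posrE//; apply: lt_le_trans (truncnS_gt _) _.
by rewrite ler_nat.
Qed.

Definition grid (n : nat) t : nat := Num.truncn (t / mesh n).

Lemma gridP n t : 0 <= t -> (grid n t)%:R * mesh n <= t < (grid n t)%:R * mesh n + mesh n.
Proof.
move=> t0; have m0 := mesh_gt0 n.
rewrite -ler_pdivlMr// -{3}[mesh n]mul1r -mulrDl natr1 -ltr_pdivrMr//.
by apply: truncn_itv; rewrite divr_ge0// ltW.
Qed.

Lemma le_grid n t k : 0 <= t -> k%:R * mesh n <= t -> (k <= grid n t)%N.
Proof.
move=> t0 kt; have m0 := mesh_gt0 n.
have tm : 0 <= t / mesh n by rewrite divr_ge0// ltW.
by rewrite /grid truncn_ge_nat// ler_pdivlMr.
Qed.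

Lemma first_nonpositive X L : continuous_ge0 X -> 0 <= L -> ~ positive_until X L ->
  exists t, [/\ 0 <= t <= L, X t <= 0 & forall s, 0 <= s < t -> 0 < X s].
Proof.
move=> cX L0 npos; pose A := [set s | 0 <= s <= L /\ X s <= 0].
have A0 : A !=set0.
  have /existsNP[s /not_implyP[sL /negP]] := npos.
  by rewrite -leNgt => Xs; exists s.
have lA : has_inf A by split => //; exists 0 => s [/andP[]].
have t0 : 0 <= inf A by apply: lb_le_inf => // s [/andP[]].
have tA s : A s -> inf A <= s by move=> As; exact: ge_inf lA.2 _ As.
exists (inf A); split.
- by rewrite t0/=; case: A0 => s As; have [/andP[_ sL] _] := As; exact: le_trans (tA _ As) sL.
- rewrite leNgt; apply/negP => Xt.
  have [r r0 h] := continuous_ge0P cX t0 Xt.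
  have [s As st] := inf_adherent r0 lA.
  have [/andP[s0 sL] Xs] := As.
  have := h s s0; rewrite ger0_norm ?subr_ge0 ?tA// ltrBlDl => /(_ st).
  by rewrite ltr_norml => /andP[]; lra.
- move=> s /andP[s0 st]; rewrite ltNge; apply/negP => Xs.
  have [/andP[tt tL]] : 0 <= inf A <= L /\ True.
    by split => //; rewrite t0/=; case: A0 => u Au; have [/andP[_ uL] _] := Au; exact: le_trans (tA _ Au) uL.
  have : A s by split => //; rewrite s0/= (le_trans (ltW st)).
  by move=> /tA; rewrite leNgt st.
Qed.

(** One generation: [gam] is the value handed over at the place of death. With [c1 = 1] and [c0 = 0]
    this measures success; with [c1 = 0], [c0 = 1] and [1 - gam] for [gam] it measures failure. *)
Definition payoff y X L (c1 c0 : R) (gam : R -> R) : R :=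
  if `[< hits y X L >] then c1
  else if `[< positive_until X L >] then gam (X L) else c0.

Section grid_limit.
Variables (X : R -> R) (L y : R) (gam : R -> R).
Hypotheses (cX : continuous_ge0 X) (L0 : 0 < L) (cgam : continuous gam)
  (gam01 : forall x, 0 <= gam x <= 1).
Variable xi : nat -> nat -> R.
Hypothesis xiE : forall n i, X (i%:R * mesh n) = X 0 + \sum_(0 <= l < i) xi n l.

Let gamX e : 0 < e -> exists2 r, 0 < r & forall s, 0 <= s -> `|s - L| < r -> gam (X L) <= gam (X s) + e.
Proof.
move=> e0; have cg : continuous_ge0 (gam \o X) by exact: continuous_ge0_comp.
have [r r0 h] := continuous_ge0P cg (ltW L0) e0.
exists r => // s s0 sL; have /= := h s s0 sL.
by rewrite ltr_norml => /andP[]; lra.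
Qed.

Let nohit t : ~ hits y X L -> 0 <= t < L -> positive_until X t -> X t <= y.
Proof. by move=> nh tL pt; rewrite leNgt; apply/negP => yt; apply: nh; exists t. Qed.

(** [hits] tests only times before [L]; continuity extends the bound to [L] itself. *)
Let nohit_end t : ~ hits y X L -> positive_until X L -> 0 <= t <= L -> X t <= y.
Proof.
move=> nh pL.
have h s : 0 <= s < L -> X s <= y.
  move=> /andP[s0 sL]; apply: nohit => //; first by rewrite s0.
  by move=> u /andP[u0 us]; apply: pL; rewrite u0/= (le_trans us)// ltW.
move=> /andP[t0]; rewrite le_eqVlt => /predU1P[->|tL]; last by apply: h; rewrite t0.
rewrite leNgt; apply/negP => yL.
have e0 : 0 < X L - y by rewrite subr_gt0.
have [r r0 hr] := continuous_ge0P cX (ltW L0) e0.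
pose s := Num.max 0 (L - r / 2).
have s0 : 0 <= s by rewrite le_max lexx.
have sL : s < L by rewrite gt_max L0/= ltrBlDl ltrDr divr_gt0.
have : `|s - L| < r.
  rewrite distrC ger0_norm ?subr_ge0 ?(ltW sL)// ltrBlDl -ltrBlDr lt_max.
  by apply/orP; right; lra.
move=> /(hr s s0); rewrite ltr_norml => /andP[+ _].
by have := h s; rewrite s0 sL => /(_ isT); lra.
Qed.

Let g0 n k : 0 <= k%:R * mesh n. Proof. by rewrite mulr_ge0// ltW// mesh_gt0. Qed.

Let le_mesh n i k : (i <= k)%N -> i%:R * mesh n <= k%:R * mesh n.
Proof. by move=> ik; rewrite ler_pM2r ?mesh_gt0// ler_nat. Qed.

(** The grid errs on the right side: missing a visit below 0 only increases the payoff, while an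
    excursion above [y] lasts for a while and is seen by a fine mesh. Without hit or killing, the
    walk is read off at a grid time close to [L], where [gam] is continuous along the path. *)
Lemma payoff_le_stopped_up e : 0 < e -> exists n0, forall n, (n0 <= n)%N ->
  payoff y X L 1 0 gam <= stopped (fun x => (0 < x) && (x <= y))
    (fun x => if x <= 0 then 0 else if y < x then 1 else gam x) (grid n L) (X 0) (xi n) + e.
Proof.
move=> e0; rewrite /payoff; set D := fun x => _ && _; set Phi := fun x => if x <= 0 then _ else _.
case: asboolP => [[t [/andP[t0 tL] yt pt]]|nh].
  have Xt : 0 < X t by apply: pt; rewrite t0 lexx.
  have m0 : 0 < X t - Num.max 0 y by rewrite subr_gt0 gt_max Xt.
  have [r r0 hr] := continuous_ge0P cX t0 m0.
  have r'0 : 0 < Num.min r (L - t) by rewrite lt_min r0 subr_gt0.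
  have [n0 hn] := mesh_small r'0; exists n0 => n /hn; rewrite lt_min => /andP[d1 d2].
  have [i [ik -> iD iN]] := @stopped_cases D Phi (grid n L) (X 0) (xi n) (fun i => X (i%:R * mesh n)) (xiE n).
  have /andP[g1 g2] := gridP n t0.
  pose k := (grid n t).+1.
  have kE : k%:R * mesh n = (grid n t)%:R * mesh n + mesh n by rewrite /k -natr1 mulrDl mul1r.
  have near s : 0 <= s -> t <= s -> s <= k%:R * mesh n -> Num.max 0 y < X s.
    move=> s0 ts sk; have : `|s - t| < r by rewrite ger0_norm ?subr_ge0//; lra.
    by move=> /(hr s s0); rewrite ltr_norml => /andP[]; lra.
  have Xk : Num.max 0 y < X (k%:R * mesh n) by apply: near => //; rewrite kE ltW.
  have kN : (k <= grid n L)%N by apply: le_grid; [exact: ltW|rewrite kE; lra].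
  have {}ik' : (i <= k)%N.
    rewrite leqNgt; apply/negP => /iD /andP[_].
    by rewrite leNgt; move: Xk; rewrite gt_max => /andP[_ ->].
  have Xi : 0 < X (i%:R * mesh n).
    have [it|/ltW ti] := leP (i%:R * mesh n) t; first by apply: pt; rewrite g0.
    by have := near _ (g0 n i) ti (le_mesh n ik'); rewrite gt_max => /andP[].
  rewrite /Phi (leNgt (X _) 0) Xi/=; case: (ltP y (X (i%:R * mesh n))) => yi.
    by rewrite lerDl ltW.
  have : ~~ (i < grid n L)%N by apply/negP => /iN; rewrite /D Xi yi.
  rewrite -leqNgt => Ni; have ki : i = k by apply/eqP; rewrite eqn_leq ik' (leq_trans kN Ni).
  by move: Xk; rewrite -ki gt_max => /andP[_]; rewrite ltNge yi.
case: asboolP => [pL|_]; last first.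
  exists 0%N => n _; rewrite addr_ge0 ?(ltW e0)//; apply: stopped_ge0 => x.
  by rewrite /Phi; case: ifP => // _; case: ifP => // _; case/andP: (gam01 x).
have [r r0 hr] := gamX e0.
have [n0 hn] := mesh_small r0; exists n0 => n /hn d1.
have [i [ik -> iD iN]] := @stopped_cases D Phi (grid n L) (X 0) (xi n) (fun i => X (i%:R * mesh n)) (xiE n).
have /andP[g1 g2] := gridP n (ltW L0).
have iL : i%:R * mesh n <= L by rewrite (le_trans (le_mesh n ik)).
have Xi : 0 < X (i%:R * mesh n) by apply: pL; rewrite g0.
have Xy : X (i%:R * mesh n) <= y by apply: nohit_end => //; rewrite g0.
have iE : i = grid n L.
  by apply/eqP; rewrite eqn_leq ik/= leqNgt; apply/negP => /iN; rewrite /D Xi Xy.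
rewrite /Phi (leNgt (X _) 0) Xi/= (ltNge y) Xy/=; apply: hr => //.
by rewrite iE distrC ger0_norm ?subr_ge0//; lra.
Qed.

(** Now a visit to 0 must not be missed, and the path may touch 0 between grid points only. By
    continuity it is below [eps] at the last grid point before the visit, hence the killing
    threshold [eps]. Until the visit it has not exceeded [y], so the walk is not stopped on the
    upper side. *)
Lemma payoff_le_stopped_low eps e : 0 < eps -> 0 < e -> exists n0, forall n, (n0 <= n)%N ->
  payoff y X L 0 1 gam <= stopped (fun x => (eps < x) && (x <= y + eps))
    (fun x => if x <= eps then 1 else if y + eps < x then 0 else gam x) (grid n L) (X 0) (xi n) + e.
Proof.
move=> eps0 e0; rewrite /payoff; set D := fun x => _ && _; set Phi := fun x => if x <= eps then _ else _.
case: asboolP => [_|nh].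
  exists 0%N => n _; rewrite addr_ge0 ?(ltW e0)//; apply: stopped_ge0 => x.
  by rewrite /Phi; case: ifP => // _; case: ifP => // _; case/andP: (gam01 x).
case: asboolP => [pL|npL].
  have [r r0 hr] := gamX e0.
  have [n0 hn] := mesh_small r0; exists n0 => n /hn d1.
  have [i [ik -> iD iN]] := @stopped_cases D Phi (grid n L) (X 0) (xi n) (fun i => X (i%:R * mesh n)) (xiE n).
  have /andP[g1 g2] := gridP n (ltW L0).
  have iL : i%:R * mesh n <= L by rewrite (le_trans (le_mesh n ik)).
  have Xy : X (i%:R * mesh n) <= y by apply: nohit_end => //; rewrite g0.
  rewrite /Phi; case: (leP (X (i%:R * mesh n)) eps) => Xi.
    by have /andP[_ h] := gam01 (X L); rewrite (le_trans h)// lerDl ltW.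
  have Xy' : X (i%:R * mesh n) <= y + eps by rewrite (le_trans Xy)// lerDl ltW.
  rewrite ltNge Xy'/=; have iE : i = grid n L.
    by apply/eqP; rewrite eqn_leq ik/= leqNgt; apply/negP => /iN; rewrite /D Xi Xy'.
  by apply: hr => //; rewrite iE distrC ger0_norm ?subr_ge0//; lra.
have [t [/andP[t0 tL] Xt ht]] := first_nonpositive cX (ltW L0) npL.
have [r r0 hr] := continuous_ge0P cX t0 eps0.
have [n0 hn] := mesh_small r0; exists n0 => n /hn d1.
have [i [ik -> iD iN]] := @stopped_cases D Phi (grid n L) (X 0) (xi n) (fun i => X (i%:R * mesh n)) (xiE n).
have /andP[g1 g2] := gridP n t0; set k := grid n t in g1 g2.
have kN : (k <= grid n L)%N by apply: le_grid; [exact: ltW|exact: le_trans tL].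
have Xk : X (k%:R * mesh n) < eps.
  have : `|k%:R * mesh n - t| < r by rewrite distrC ger0_norm ?subr_ge0//; lra.
  by move=> /(hr _ (g0 n k)); rewrite ltr_norml => /andP[]; lra.
have ik' : (i <= k)%N.
  by rewrite leqNgt; apply/negP => /iD /andP[]; rewrite ltNge (ltW Xk).
have it : i%:R * mesh n <= t by apply: le_trans g1; exact: le_mesh.
have Xy : X (i%:R * mesh n) <= y \/ X (i%:R * mesh n) <= 0.
  move: it; rewrite le_eqVlt => /predU1P[->|it]; [by right|left].
  apply: nohit => //; first by rewrite g0 (lt_le_trans it).
  by move=> s /andP[s0 si]; apply: ht; rewrite s0 (le_lt_trans si).
rewrite /Phi; case: (leP (X (i%:R * mesh n)) eps) => Xi; first by rewrite lerDl ltW.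
have {}Xy : X (i%:R * mesh n) <= y + eps by case: Xy => ?; lra.
have iE : i = grid n L.
  by apply/eqP; rewrite eqn_leq ik/= leqNgt; apply/negP => /iN; rewrite /D Xi Xy.
have : i = k by apply/eqP; rewrite eqn_leq ik' iE kN.
by move=> ikE; move: Xi; rewrite ikE ltNge (ltW Xk).
Qed.

End grid_limit.

End paths.

Lemma grid_ge0 {R : realType} n k : 0 <= k%:R * mesh n :> R.
Proof. by rewrite mulr_ge0// ltW// mesh_gt0. Qed.

(** * Measurability of path functionals *)

Section measurable_paths.
Context {R : realType} {dS : measure_display} {S : measurableType dS}.
Implicit Types (X : S -> R -> R) (f g tau L : S -> R).

Lemma measurable_set_bool (b : S -> bool) : measurable_fun setT b -> measurable [set s | b s].
Proof.
move=> mb; have -> : [set s | b s] = setT `&` b @^-1` [set true].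
  by rewrite setTI; apply/seteqP; split => s.
exact: mb.
Qed.

Lemma measurable_set_lt f g : measurable_fun setT f -> measurable_fun setT g ->
  measurable [set s | f s < g s].
Proof. by move=> mf mg; apply: measurable_set_bool; exact: measurable_fun_ltr. Qed.

Lemma measurable_set_le f g : measurable_fun setT f -> measurable_fun setT g ->
  measurable [set s | f s <= g s].
Proof. by move=> mf mg; apply: measurable_set_bool; exact: measurable_fun_ler. Qed.

Lemma measurable_asbool (A : set S) : measurable A -> measurable_fun setT (fun s => `[< A s >]).
Proof.
move=> mA; apply: (measurable_fun_bool true); rewrite setTI.
by have -> : (fun s => `[< A s >]) @^-1` [set true] = A
  by apply/seteqP; split => s /=; [move=> /asboolP|move=> As; apply/asboolP].
Qed.

Lemma measurable_stopped (D : R -> bool) (Phi : R -> R) k (z : S -> R) (xi : nat -> S -> R) :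
  measurable_fun setT D -> measurable_fun setT Phi -> measurable_fun setT z ->
  (forall l, measurable_fun setT (xi l)) ->
  measurable_fun setT (fun s => stopped D Phi k (z s) (fun l => xi l s)).
Proof.
move=> mD mPhi; elim: k z xi => [|k IH] z xi mz mxi /=; first exact: measurableT_comp.
apply: measurable_fun_ifT; first exact: measurableT_comp.
  exact: (IH _ (fun l => xi l.+1) (measurable_funD mz (mxi 0%N))).
exact: measurableT_comp.
Qed.

Lemma measurable_countable_comp dU (U : measurableType dU) (K : S -> nat) (f : nat -> S -> U) :
  measurable_fun setT K -> (forall k, measurable_fun setT (f k)) ->
  measurable_fun setT (fun s => f (K s) s).
Proof.
move=> mK mf _ B mB; rewrite setTI.
have -> : (fun s => f (K s) s) @^-1` B = \bigcup_k (K @^-1` [set k] `&` f k @^-1` B).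
  apply/seteqP; split => [s Bs|s [k _ [<-]]//]; by exists (K s).
apply: bigcupT_measurable => k; apply: measurableI.
  by rewrite -[X in measurable X]setTI; exact: mK.
by rewrite -[X in measurable X]setTI; exact: mf.
Qed.

Lemma measurable_grid n tau : measurable_fun setT tau -> measurable_fun setT (fun s => grid n (tau s)).
Proof.
move=> mtau _ B _; rewrite setTI.
have -> : (fun s => grid n (tau s)) @^-1` B =
    \bigcup_(k in B) [set s | grid n (tau s) = k].
  by apply/seteqP; split => [s Bs|s [k Bk /= sk]]; [exists (grid n (tau s))|rewrite /= sk].
apply: bigcup_measurable => k _.
have mt : measurable_fun setT (fun s => tau s / mesh n) by apply: measurable_funM.
case: k => [|k].
  have -> : [set s | grid n (tau s) = 0%N] = [set s | tau s / mesh n < 1].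
    apply/seteqP; split => s /=; rewrite /grid -(truncn_le_nat _ 0).
      by move=> ->.
    by rewrite leqn0 => /eqP.
  exact: measurable_set_lt.
have -> : [set s | grid n (tau s) = k.+1] =
    [set s | k.+1%:R <= tau s / mesh n] `&` [set s | tau s / mesh n < k.+2%:R].
  apply/seteqP; split => s /=; rewrite /grid -truncn_gt_nat -truncn_le_nat.
    by move=> ->.
  by move=> [h1 h2]; apply/eqP; rewrite eqn_leq h1 h2.
by apply: measurableI; [exact: measurable_set_le|exact: measurable_set_lt].
Qed.

Section regular_path.
Variable X : S -> R -> R.
Hypotheses (mX : forall t, 0 <= t -> measurable_fun setT (X^~ t))
  (cX : forall s, continuous_ge0 (X s)).

Let mXg n k : measurable_fun setT (X^~ (k%:R * mesh n)).
Proof. by apply: mX; exact: grid_ge0. Qed.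

(** Evaluation at a random time is a limit of evaluations at its grid approximations, which take
    countably many values. *)
Lemma measurable_path_at tau : measurable_fun setT tau -> (forall s, 0 <= tau s) ->
  measurable_fun setT (fun s => X s (tau s)).
Proof.
move=> mtau tau0.
apply: (@measurable_fun_cvg _ _ _ _ (fun n s => X s ((grid n (tau s))%:R * mesh n))).
  move=> n; apply: (@measurable_countable_comp _ R (fun s => grid n (tau s)) (fun k s => X s (k%:R * mesh n))) => //.
  exact: measurable_grid.
move=> s _; apply/cvgrPdist_lt => e e0.
have [r r0 hr] := continuous_ge0P (@cX s) (tau0 s) e0.
have [n0 hn] := mesh_small r0; exists n0 => // n /= /hn d1.
have /andP[g1 g2] := gridP n (tau0 s).
rewrite distrC; apply: hr; first exact: grid_ge0.
by rewrite distrC ger0_norm ?subr_ge0//; lra.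
Qed.

(** A continuous path that is positive on [[0, t]] is bounded below there by some [mesh m];
    conversely, such a bound at the grid points extends to positivity by continuity. Only countably
    many conditions remain. *)
Let positive_untilE s t : 0 <= t -> positive_until (X s) t <->
  exists m, forall n k, k%:R * mesh n <= t -> mesh m <= X s (k%:R * mesh n).
Proof.
move=> t0; split => [pt|[m h] u /andP[u0 ut]].
  have cf : {within `[0, t], continuous (fun u => X s (Num.max 0 u))}.
    by apply: continuous_subspaceT; exact: cX.
  have [c ct hc] := EVT_min t0 cf.
  move: ct; rewrite in_itv/= => /andP[c0 ct].
  have Xc : 0 < X s (Num.max 0 c) by apply: pt; rewrite max_r// c0.
  have [m hm] := mesh_small Xc; exists m => n k kt.
  have k0 : 0 <= k%:R * mesh n :> R by exact: grid_ge0.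
  apply: ltW; apply: lt_le_trans (hm m (leqnn _)) _.
  by have := hc (k%:R * mesh n); rewrite (max_r k0); apply; rewrite in_itv/= k0.
have [r r0 hr] := continuous_ge0P (@cX s) u0 (mesh_gt0 m).
have [n hn] := mesh_small r0; have d1 := hn n (leqnn n).
have /andP[g1 g2] := gridP n u0.
have : `|X s ((grid n u)%:R * mesh n) - X s u| < mesh m.
  apply: hr; first exact: grid_ge0.
  by rewrite distrC ger0_norm ?subr_ge0//; lra.
have := h n (grid n u) (le_trans g1 ut).
by rewrite ltr_norml => ? /andP[]; lra.
Qed.

Lemma measurable_positive_until tau : measurable_fun setT tau -> (forall s, 0 <= tau s) ->
  measurable [set s | positive_until (X s) (tau s)].
Proof.
move=> mtau tau0.
have -> : [set s | positive_until (X s) (tau s)] =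
  \bigcup_m \bigcap_n \bigcap_k
   ([set s | tau s < k%:R * mesh n] `|` [set s | mesh m <= X s (k%:R * mesh n)]).
  apply/seteqP; split => s /=.
    move=> /positive_untilE => /(_ (tau0 s)) [m h]; exists m => // n _ k _ /=.
    by have [kt|tk] := leP (k%:R * mesh n) (tau s); [right; exact: h|left].
  move=> [m _ h]; apply/positive_untilE => //; exists m => n k kt.
  by have [] := h n I k I => //=; rewrite ltNge kt.
apply: bigcupT_measurable => m; apply: bigcapT_measurable => n; apply: bigcapT_measurable => k.
by apply: measurableU; [exact: measurable_set_lt|exact: measurable_set_le].
Qed.

(** Being positive and above [y] persists for a short time, so a grid time just after the witness
    serves as well. *)
Lemma measurable_hits y tau : measurable_fun setT tau ->
  measurable [set s | hits y (X s) (tau s)].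
Proof.
move=> mtau.
have -> : [set s | hits y (X s) (tau s)] = \bigcup_n \bigcup_k
   ([set s | k%:R * mesh n < tau s] `&` [set s | y < X s (k%:R * mesh n)] `&`
    [set s | positive_until (X s) (k%:R * mesh n)]).
  apply/seteqP; split => s /=; last first.
    move=> [n _ [k _ [[/= h1 h2] h3]]]; exists (k%:R * mesh n); split => //.
    by rewrite h1 andbT grid_ge0.
  move=> [t [/andP[t0 tL] yt pt]].
  have Xt : 0 < X s t by apply: pt; rewrite t0 lexx.
  have m0 : 0 < X s t - Num.max 0 y by rewrite subr_gt0 gt_max Xt.
  have [r r0 hr] := continuous_ge0P (@cX s) t0 m0.
  have r'0 : 0 < Num.min r (tau s - t) by rewrite lt_min r0 subr_gt0.
  have [n hn] := mesh_small r'0; have := hn n (leqnn n); rewrite lt_min => /andP[d1 d2].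
  have /andP[g1 g2] := gridP n t0.
  have kE : (grid n t).+1%:R * mesh n = (grid n t)%:R * mesh n + mesh n :> R by rewrite -natr1 mulrDl mul1r.
  have near u : t <= u -> u <= (grid n t).+1%:R * mesh n -> Num.max 0 y < X s u.
    move=> tu uk; have : `|u - t| < r by rewrite ger0_norm ?subr_ge0//; lra.
    by move=> /(hr u (le_trans t0 tu)); rewrite ltr_norml => /andP[]; lra.
  exists n => //; exists (grid n t).+1 => //; split; first split => /=.
  - by rewrite kE; lra.
  - have tk : t <= (grid n t).+1%:R * mesh n by rewrite kE ltW.
    by have := near _ tk (lexx _); rewrite gt_max => /andP[].
  - move=> u /andP[u0 uk].
    have [ut|/ltW tu] := leP u t; first by apply: pt; rewrite u0.
    by have := near u tu uk; rewrite gt_max => /andP[].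
apply: bigcupT_measurable => n; apply: bigcupT_measurable => k.
have k0 : 0 <= k%:R * mesh n :> R by exact: grid_ge0.
apply: measurableI; last by apply: measurable_positive_until.
by apply: measurableI; exact: measurable_set_lt.
Qed.

Lemma measurable_payoff y tau c1 c0 gam : measurable_fun setT tau -> (forall s, 0 <= tau s) ->
  measurable_fun setT gam ->
  measurable_fun setT (fun s => payoff y (X s) (tau s) c1 c0 gam).
Proof.
move=> mtau tau0 mgam; apply: measurable_fun_ifT => //.
  exact: measurable_asbool (measurable_hits _ mtau).
apply: measurable_fun_ifT => //.
  exact: measurable_asbool (measurable_positive_until mtau tau0).
by apply: measurableT_comp => //; exact: measurable_path_at.
Qed.

End regular_path.
End measurable_paths.

(** * One gaussian step *)

Section density.
Context {d : measure_display} {T : measurableType d} {R : realType}.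
Variables (nu mu : {measure set T -> \bar R}) (h : T -> R).
Hypotheses (h0 : forall x, 0 <= h x) (mh : measurable_fun setT h)
  (nuE : forall A, measurable A -> nu A = (\int[mu]_(x in A) (h x)%:E)%E).

Let density_indic (A : set T) : measurable A ->
  (\int[nu]_x (\1_A x)%:E = \int[mu]_x ((\1_A x)%:E * (h x)%:E))%E.
Proof.
move=> mA; rewrite integral_indic// setIT nuE// integral_mkcond.
apply: eq_integral => x _; rewrite patchE indicE; case: ifPn => xA; first by rewrite mul1e.
by rewrite mul0e.
Qed.

Import HBNNSimple.

Let density_nnsfun (f : {nnsfun T >-> R}) :
  (\int[nu]_x (f x)%:E = \int[mu]_x ((f x)%:E * (h x)%:E))%E.
Proof.
under [LHS]eq_integral do rewrite fimfunE -fsumEFin//.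
rewrite [LHS]ge0_integral_fsum//; last 2 first.
  - by move=> r; exact/measurable_EFinP/measurableT_comp.
  - by move=> n x _; rewrite EFinM nnfun_muleindic_ge0.
under [RHS]eq_integral.
  move=> x xD; rewrite fimfunE -fsumEFin// muleC ge0_mule_fsumr; last first.
    by move=> r; rewrite EFinM nnfun_muleindic_ge0.
  over.
rewrite [RHS]ge0_integral_fsum//; last 2 first.
  - move=> r; apply: emeasurable_funM; first exact/measurable_EFinP.
    by apply/measurable_EFinP; do 2 apply/measurableT_comp => //.
  - by move=> n x _; apply: mule_ge0; [rewrite lee_fin|rewrite EFinM nnfun_muleindic_ge0].
apply: eq_fsbigr => r rf; rewrite integralZl_indic_nnsfun//= density_indic//.
rewrite -ge0_integralZl//.
- by apply: eq_integral => x _; rewrite EFinM [RHS]muleC muleA.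
- apply: emeasurable_funM; last exact/measurable_EFinP.
  exact/measurable_EFinP/measurable_indic.
- by move=> x _; rewrite mule_ge0// lee_fin.
- by move: rf; rewrite inE => -[x _ <-]; rewrite lee_fin.
Qed.

Lemma ge0_integral_density (f : T -> \bar R) : measurable_fun setT f ->
  (forall x, (0 <= f x)%E) -> (\int[nu]_x f x = \int[mu]_x (f x * (h x)%:E))%E.
Proof.
move=> mf f0; pose f_ := nnsfun_approx measurableT mf.
transitivity (lim (\int[nu]_x (f_ n x)%:E @[n --> \oo])%E).
  rewrite -monotone_convergence//=.
  - apply: eq_integral => ? /[!inE] xD; apply/esym/cvg_lim => //=.
    exact: cvg_nnsfun_approx.
  - by move=> n; exact/measurable_EFinP/measurable_funTS.
  - by move=> n ? _; rewrite lee_fin.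
  - by move=> ? _ ? ? mn; rewrite lee_fin; exact/lefP/nd_nnsfun_approx.
transitivity (lim (\int[mu]_x ((f_ n x)%:E * (h x)%:E) @[n --> \oo])%E).
  by apply: congr_lim; apply/funext => n; exact: density_nnsfun.
rewrite -monotone_convergence//=.
- apply: eq_integral => x _; apply/cvg_lim => //=; apply: cvgeZr => //.
  exact: cvg_nnsfun_approx.
- move=> n; apply: emeasurable_funM; last exact/measurable_EFinP.
  exact/measurable_EFinP/measurable_funTS.
- by move=> n x _; rewrite mule_ge0// lee_fin.
- move=> x _ m n mn; rewrite lee_wpmul2r ?lee_fin//.
  exact/lefP/nd_nnsfun_approx.
Qed.

End density.

(** Completing the square: the centred density tilted by [expR (theta * x)] is a multiple of the
    normal density with mean [theta * s ^+ 2]. *)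
Lemma normal_mgf {R : realType} (s theta : R) : s != 0 ->
  (\int[normal_prob 0 s]_x (expR (theta * x))%:E = (expR (theta ^+ 2 * s ^+ 2 / 2))%:E)%E.
Proof.
move=> s0.
have mexp : measurable_fun setT (fun x : R => expR (theta * x)).
  by apply: measurableT_comp => //; apply: measurable_funM.
have mE : measurable_fun setT (fun x : R => (expR (theta * x))%:E) by exact/measurable_EFinP.
have E0 (x : R) : (0 <= (expR (theta * x))%:E)%E by rewrite lee_fin expR_ge0.
rewrite (@ge0_integral_density _ _ _ (normal_prob 0 s) lebesgue_measure (normal_pdf 0 s)
  (normal_pdf_ge0 0 s) (measurable_normal_pdf 0 s) (fun A _ => erefl) _ mE E0).
transitivity (\int[lebesgue_measure]_x ((expR (theta ^+ 2 * s ^+ 2 / 2))%:E * (normal_pdf (theta * s ^+ 2) s x)%:E))%E.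
  apply: eq_integral => x _; rewrite -!EFinM; congr EFin.
  rewrite !normal_pdfE// mulrCA [RHS]mulrCA; congr (_ * _).
  rewrite /normal_fun -!expRD; congr expR.
  by field; rewrite s0.
rewrite ge0_integralZl//.
- by rewrite integral_normal_pdf mule1.
- by apply/measurable_EFinP; exact: measurable_normal_pdf.
- by move=> x _; rewrite lee_fin normal_pdf_ge0.
Qed.

Section sigma_of_lemmas.
Context {R : realType} {d d' : measure_display} {T : measurableType d} {T' : measurableType d'}.
Variable X : T -> T'.

Lemma sigma_of_measurable : measurable_fun setT X -> sigma_of X `<=` measurable.
Proof. by move=> mX _ [B mB <-]; exact: mX. Qed.

Lemma sigma_ofT : sigma_of X setT.
Proof. by exists setT => //; rewrite setTI preimage_setT. Qed.

Lemma sigma_ofI : setI_closed (sigma_of X).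
Proof.
move=> _ _ [A mA <-] [B mB <-]; exists (A `&` B); first exact: measurableI.
by rewrite !setTI preimage_setI.
Qed.

Lemma measurable_sigma_of (G : set (set T)) : sigma_of X `<=` <<s G >> ->
  measurable_fun setT (X : g_sigma_algebraType G -> T').
Proof. by move=> XG _ B mB; apply: XG; exists B. Qed.

End sigma_of_lemmas.

(** * Domination of a walk stopped at a geometric time *)

Section walk_domination.
Context {R : realType} {d : measure_display} {T : measurableType d}.
Variables (P : probability T R) (xi : nat -> T -> R).
Hypotheses (mxi : forall l, measurable_fun setT (xi l))
  (xi_indep : mutually_independent P (fun l => sigma_of (xi l))).
Variables (D : R -> bool) (Phi U : R -> R) (q e : R).
Hypotheses (mD : measurable_fun setT D) (mPhi : measurable_fun setT Phi)
  (mU : measurable_fun setT U) (Phi0 : forall z, 0 <= Phi z) (U0 : forall z, 0 <= U z)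
  (PhiU : forall z, ~~ D z -> Phi z <= U z) (q01 : 0 <= q <= 1) (e0 : 0 <= e).
Hypothesis stepU : forall j z, D z ->
  (((1 - q) * Phi z)%:E + q%:E * \int[P]_w (U (z + xi j w))%:E <= (U z + (1 - q) * e)%:E)%E.

Let q0 : 0 <= q. Proof. by case/andP: q01. Qed.
Let q1 : 0 <= 1 - q. Proof. by case/andP: q01; rewrite subr_ge0. Qed.

Let Es k j z := (\int[P]_w (stopped D Phi k z (fun l => xi (j + l)%N w))%:E)%E.

Let Es_ge0 k j z : (0 <= Es k j z)%E.
Proof. by apply: integral_ge0 => w _; rewrite lee_fin stopped_ge0. Qed.

(** Freezing the first increment leaves a walk driven by the later ones, which are independent of
    it. *)
Let Es_Markov k j z : D z -> Es k.+1 j z = (\int[P]_w Es k j.+1 (z + xi j w))%E.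
Proof.
move=> Dz; pose G := sigma_block (fun l => sigma_of (xi l)) [set i | (j < i)%N].
have Gm : G `<=` measurable.
  by apply: sigma_block_measurable => i; apply: sigma_of_measurable.
pose F (z' : R * g_sigma_algebraType G) :=
  (stopped D Phi k (z + z'.1) (fun l => xi (j.+1 + l)%N z'.2))%:E.
have mF : measurable_fun setT F.
  apply/measurable_EFinP; apply: measurable_stopped => //.
    by apply: measurable_funD.
  move=> l; apply: (measurableT_comp (f := (xi (j.+1 + l)%N : g_sigma_algebraType G -> R))) => //.
  apply: measurable_sigma_of => X XX; apply: sub_sigma_algebra.
  by exists (j.+1 + l)%N => //=; rewrite addSn ltnS leq_addr.
have F0 z' : (0 <= F z')%E by rewrite lee_fin stopped_ge0.
have := @freezing _ _ _ _ T _ _ P (xi j) (id : T -> g_sigma_algebraType G) (mxi j)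
  (measurable_id_sigma Gm) F mF F0.
rewrite /F /= => <-.
  apply: eq_integral => w _; rewrite /= Dz addn0; congr (_%:E).
  by congr stopped; apply/funext => l; rewrite addnS.
move=> A B mA mB.
apply: (@sigma_block_independent _ _ _ P nat (fun l => sigma_of (xi l)) _ _ _ _ [set j] [set i | (j < i)%N]) => //.
- by move=> i; exact: sigma_of_measurable.
- by move=> i; exact: sigma_ofI.
- by move=> i; exact: sigma_ofT.
- by apply/seteqP; split => // i [/= ->]; rewrite ltnn.
- apply: sub_sigma_algebra; exists j => //; exists A => //; exact: setTI.
Qed.

(** The weights are those of a geometric time. Inside [D] the term [k = 0] is the payoff now, and
    the others are [q] times the same sum for the walk after one increment, bounded pointwise by
    induction. Then [stepU] turns [q e + (1 - q) e] into [e], so the error does not grow with the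
    number of steps. *)
Lemma stopped_sum_le n j z :
  (\sum_(0 <= k < n) (q ^+ k * (1 - q))%:E * Es k j z <= (U z + e)%:E)%E.
Proof.
elim: n j z => [|n IH] j z; first by rewrite big_geq// lee_fin addr_ge0.
have [Dz|nDz] := boolP (D z); last first.
  have -> : (\sum_(0 <= k < n.+1) (q ^+ k * (1 - q))%:E * Es k j z =
     \sum_(0 <= k < n.+1) ((q ^+ k * (1 - q)) * Phi z)%:E)%E.
    apply: eq_bigr => k _; rewrite [RHS]EFinM; congr (_ * _)%E.
    transitivity (\int[P]_w (cst (Phi z)%:E w))%E.
      by apply: eq_integral => w _; case: k => //= k; rewrite (negbTE nDz).
    by rewrite integral_cst//= probability_setT mule1.
  rewrite sumEFin lee_fin -mulr_suml -mulr_suml mulrC.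
  have -> : (\sum_(0 <= i < n.+1) q ^+ i) * (1 - q) = 1 - q ^+ n.+1.
    by rewrite big_mkord; have := subrX1 q n.+1; move: (\sum_(i < n.+1) _) => s0; lra.
  rewrite (le_trans _ (lerD (PhiU nDz) e0))// addr0 mulrC ler_piMl//.
  by rewrite gerBl exprn_ge0.
rewrite big_nat_recl// expr0 mul1r.
have -> : Es 0%N j z = (Phi z)%:E.
  by rewrite /Es /= integral_cst//= probability_setT mule1.
have mEs k : measurable_fun setT (fun w => Es k j.+1 (z + xi j w)).
  have mS : measurable_fun setT (fun a : R => Es k j.+1 (z + a)).
    pose F (z' : R * T) := (stopped D Phi k (z + z'.1) (fun l => xi (j.+1 + l)%N z'.2))%:E.
    apply: (@measurable_frozen _ _ _ _ T _ _ P (id : T -> T) _ F) => //.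
      apply/measurable_EFinP; apply: measurable_stopped => //.
        by apply: measurable_funD.
      by move=> l; apply: (measurableT_comp (f := xi (j.+1 + l)%N)).
    by move=> z'; rewrite lee_fin stopped_ge0.
  by apply: (measurableT_comp mS).
have -> : (\sum_(0 <= i < n) (q ^+ i.+1 * (1 - q))%:E * Es i.+1 j z =
   q%:E * \int[P]_w \sum_(0 <= i < n) ((q ^+ i * (1 - q))%:E * Es i j.+1 (z + xi j w)))%E.
  rewrite ge0_integral_sum//; last 2 first.
  - by move=> k; apply: measurable_funeM.
  - by move=> k w _; rewrite mule_ge0// lee_fin mulr_ge0 ?exprn_ge0.
  rewrite ge0_sume_distrr; last first.
    move=> k _; apply: integral_ge0 => w _.
    by rewrite mule_ge0// lee_fin mulr_ge0 ?exprn_ge0.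
  apply: eq_bigr => k _; rewrite Es_Markov// exprS -mulrA EFinM -muleA; congr (_ * _)%E.
  by rewrite ge0_integralZl// lee_fin mulr_ge0 ?exprn_ge0.
apply: (@le_trans _ _ (((1 - q) * Phi z)%:E + q%:E * (\int[P]_w (U (z + xi j w))%:E + e%:E))%E).
  rewrite leeD// lee_wpmul2l ?lee_fin//.
  have -> : (\int[P]_w (U (z + xi j w))%:E + e%:E = \int[P]_w ((U (z + xi j w))%:E + e%:E))%E.
    rewrite ge0_integralD//=.
    - by rewrite integral_cst//= probability_setT mule1.
    - by move=> w _; rewrite lee_fin.
    - by apply/measurable_EFinP; apply: measurableT_comp => //; apply: measurable_funD.
  apply: ge0_le_integral => //.
  - move=> w _; apply: sume_ge0 => k _.
    by rewrite mule_ge0// lee_fin mulr_ge0 ?exprn_ge0.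
  - by apply: emeasurable_sum => k; apply: measurable_funeM.
  - apply: emeasurable_funD => //.
    by apply/measurable_EFinP; apply: measurableT_comp => //; apply: measurable_funD.
rewrite muleDr//.
rewrite addeA; apply: (@le_trans _ _ ((U z + (1 - q) * e)%:E + q%:E * e%:E)%E).
  by rewrite leeD2r//; exact: stepU.
by rewrite -EFinM -EFinD lee_fin; lra.
by rewrite fin_num_adde_defl.
Qed.

Variable K : T -> nat.
Hypotheses (mK : measurable_fun setT K)
  (K_law : forall k, P (K @^-1` [set k]) = (q ^+ k * (1 - q))%:E).
Variable G : set (set T).
Hypotheses (Gm : G `<=` measurable) (xiG : forall l, sigma_of (xi l) `<=` <<s G >>)
  (KG : forall A B, <<s G >> B -> P (K @^-1` A `&` B) = (P (K @^-1` A) * P B)%E).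

(** Freezing [K], which is independent of the increments, leaves the series whose partial sums
    [stopped_sum_le] bounds. *)
Lemma stopped_random_le z :
  (\int[P]_w (stopped D Phi (K w) z (fun l => xi l w))%:E <= (U z + e)%:E)%E.
Proof.
pose F (z' : nat * g_sigma_algebraType G) :=
  (stopped D Phi z'.1 z (fun l => xi l z'.2))%:E.
have mxiG l : measurable_fun setT (xi l : g_sigma_algebraType G -> R).
  by apply: measurable_sigma_of; exact: xiG.
have mF : measurable_fun setT F.
  apply/measurable_EFinP.
  apply: (@measurable_countable_comp _ _ _ R fst
    (fun k (z' : nat * g_sigma_algebraType G) => stopped D Phi k z (fun l => xi l z'.2))) => // k.
  by apply: measurable_stopped => // l; apply: (measurableT_comp (mxiG l)).
have F0 z' : (0 <= F z')%E by rewrite lee_fin stopped_ge0.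
have := @freezing _ _ _ _ T _ _ P K (id : T -> g_sigma_algebraType G) mK
  (measurable_id_sigma Gm) F mF F0.
rewrite /F /= => ->; last by move=> A B _ mB; exact: KG.
have E (psi : nat -> \bar R) : (forall k, 0 <= psi k)%E ->
    (\int[P]_w psi (K w) = \sum_(0 <= k <oo) (q ^+ k * (1 - q))%:E * psi k)%E.
  move=> psi0.
  have cover : \bigcup_k (K @^-1` [set k]) = setT.
    by apply/seteqP; split => // w _; exists (K w).
  have mKk k : measurable (K @^-1` [set k]).
    by rewrite -[X in measurable X]setTI; exact: mK.
  rewrite -cover ge0_integral_bigcup//; last 2 first.
  - by rewrite cover; apply: measurableT_comp.
  - by apply/trivIsetP => i j _ _ ij; apply/seteqP; split => // w [/= wi wj]; move: ij; rewrite -wi -wj eqxx.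
  apply: eq_eseriesr => k _; rewrite -K_law muleC -integral_cst//.
  by apply: eq_integral => w; rewrite inE/= => ->.
rewrite (E (fun k => Es k 0%N z)); last by move=> k; exact: Es_ge0.
apply: lime_le.
  by apply: is_cvg_nneseries => k _ _; rewrite mule_ge0// lee_fin mulr_ge0 ?exprn_ge0.
by apply: nearW => n; exact: stopped_sum_le.
Qed.

End walk_domination.

Section exponential_sums.
Context {R : realType} {d : measure_display} {T : measurableType d}.
Variables (P : probability T R) (xi : T -> R) (M : R -> R).
Hypotheses (mxi : measurable_fun setT xi)
  (xi_mgf : forall th, (\int[P]_w (expR (th * xi w))%:E = (M th)%:E)%E).

Let mexp th : measurable_fun setT (fun w => expR (th * xi w)).
Proof. by apply: measurableT_comp => //; apply: measurable_funM. Qed.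

Let integrable_exp th : P.-integrable setT (fun w => (expR (th * xi w))%:E).
Proof.
apply/integrableP; split; first exact/measurable_EFinP.
under eq_integral do rewrite gee0_abs ?lee_fin ?expR_ge0//.
by rewrite xi_mgf ltry.
Qed.

Lemma integral_expsum (s : seq (R * R)) :
  (\int[P]_w (\sum_(p <- s) p.1 * expR (p.2 * xi w))%:E = (\sum_(p <- s) p.1 * M p.2)%:E)%E.
Proof.
suff: P.-integrable setT (fun w => (\sum_(p <- s) p.1 * expR (p.2 * xi w))%:E) /\
  (\int[P]_w (\sum_(p <- s) p.1 * expR (p.2 * xi w))%:E = (\sum_(p <- s) p.1 * M p.2)%:E)%E by case.
elim: s => [|[a th] s [IHi IH]].
  split; last by under eq_integral do rewrite big_nil; rewrite big_nil integral0.
  by under eq_fun do rewrite big_nil; exact: integrable0.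
have i1 : P.-integrable setT (fun w => (a * expR (th * xi w))%:E).
  by under eq_fun do rewrite EFinM; exact: integrableZl.
split.
  under eq_fun do rewrite big_cons EFinD /=.
  exact: integrableD.
under eq_integral do rewrite big_cons EFinD /=.
rewrite integralD// big_cons EFinD IH; congr (_ + _)%E.
under eq_integral do rewrite EFinM.
by rewrite integralZl// xi_mgf -EFinM.
Qed.

End exponential_sums.

(** * Hyperbolic expansion and the generator inequality on the grid *)

Section one_step.
Context {R : realType}.

Definition cosh1 (h : R) : R := (expR h + expR (- h)) / 2 - 1.

Lemma cosh1_sqr h : cosh1 h = (expR (h / 2) - expR (- (h / 2))) ^+ 2 / 2.
Proof.
rewrite /cosh1; have -> : expR h = expR (h / 2) ^+ 2.
  by rewrite -expRM_natl mulrC divfK.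
have -> : expR (- h) = expR (- (h / 2)) ^+ 2.
  by rewrite -expRM_natl mulrN mulrC divfK.
have : expR (h / 2) * expR (- (h / 2)) = 1 by rewrite -expRD subrr expR0.
by move: (expR _) (expR _) => a b ab; rewrite sqrrB -mulr_natr ab; field.
Qed.

Lemma cosh1_ge0 h : 0 <= cosh1 h.
Proof. by rewrite cosh1_sqr divr_ge0// sqr_ge0. Qed.

Lemma cosh1N h : cosh1 (- h) = cosh1 h.
Proof. by rewrite /cosh1 opprK [expR (- h) + _]addrC. Qed.

Lemma cosh1_gt0 h : 0 < h -> 0 < cosh1 h.
Proof.
move=> h0; rewrite cosh1_sqr divr_gt0// exprn_even_gt0//= subr_eq0 gt_eqF//.
by rewrite ltr_expR; lra.
Qed.

Lemma le_cosh1 h h' : 0 <= h -> h <= `|h'| -> cosh1 h <= cosh1 h'.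
Proof.
move=> h0; have : cosh1 h' = cosh1 `|h'|.
  by case: (leP 0 h') => [/ger0_norm ->|/ltr0_norm ->] //; rewrite cosh1N.
move=> ->; move: `|h'| => k hk; rewrite !cosh1_sqr ler_pM2r//.
have e1 : expR (- (h / 2)) <= expR (h / 2) by rewrite ler_expR; lra.
have e2 : expR (h / 2) <= expR (k / 2) by rewrite ler_expR; lra.
have e3 : expR (- (k / 2)) <= expR (- (h / 2)) by rewrite ler_expR; lra.
by rewrite lerXn2r ?nnegrE//; lra.
Qed.

Lemma normr_sinh h : `|sinh h| <= cosh1 h + 1.
Proof.
by rewrite /sinh /cosh1 ler_norml; have := expR_gt0 h; have := expR_gt0 (- h); lra.
Qed.

Lemma hyperbolic_small (e : R) : 0 < e -> exists2 h0, 0 < h0 &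
  forall h, `|h| <= h0 -> `|sinh h| <= e /\ cosh1 h <= e.
Proof.
move=> e0; have /cvgrPdist_lt/(_ e e0) := @continuous_expR R 0.
move=> /nbhs_ballP[r /= r0 hr]; exists (r / 2); first by rewrite divr_gt0.
move=> h hh.
have h1 : `|1 - expR h| < e.
  by have := hr h; rewrite expR0; apply; rewrite /ball/= sub0r normrN; lra.
have h2 : `|1 - expR (- h)| < e.
  by have := hr (- h); rewrite expR0; apply; rewrite /ball/= sub0r normrN normrN; lra.
move: h1 h2; rewrite !ltr_norml => /andP[? ?] /andP[? ?].
by rewrite /sinh /cosh1 ler_norml; split; [apply/andP; split|]; lra.
Qed.

Let deriv_exp (a b h : R) : is_derive h 1 (fun t : R => a * expR (1 * t) + b * expR (-1 * t))
  (a * expR (1 * h) - b * expR (-1 * h)).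
Proof.
have := is_derive_affine b (is_derive_affine a (is_derive_cst (0 : R) h 1)
  (is_derive_expR_scale 1 h)) (is_derive_expR_scale (-1) h).
move=> H; have E : a * expR (1 * h) - b * expR (-1 * h) =
   0 + a * (1 * expR (1 * h)) + b * (-1 * expR (-1 * h)) by ring.
by rewrite E; apply: is_derive_ext H => t /=; rewrite add0r.
Qed.

(* A Taylor expansion in [sinh h] and [cosh h - 1] rather than in [h] and [h^2 / 2]:
   its expectation at a gaussian increment only involves exponential moments. *)
Lemma hyperbolic_taylor (u u1 u2 : R -> R) (lo hi B Lip : R) : 0 <= B -> 0 <= Lip ->
  (forall x, lo <= x <= hi -> is_derive x 1 u (u1 x)) ->
  (forall x, lo <= x <= hi -> is_derive x 1 u1 (u2 x)) ->
  (forall x, lo <= x <= hi -> `|u1 x| <= B /\ `|u2 x| <= B) ->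
  (forall x y, lo <= x <= hi -> lo <= y <= hi -> `|u2 x - u2 y| <= Lip * `|x - y|) ->
  forall om, 0 < om -> exists2 h0, 0 < h0 & forall z h, lo <= z <= hi -> lo <= z + h <= hi ->
    `|h| <= h0 -> u (z + h) <= u z + u1 z * sinh h + (u2 z + om) * cosh1 h.
Proof.
move=> B0 Lip0 ud u1d uB uL om om0.
(* The errors from [u1 z * sinh t], from [u2 z * cosh1 t] and from [u2 (z + t) - u2 z] are allotted
   [om / 3] each. *)
have e0 : 0 < om / (3 * (B + 1)) by rewrite divr_gt0// mulr_gt0//; lra.
have [h1 h10 hh] := hyperbolic_small e0.
have L0 : 0 < om / (3 * (Lip + 1)) by rewrite divr_gt0// mulr_gt0//; lra.
exists (Num.min h1 (om / (3 * (Lip + 1)))); first by rewrite lt_min h10.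
move=> z h zI zhI; rewrite le_min => /andP[hh1 hL].
(* [T] collects the exponentials of the claimed bound, whose remaining part is constant in [t]; it
   solves [T'' = T]. *)
pose a := (u1 z + (u2 z + om)) / 2; pose b := (- u1 z + (u2 z + om)) / 2.
pose T t := a * expR (1 * t) + b * expR (-1 * t).
pose T1 t := a * expR (1 * t) + (- b) * expR (-1 * t).
have TE t : u z + u1 z * sinh t + (u2 z + om) * cosh1 t = u z - (u2 z + om) + T t.
  by rewrite /T mul1r mulN1r /sinh /cosh1 /a /b; field.
have Td (t : R) : is_derive t 1 T (T1 t).
  by apply: (is_derive_eq (deriv_exp a b t)); rewrite /T1; ring.
have T1d (t : R) : is_derive t 1 T1 (T t).
  by apply: (is_derive_eq (deriv_exp a (- b) t)); rewrite /T; ring.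
have shift (t : R) : is_derive t 1 (fun s : R => s + z) 1.
  have -> : (fun s : R => s + z) = (@id R) + cst z by apply/funext.
  by apply: is_derive_eq; rewrite addr0.
have small t : `|t| <= `|h| -> lo <= t + z <= hi -> u2 (t + z) <= T t.
  move=> th tI.
  have [s1 s2] := hh t (le_trans th hh1).
  have := uL _ _ tI zI; rewrite addrK.
  have tL : Lip * `|t| <= om / 3.
    have : Lip * `|t| <= Lip * (om / (3 * (Lip + 1))) by rewrite ler_wpM2l// (le_trans th).
    move=> /le_trans; apply.
    rewrite mulrA ler_pdivrMr; last by rewrite mulr_gt0//; lra.
    by nra.
  move=> /le_trans/(_ tL); rewrite ler_norml => /andP[_ h3].
  have [B1 B2] := uB _ zI.
  have ee : (B + 1) * (om / (3 * (B + 1))) = om / 3 by field; lra.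
  have t1 : - (om / 3) <= u1 z * sinh t.
    have : `|u1 z * sinh t| <= om / 3.
      rewrite normrM -ee ler_pM//; first by rewrite (le_trans B1)// lerDl.
    by rewrite ler_norml => /andP[].
  have t2 : - (om / 3) <= u2 z * cosh1 t.
    have : `|u2 z * cosh1 t| <= om / 3.
      rewrite normrM -ee ler_pM//; first by rewrite (le_trans B2)// lerDl.
      by rewrite ger0_norm// cosh1_ge0.
    by rewrite ler_norml => /andP[].
  have t3 : 0 <= om * cosh1 t by rewrite mulr_ge0 ?cosh1_ge0// ltW.
  have : T t = u1 z * sinh t + (u2 z + om) * cosh1 t + (u2 z + om) by rewrite -[LHS](addKr (u z - (u2 z + om))) -TE; ring.
  by move=> ->; lra.
rewrite TE -subr_ge0.
have F'd t : lo <= t + z <= hi -> is_derive t 1 (fun t => T1 t + (-1) * u1 (t + z)) (T t + (-1) * u2 (t + z)).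
  by move=> tI; apply: is_derive_affine => //; apply: is_derive_shift; exact: u1d.
have Fd t : lo <= t + z <= hi -> is_derive t 1 (fun t => T t + (-1) * u (t + z)) (T1 t + (-1) * u1 (t + z)).
  by move=> tI; apply: is_derive_affine => //; apply: is_derive_shift; exact: ud.
have T10 : T1 0 + (-1) * u1 (0 + z) = 0.
  by rewrite /T1 !mulr0 expR0 add0r /a /b; field.
have T00 : T 0 + (-1) * u (0 + z) = u2 z + om - u z.
  by rewrite /T !mulr0 expR0 add0r /a /b; field.
(* By [small], [T'' = T] dominates the second derivative of [u] along the segment. So the difference
   is convex there with zero derivative at 0, hence minimal at 0. *)
have key : T 0 + (-1) * u (0 + z) <= T h + (-1) * u (h + z).
  case/andP: zI => z1 z2; rewrite addrC in zhI; case/andP: zhI => zh1 zh2.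
  have [h0|/ltW h0] := leP 0 h.
    have tI t : 0 <= t <= h -> lo <= t + z <= hi by move=> /andP[? ?]; apply/andP; split; lra.
    have tn t : 0 <= t <= h -> `|t| <= `|h| by move=> /andP[? ?]; rewrite !ger0_norm.
    apply: (ge0_derive_le h0 (fun t th => Fd t (tI t th))) => t th.
    rewrite -T10; case/andP: th => t0 th.
    have sub s : 0 <= s <= t -> 0 <= s <= h by move=> /andP[-> /le_trans]; apply.
    apply: (ge0_derive_le t0 (fun s st => F'd s (tI s (sub s st)))) => s st.
    by rewrite mulN1r subr_ge0; apply: small; [apply: tn; exact: sub|apply: tI; exact: sub].
  have tI t : h <= t <= 0 -> lo <= t + z <= hi by move=> /andP[? ?]; apply/andP; split; lra.
  have tn t : h <= t <= 0 -> `|t| <= `|h| by move=> /andP[? ?]; rewrite !ler0_norm// lerN2.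
  have : 0 + (-1) * (T h + (-1) * u (h + z)) <= 0 + (-1) * (T 0 + (-1) * u (0 + z)).
    apply: (ge0_derive_le (f := fun t => 0 + (-1) * (T t + (-1) * u (t + z))) h0
      (fun t th => is_derive_affine (-1) (is_derive_cst (0 : R) t 1) (Fd t (tI t th)))) => t /andP[th t0].
    have sub s : t <= s <= 0 -> h <= s <= 0 by move=> /andP[ts ->]; rewrite (le_trans th).
    have : T1 t + (-1) * u1 (t + z) <= T1 0 + (-1) * u1 (0 + z).
      apply: (ge0_derive_le t0 (fun s st => F'd s (tI s (sub s st)))) => s st.
      by rewrite mulN1r subr_ge0; apply: small; [apply: tn; exact: sub|apply: tI; exact: sub].
    by rewrite T10; lra.
  by lra.
by rewrite T00 in key; rewrite [z + h]addrC; lra.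
Qed.

(** Difference quotient of [expR (c * t)] at 0 over one mesh step. It tends to [c], so first-order
    expansions in the mesh become limits of [Q]. *)
Let Q (c : R) (n : nat) : R := (expR (c * mesh n) - 1) / mesh n.

Let mesh_cvg0 : @mesh R n @[n --> \oo] --> 0.
Proof.
apply/cvgrPdist_lt => e e0; have [n0 hn] := mesh_small e0.
by exists n0 => // n /= /hn h; rewrite sub0r normrN gtr0_norm ?mesh_gt0.
Qed.

Let Q_cvg c : Q c n @[n --> \oo] --> c.
Proof.
have l1 : (fun=> c) n @[n --> \oo] --> c by exact: cvg_cst.
have l2 : c / (1 - c * mesh n) @[n --> \oo] --> c.
  rewrite -[X in _ --> X]divr1; apply: cvgM; first exact: cvg_cst.
  apply: cvgV; first by rewrite oner_eq0.
  have : 1 - c * mesh n @[n --> \oo] --> 1 - c * 0.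
    by apply: cvgB; [exact: cvg_cst|apply: cvgM; [exact: cvg_cst|exact: mesh_cvg0]].
  by rewrite mulr0 subr0.
have c0 : 0 < (`|c| + 1)^-1 by rewrite invr_gt0 ltr_wpDl.
have [n0 hn] := mesh_small c0.
apply: (squeeze_cvgr _ l1 l2); near=> n.
have m0 := mesh_gt0 (R := R) n.
have cm : c * mesh n < 1.
  have : (n0 <= n)%N by near: n; exact: nbhs_infty_ge.
  move=> /hn h; have {h} : `|c| + 1 < (mesh n)^-1.
    by rewrite -[ltLHS]invrK ltf_pV2 ?posrE.
  move=> h; rewrite -ltr_pdivlMr// mul1r (le_lt_trans (ler_norm _))// (lt_trans _ h)//.
  by rewrite ltrDl.
have d0 : 0 < 1 - c * mesh n by rewrite subr_gt0.
apply/andP; rewrite /Q; split.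
  by rewrite ler_pdivlMr//; have := expR_ge1Dx (c * mesh n); lra.
rewrite ler_pdivrMr//.
rewrite mulrAC ler_pdivlMr// mulrBl mul1r lerBlDr.
have := expR_ge1Dx (- (c * mesh n)).
have ee : expR (c * mesh n) * expR (- (c * mesh n)) = 1 by rewrite -expRD subrr expR0.
move=> /(ler_wpM2l (expR_ge0 (c * mesh n))); rewrite ee.
by lra.
Unshelve. all: by end_near. Qed.

(* One step of a walk that is killed at rate [beta], where [U''/2 - rho U' <= beta (U - Phi)]:
   the generator inequality survives discretisation up to an error [e] per unit rate. *)
Lemma gaussian_step (beta rho B : R) (D : R -> bool) (U u1 u2 Phi : R -> R) :
  0 < beta -> 0 <= B -> measurable_fun setT U -> (forall x, 0 <= U x <= 1) ->
  (forall z, D z -> `|u1 z| <= B /\ `|u2 z| <= B) ->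
  (forall z, D z -> beta * Phi z <= beta * U z - (u2 z / 2 - rho * u1 z)) ->
  (forall om, 0 < om -> exists2 h0, 0 < h0 & forall z h, D z -> `|h| <= h0 ->
    U (z + h) <= U z + u1 z * sinh h + (u2 z + om) * cosh1 h) ->
  forall e, 0 < e -> exists n0, forall n, (n0 <= n)%N ->
  forall (d : measure_display) (T : measurableType d) (P : probability T R) (xi : T -> R),
  measurable_fun setT xi ->
  (forall th, (\int[P]_w (expR (th * xi w))%:E = (expR ((th ^+ 2 / 2 - th * rho) * mesh n))%:E)%E) ->
  forall z, D z ->
  let q := expR (- beta * mesh n) in
  (((1 - q) * Phi z)%:E + q%:E * \int[P]_w (U (z + xi w))%:E <= (U z + (1 - q) * e)%:E)%E.
Proof.
move=> beta0 B0 mU U01 uB PhiU loc e e0.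
have om0 : 0 < beta * e / 4 by rewrite divr_gt0// mulr_gt0.
have [h0 h00 hloc] := loc _ om0; set om := beta * e / 4 in om0 hloc.
have c00 := cosh1_gt0 h00; set c0 := cosh1 h0 in c00.
pose C := (1 + B) / c0 ^+ 2 + 2 * B / c0.
have C0 : 0 <= C.
  have c00' := ltW c00.
  by apply: addr_ge0; rewrite divr_ge0 ?exprn_ge0// ?mulr_ge0// addr_ge0.
have glob z h : D z -> U (z + h) <= U z + u1 z * sinh h + (u2 z + om) * cosh1 h + C * cosh1 h ^+ 2.
  move=> Dz; have [hh|hh] := leP `|h| h0.
    by apply: (le_trans (hloc z h Dz hh)); rewrite lerDl mulr_ge0// sqr_ge0.
  have [B1 B2] := uB z Dz; have /andP[Uz _] := U01 z; have /andP[_ Uh] := U01 (z + h).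
  have cc : c0 <= cosh1 h by apply: le_cosh1; apply: ltW.
  have sh := normr_sinh h; have chge := cosh1_ge0 h.
  have b1 : - (B * (cosh1 h + 1)) <= u1 z * sinh h.
    have : `|u1 z * sinh h| <= B * (cosh1 h + 1) by rewrite normrM ler_pM.
    by rewrite ler_norml => /andP[].
  have b2 : - (B * cosh1 h) <= u2 z * cosh1 h.
    have : `|u2 z * cosh1 h| <= B * cosh1 h by rewrite normrM ler_pM// ger0_norm.
    by rewrite ler_norml => /andP[].
  have b3 : 0 <= om * cosh1 h by rewrite mulr_ge0// ltW.
  have b4 : 1 + B + 2 * B * cosh1 h <= C * cosh1 h ^+ 2.
    pose r := cosh1 h / c0.
    have r1 : 1 <= r by rewrite ler_pdivlMr// mul1r.
    have -> : C * cosh1 h ^+ 2 = (1 + B) * r ^+ 2 + 2 * B * cosh1 h * r.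
      by rewrite /C /r; field; rewrite gt_eqF.
    have := ler_wpM2l (_ : 0 <= 2 * B * cosh1 h) r1.
    rewrite !mulr_ge0// mulr1 => /(_ isT) h5.
    have r2 : 1 <= r ^+ 2 by rewrite expr_ge1// (le_trans ler01).
    have := ler_wpM2l (_ : 0 <= 1 + B) r2; rewrite addr_ge0// mulr1 => /(_ isT) h6.
    by lra.
  by lra.
(* These are the exponents [th ^+ 2 / 2 - th * rho - beta] at [th = 1, -1, 2, -2]: moments of one
   increment, discounted by the survival factor [q]. *)
pose c1 := 1 / 2 - rho - beta; pose c2 := 1 / 2 + rho - beta.
pose c3 := 2 - 2 * rho - beta; pose c4 := 2 + 2 * rho - beta.
(* [a] and [b'] measure how far the coefficients of [u1] and [u2] are from the [- rho] and [1 / 2]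
   of the generator, rescaled by [kap n / beta]; [f] is the contribution of [cosh1 h ^+ 2]. All
   three tend to 0. *)
pose a n := (Q c1 n - Q c2 n) / 2 + (- Q (- beta) n) * (rho / beta).
pose b n := (Q c1 n + Q c2 n) / 2 - Q (- beta) n.
pose f n := (Q c3 n + Q c4 n) / 4 - (Q c1 n + Q c2 n) + 3 / 2 * Q (- beta) n.
pose kap n := - Q (- beta) n.
pose b' n := b n - kap n / (2 * beta).
have b0' : beta != 0 by rewrite gt_eqF.
have kap_cvg : kap n @[n --> \oo] --> beta.
  by rewrite -[X in _ --> X]opprK; apply: cvgN; exact: Q_cvg.
have a_cvg : a n @[n --> \oo] --> 0.
  have -> : 0 = (c1 - c2) / 2 + beta * (rho / beta) by rewrite /c1 /c2; field.
  by apply: cvgD; apply: cvgM => //; [apply: cvgB|exact: cvg_cst|exact: cvg_cst].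
have b_cvg : b n @[n --> \oo] --> (1 / 2 : R).
  have -> : 1 / 2 = (c1 + c2) / 2 - (- beta) :> R by rewrite /c1 /c2; field.
  by apply: cvgB => //; apply: cvgM; [apply: cvgD|exact: cvg_cst].
have b'_cvg : b' n @[n --> \oo] --> 0.
  have -> : 0 = 1 / 2 - beta / (2 * beta) :> R by field.
  by apply: cvgB => //; apply: cvgM => //; exact: cvg_cst.
have f_cvg : f n @[n --> \oo] --> 0.
  have -> : 0 = (c3 + c4) / 4 - (c1 + c2) + 3 / 2 * (- beta) :> R by rewrite /c1 /c2 /c3 /c4; field.
  apply: cvgD; first apply: cvgB.
  - by apply: cvgM; [apply: cvgD|exact: cvg_cst].
  - by apply: cvgD.
  - by apply: cvgM => //; exact: cvg_cst.
have e1 : 0 < beta * e / (8 * (B + 1)) by rewrite divr_gt0 ?mulr_gt0//; lra.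
have e2 : 0 < beta * e / (8 * (C + 1)) by rewrite divr_gt0 ?mulr_gt0//; lra.
have e3 : 0 < beta / 4 by rewrite divr_gt0.
have e4 : 0 < 1 / 2 :> R by rewrite divr_gt0.
have /cvgrPdist_lt/(_ _ e1) [na _ ha] := a_cvg.
have /cvgrPdist_lt/(_ _ e1) [nb _ hb] := b'_cvg.
have /cvgrPdist_lt/(_ _ e2) [nf _ hf] := f_cvg.
have /cvgrPdist_lt/(_ _ e3) [nk _ hk] := kap_cvg.
have /cvgrPdist_lt/(_ _ e4) [nb2 _ hb2] := b_cvg.
exists (maxn na (maxn nb (maxn nf (maxn nk nb2)))) => n.
rewrite !geq_max => /and5P[/ha Ha /hb Hb /hf Hf /hk Hk /hb2 Hb2] d T P xi mxi mgf z Dz /=; set q := expR (- beta * mesh n).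
have m0 := mesh_gt0 (R := R) n.
have q0 : 0 < q by exact: expR_gt0.
(* Pairs of a weight and an exponent: the global bound rewritten as a combination of [expR (th * h)]
   with [th = 0, 1, -1, 2, -2]. *)
pose s := [:: (U z - (u2 z + om) + C * (3 / 2), 0);
              ((u1 z + (u2 z + om)) / 2 - C, 1); ((- u1 z + (u2 z + om)) / 2 - C, -1);
              (C / 4, 2); (C / 4, -2)] : seq (R * R).
have sE h : U z + u1 z * sinh h + (u2 z + om) * cosh1 h + C * cosh1 h ^+ 2 =
    \sum_(p <- s) p.1 * expR (p.2 * h).
  rewrite !big_cons big_nil /= mul0r expR0 mul1r mulN1r mulNr !(expRM_natl 2).
  rewrite -[expR (- (2 * h))]invrK -expRN opprK expRM_natl -exprVn -expRN.
  have : expR h * expR (- h) = 1 by rewrite -expRD subrr expR0.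
  rewrite /sinh /cosh1; move: (expR h) (expR (- h)) => x y xy.
  have -> : ((x + y) / 2 - 1) ^+ 2 = (x ^+ 2 + y ^+ 2) / 4 + (x * y) / 2 - (x + y) + 1 by field.
  by rewrite xy; field.
have hint : (\int[P]_w (U (z + xi w))%:E <= (\sum_(p <- s) p.1 * expR ((p.2 ^+ 2 / 2 - p.2 * rho) * mesh n))%:E)%E.
  rewrite -(integral_expsum mxi mgf).
  have mUx : measurable_fun setT (fun w => U (z + xi w)).
    by apply: measurableT_comp => //; apply: measurable_funD.
  apply: ge0_le_integral => //.
  - by move=> w _; rewrite lee_fin; case/andP: (U01 (z + xi w)).
  - exact/measurable_EFinP.
  - apply/measurable_EFinP; apply: measurable_sum => p.
    by apply: measurable_funM => //; apply: measurableT_comp => //; apply: measurable_funM.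
  - by move=> w _; rewrite lee_fin -sE; exact: glob.
apply: (@le_trans _ _ (((1 - q) * Phi z)%:E + q%:E * (\sum_(p <- s) p.1 * expR ((p.2 ^+ 2 / 2 - p.2 * rho) * mesh n))%:E)%E).
  by rewrite leeD2l// lee_wpmul2l// lee_fin ltW.
rewrite -EFinM -EFinD lee_fin.
have qE c : q * expR (c * mesh n) = 1 + Q (c - beta) n * mesh n.
  rewrite /Q divfK ?gt_eqF// addrC subrK -expRD; congr expR; ring.
have q1E : 1 - q = kap n * mesh n.
  by rewrite /kap /Q mulNr divfK ?gt_eqF// opprB.
have SE : q * (\sum_(p <- s) p.1 * expR ((p.2 ^+ 2 / 2 - p.2 * rho) * mesh n)) =
   q * U z + mesh n * (u1 z * ((Q c1 n - Q c2 n) / 2) + (u2 z + om) * b n + C * f n).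
  rewrite !big_cons big_nil /= addr0 !mulrDr !(mulrCA q) !qE.
  have -> : 0 ^+ 2 / 2 - 0 * rho - beta = - beta by ring.
  have -> : 1 ^+ 2 / 2 - 1 * rho - beta = c1 by rewrite /c1; ring.
  have -> : (- 1) ^+ 2 / 2 - (- 1) * rho - beta = c2 by rewrite /c2; ring.
  have -> : 2 ^+ 2 / 2 - 2 * rho - beta = c3 by rewrite /c3; field.
  have -> : (- 2) ^+ 2 / 2 - (- 2) * rho - beta = c4 by rewrite /c4; field.
  have -> : q = 1 + Q (- beta) n * mesh n by rewrite -[LHS](subKr 1) q1E /kap; ring.
  by rewrite /b /f; field.
rewrite SE.
have key : u1 z * ((Q c1 n - Q c2 n) / 2) + (u2 z + om) * b n + C * f n <=
    kap n * (U z - Phi z + e).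
  have hPhi : (u2 z / 2 - rho * u1 z) / beta <= U z - Phi z.
    by rewrite ler_pdivrMr//; have := PhiU z Dz; lra.
  move: Hk; rewrite /= ltr_norml => /andP[k1 k2].
  have kap0 : 0 <= kap n by have := beta0; lra.
  have h1 := ler_wpM2l kap0 hPhi.
  have [B1 B2] := uB z Dz.
  have be8 : 0 < beta * e by rewrite mulr_gt0.
  have eB : B * (beta * e / (8 * (B + 1))) <= beta * e / 8.
    by rewrite mulrA ler_pdivrMr ?mulr_gt0//; nra.
  have eC : C * (beta * e / (8 * (C + 1))) <= beta * e / 8.
    by rewrite mulrA ler_pdivrMr ?mulr_gt0//; nra.
  have t1 : u1 z * a n <= beta * e / 8.
    apply: le_trans (ler_norm _) (le_trans _ eB); rewrite normrM ler_pM//.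
    by move: Ha; rewrite /= sub0r normrN => /ltW.
  have t2 : u2 z * b' n <= beta * e / 8.
    apply: le_trans (ler_norm _) (le_trans _ eB); rewrite normrM ler_pM//.
    by move: Hb; rewrite /= sub0r normrN => /ltW.
  have t3 : C * f n <= beta * e / 8.
    apply: le_trans (ler_norm _) (le_trans _ eC); rewrite normrM (ger0_norm C0) ler_wpM2l//.
    by move: Hf; rewrite /= sub0r normrN => /ltW.
  have t4 : om * b n <= beta * e / 4.
    rewrite -[leRHS]mulr1 ler_wpM2l ?(ltW om0)//.
    by move: Hb2; rewrite /= ltr_norml => /andP[? ?]; lra.
  (* The errors [t1] to [t4] add up to at most [5/8 * beta * e], less than this lower bound for
     [kap n * e]. *)
  have t5 : 3 / 4 * beta * e <= kap n * e by rewrite ler_pM2r//; lra.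
  have E : u1 z * ((Q c1 n - Q c2 n) / 2) + (u2 z + om) * b n + C * f n =
     kap n * ((u2 z / 2 - rho * u1 z) / beta) + u1 z * a n + u2 z * b' n + om * b n + C * f n.
    by rewrite /a /b' -/(kap n); field.
  by rewrite E; lra.
have := ler_wpM2l (ltW m0) key.
have -> : mesh n * (kap n * (U z - Phi z + e)) = (1 - q) * (U z - Phi z + e) by rewrite q1E; ring.
by lra.
Qed.

End one_step.

(** * One particle *)

Lemma within_continuous_ge0 {R : realType} (f : R -> R) :
  {within `[0, +oo[, continuous f} -> continuous_ge0 f.
Proof.
move=> cf x; apply/cvgrPdist_lt => e e0.
have m0 : Num.max 0 x \in `[0%R, +oo[ by rewrite in_itv/= andbT le_max lexx.
have /subspace_continuousP/(_ _ m0)/cvgrPdist_lt/(_ e e0) := cf.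
rewrite /within /= => h.
have /nbhs_ballP[r /= r0 hr] := @continuous_maxl R 0 x _ h.
apply/nbhs_ballP; exists r => //= t /hr /=.
by apply; rewrite in_itv/= andbT le_max lexx.
Qed.

Section one_particle.
Context {R : realType} {d : measure_display} {T : measurableType d}.
Variables (P : probability T R) (beta rho : R) (W : R -> {RV P >-> R}) (L : {RV P >-> R}).
Hypotheses (beta0 : 0 < beta) (L0 : forall w, 0 < L w)
  (L_law : forall A : set R, measurable A -> P (L @^-1` A) = exponential_prob beta A)
  (W_BM : standard_brownian_motion W).
Let GW := \bigcup_(t in [set t : R | 0 <= t]) sigma_of (W t).
Hypothesis LW : independent_classes P (sigma_of L) <<s GW >>.

Let W_incr n l w := W (l.+1%:R * mesh n) w - W (l%:R * mesh n) w.

Let xi n l w := W_incr n l w - rho * mesh n.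

Let mW_incr n l : measurable_fun setT (W_incr n l).
Proof. by apply: measurable_funB. Qed.

Let mxi n l : measurable_fun setT (xi n l).
Proof. by apply: measurable_funB. Qed.

Let xi_indep n : mutually_independent P (fun l => sigma_of (xi n l)).
Proof.
have [_ _ _ indep] := W_BM.
have t0 : 0 <= (0%N)%:R * mesh n :> R by exact: grid_ge0.
have tn : nondecreasing_seq (fun k : nat => k%:R * mesh n : R).
  by apply/nondecreasing_seqP => k; rewrite ler_pM2r ?mesh_gt0// ler_nat.
move=> m j jinj A FA; apply: (indep _ t0 tn m j jinj A) => k.
have [B mB <-] := FA k.
exists ((fun x => x - rho * mesh n) @^-1` B); last by rewrite !setTI.
rewrite -[X in measurable X]setTI.
have mf : measurable_fun setT (fun x : R => x - rho * mesh n) by apply: measurable_funB.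
exact: mf.
Qed.

Let xi_mgf n l th : (\int[P]_w (expR (th * xi n l w))%:E =
  (expR ((th ^+ 2 / 2 - th * rho) * mesh n))%:E)%E.
Proof.
have [_ _ law _] := W_BM.
have st : l%:R * mesh n < l.+1%:R * mesh n :> R by rewrite ltr_pM2r ?mesh_gt0// ltr_nat.
have dt : l.+1%:R * mesh n - l%:R * mesh n = mesh n :> R by rewrite -natr1 mulrDl mul1r addrAC subrr add0r.
have m0 := mesh_gt0 (R := R) n.
have mE : measurable_fun setT (fun x : R => (expR (th * x))%:E).
  by apply/measurable_EFinP; apply: measurableT_comp => //; apply: measurable_funM.
transitivity ((expR (- th * rho * mesh n))%:E * \int[P]_w (expR (th * W_incr n l w))%:E)%E.
  rewrite -ge0_integralZl//; last first.
    have mc : measurable_fun setT ((fun x : R => (expR (th * x))%:E) \o W_incr n l) by exact: measurableT_comp.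
    exact: mc.
  apply: eq_integral => w _; rewrite -EFinM -expRD; congr (expR _)%:E.
  by rewrite /xi; ring.
have -> : (\int[P]_w (expR (th * W_incr n l w))%:E =
    \int[normal_prob 0 (Num.sqrt (mesh n))]_x (expR (th * x))%:E)%E.
  have mX : measurable_fun setT (W_incr n l : T -> measurableTypeR R) by exact: mW_incr.
  pose X : {mfun T >-> measurableTypeR R} := HB.pack (W_incr n l : T -> measurableTypeR R) (isMeasurableFun.Build _ _ _ _ _ mX).
  transitivity (\int[distribution P X]_x (expR (th * x))%:E)%E.
    by rewrite ge0_integral_distribution// => x; rewrite lee_fin expR_ge0.
  apply: eq_measure_integral => A mA _.
  by have := law _ _ (grid_ge0 n l) st A mA; rewrite dt.
rewrite normal_mgf; last by rewrite gt_eqF// sqrtr_gt0.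
rewrite sqr_sqrtr ?(ltW m0)// -EFinM -expRD; congr (expR _)%:E.
by field.
Qed.

Let K n w := grid n (L w).

Let mK n : measurable_fun setT (K n).
Proof. exact: measurable_grid. Qed.

Let L_lt b : 0 <= b -> P [set w | L w < b] = (1 - expR (- beta * b))%:E.
Proof.
rewrite le_eqVlt => /predU1P[<-|b0].
  rewrite mulr0 expR0 subrr (_ : [set w | _] = set0) ?measure0//.
  by apply/seteqP; split => w //=; rewrite ltNge (ltW (L0 w)).
have -> : [set w | L w < b] = L @^-1` `[0, b[.
  by apply/seteqP; split => w /=; rewrite in_itv/= (ltW (L0 w)).
rewrite L_law// EFinB -exponential_prob_itv0c// /exponential_prob.
rewrite integral_itv_bndo_bndc//.
by apply/measurable_EFinP; apply: measurable_funTS; exact: measurable_exponential_pdf.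
Qed.

(** Memorylessness: the number of full mesh steps in an exponential time is geometric. *)
Let K_law n k : P (K n @^-1` [set k]) =
  (expR (- beta * mesh n) ^+ k * (1 - expR (- beta * mesh n)))%:E.
Proof.
have m0 := mesh_gt0 (R := R) n.
have KE : K n @^-1` [set k] = [set w | L w < k.+1%:R * mesh n] `\` [set w | L w < k%:R * mesh n].
  apply/seteqP; split => w /=.
    move=> <-; have /andP[h1 h2] := gridP n (ltW (L0 w)).
    rewrite -natr1 mulrDl mul1r; split => //; apply/negP; by rewrite -leNgt.
  move=> [h1 /negP]; rewrite -leNgt => h2.
  by apply: truncn_def; rewrite ler_pdivlMr// h2 ltr_pdivrMr.
have mlt b : measurable [set w | L w < b] by exact: measurable_set_lt.
rewrite KE measureD//; last by rewrite (le_lt_trans (probability_le1 _ _))// ltry.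
rewrite setIidr; last first.
  move=> w /= /lt_trans; apply; by rewrite ltr_pM2r// ltr_nat.
rewrite [X in (X - _)%E](L_lt (grid_ge0 n k.+1)) [X in (_ - X)%E](L_lt (grid_ge0 n k)).
rewrite -EFinB; congr EFin; rewrite -!expRM_natr.
have -> : - beta * (k.+1%:R * mesh n) = - beta * mesh n * k%:R + - beta * mesh n by rewrite -natr1; ring.
have -> : - beta * (k%:R * mesh n) = - beta * mesh n * k%:R by ring.
by rewrite expRD; ring.
Qed.

Let GWm : GW `<=` measurable.
Proof. by move=> X [t _]; apply: sigma_of_measurable. Qed.

Let xiG n l : sigma_of (xi n l) `<=` <<s GW >>.
Proof.
have mWG t : 0 <= t -> measurable_fun setT (W t : g_sigma_algebraType GW -> R).
  move=> t0; apply: measurable_sigma_of => X XX.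
  by apply: sub_sigma_algebra; exists t.
have : measurable_fun setT (xi n l : g_sigma_algebraType GW -> R).
  by apply: measurable_funB => //; apply: measurable_funB; apply: mWG; exact: grid_ge0.
by move=> m _ [B mB <-]; exact: m.
Qed.

Let KG n A B : <<s GW >> B -> P (K n @^-1` A `&` B) = (P (K n @^-1` A) * P B)%E.
Proof.
move=> GB; apply: LW => //; exists [set x | A (grid n x)].
  have mg : measurable_fun setT (fun x : R => grid n x) by exact: measurable_grid.
  by rewrite -[X in measurable X]setTI; exact: mg.
by rewrite setTI.
Qed.

Definition path z w t := z + (W t w - rho * t).

Lemma path_continuous z w : continuous_ge0 (path z w).
Proof.
have [_ cW _ _] := W_BM.
have cW' : continuous_ge0 (fun t => W t w) by exact: within_continuous_ge0 (cW w).
have cI : continuous_ge0 (fun t : R => rho * t).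
  move=> x; apply: (@cvgM _ _ _ _ (cst rho) (fun x => Num.max 0 x)); first exact: cvg_cst.
  exact: continuous_maxl.
move=> x; rewrite /path.
have h : W (Num.max 0 t) w - rho * Num.max 0 t @[t --> x] --> W (Num.max 0 x) w - rho * Num.max 0 x.
  exact: cvgB (cW' x) (cI x).
by apply: cvgD => //; exact: cvg_cst.
Qed.

Lemma path0 z w : path z w 0 = z.
Proof. by have [W0 _ _ _] := W_BM; rewrite /path W0 mulr0 subr0 addr0. Qed.

Let path_xi z n w i : path z w (i%:R * mesh n) = path z w 0 + \sum_(0 <= l < i) xi n l w.
Proof.
elim: i => [|i IH]; first by rewrite mul0r big_geq// addr0.
rewrite big_nat_recr//= addrA -IH /path /xi /W_incr -natr1; ring.
Qed.

Lemma measurable_path t z : measurable_fun setT (fun w => path z w t).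
Proof. by apply: measurable_funD => //; apply: measurable_funB. Qed.

(** Each discretised payoff has expectation at most [U z + e]. The mesh from which it dominates the
    true payoff up to a given error depends on the path, so the limit is taken through [liminf] and
    Fatou's lemma. *)
Lemma expected_payoff_le (y c1 c0 B : R) (gam : R -> R) (D : R -> bool) (Phi U u1 u2 : R -> R) (z : R) :
  0 <= c1 -> 0 <= c0 -> (forall x, 0 <= gam x) -> measurable_fun setT gam ->
  measurable_fun setT D -> measurable_fun setT Phi -> measurable_fun setT U ->
  (forall x, 0 <= Phi x) -> (forall x, 0 <= U x <= 1) -> (forall x, ~~ D x -> Phi x <= U x) ->
  0 <= B -> (forall x, D x -> `|u1 x| <= B /\ `|u2 x| <= B) ->
  (forall x, D x -> beta * Phi x <= beta * U x - (u2 x / 2 - rho * u1 x)) ->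
  (forall om, 0 < om -> exists2 h0, 0 < h0 & forall x h, D x -> `|h| <= h0 ->
    U (x + h) <= U x + u1 x * sinh h + (u2 x + om) * cosh1 h) ->
  (forall X l xi, continuous_ge0 X -> 0 < l ->
    (forall n i, X (i%:R * mesh n) = X 0 + \sum_(0 <= l < i) xi n l) ->
    forall e, 0 < e -> exists n0, forall n, (n0 <= n)%N ->
    payoff y X l c1 c0 gam <= stopped D Phi (grid n l) (X 0) (xi n) + e) ->
  (\int[P]_w (payoff y (path z w) (L w) c1 c0 gam)%:E <= (U z)%:E)%E.
Proof.
move=> c10 c00 gam0 mgam mD mPhi mU Phi0 U01 PhiU B0 uB hPhi loc pathwise.
apply/lee_addgt0Pr => e e0; rewrite -EFinD.
have [n0 hn] := gaussian_step beta0 B0 mU U01 uB hPhi loc e0.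
pose S n w := stopped D Phi (K n w) z (fun l => xi n l w).
have mS n : measurable_fun setT (S n).
  apply: (@measurable_countable_comp _ _ _ R (K n)
    (fun k w => stopped D Phi k z (fun l => xi n l w))) => // k.
  exact: measurable_stopped.
have U0 x : 0 <= U x by case/andP: (U01 x).
have SU n : (n0 <= n)%N -> (\int[P]_w (S n w)%:E <= (U z + e)%:E)%E.
  move=> n0n.
  have q01 : 0 <= expR (- beta * mesh n) <= 1.
    rewrite expR_ge0/= -[leRHS]expR0 ler_expR mulNr oppr_le0 mulr_ge0 ?(ltW beta0)//.
    by rewrite ltW// mesh_gt0.
  have st j x : D x -> (((1 - expR (- beta * mesh n)) * Phi x)%:E +
      (expR (- beta * mesh n))%:E * \int[P]_w (U (x + xi n j w))%:E <=
      (U x + (1 - expR (- beta * mesh n)) * e)%:E)%E.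
    by move=> Dx; exact: (hn n n0n _ _ _ _ (mxi n j) (xi_mgf n j) x Dx).
  exact: (@stopped_random_le _ _ _ P (xi n) (mxi n) (@xi_indep n) D Phi U
    (expR (- beta * mesh n)) e mD mPhi mU Phi0 U0 PhiU q01 (ltW e0) st
    (K n) (mK n) (K_law n) GW GWm (@xiG n) (@KG n) z).
have mpay : measurable_fun setT (fun w => payoff y (path z w) (L w) c1 c0 gam).
  apply: measurable_payoff => //.
  - by move=> t _; exact: measurable_path.
  - by move=> w; exact: path_continuous.
  - by move=> w; exact: ltW.
have pay0 w : 0 <= payoff y (path z w) (L w) c1 c0 gam.
  by rewrite /payoff; case: ifP => // _; case: ifP.
have limU : (limn_einf (fun n => \int[P]_w (S n w)%:E) <= (U z + e)%:E)%E.
  rewrite limn_einf_lim; apply: lime_le; first exact: is_cvg_einfs.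
  near=> n; apply: (@le_trans _ _ (\int[P]_w (S n w)%:E)%E).
    by apply: ereal_inf_lbound; exists n => /=.
  by apply: SU; near: n; exact: nbhs_infty_ge.
apply: le_trans limU.
have mSE n : measurable_fun setT (fun w => (S n w)%:E) by exact/measurable_EFinP.
have S0 n w : setT w -> (0 <= (S n w)%:E)%E by move=> _; rewrite lee_fin stopped_ge0.
apply: le_trans (fatou P measurableT mSE S0).
apply: ge0_le_integral => //.
- by move=> w _; rewrite lee_fin.
- exact/measurable_EFinP.
- rewrite /limn_einf; apply: measurableT_comp => //.
  apply: measurable_fun_limn_esup => // n.
  by apply: measurableT_comp => //; exact: mSE.
- move=> w _; apply/lee_addgt0Pr => e' e'0; rewrite -leeBlDr// -EFinB.
  have Xi n i : path z w (i%:R * mesh n) = path z w 0 + \sum_(0 <= l < i) xi n l w by exact: path_xi.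
  have [n1 hn1] := pathwise _ _ _ (@path_continuous z w) (L0 w) Xi e' e'0.
  rewrite limn_einf_lim; apply: lime_ge; first exact: is_cvg_einfs.
  exists n1 => // n /= n1n; apply: le_ereal_inf_tmp => _ [k /= nk <-].
  by have := hn1 k (leq_trans n1n nk); rewrite path0 lee_fin lerBlDr.
Unshelve. all: by end_near. Qed.

End one_particle.

Lemma derive_bounded_lipschitz {R : realType} (f df : R -> R) (lo hi C x y : R) :
  (forall t, lo <= t <= hi -> is_derive t 1 f (df t)) ->
  (forall t, lo <= t <= hi -> `|df t| <= C) ->
  lo <= x <= hi -> lo <= y <= hi -> `|f x - f y| <= C * `|x - y|.
Proof.
move=> fd dfC.
have main a b : lo <= a <= hi -> lo <= b <= hi -> a <= b -> `|f a - f b| <= C * `|a - b|.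
  move=> /andP[a1 a2] /andP[b1 b2] ab.
  have sub t : a <= t <= b -> lo <= t <= hi.
    by move=> /andP[h1 h2]; rewrite (le_trans a1 h1) (le_trans h2 b2).
  have [c cab E] : exists2 c, c \in `[a, b]%R & f b - f a = df c * (b - a).
    apply: MVT_segment => // [t|].
      by rewrite in_itv/= => /andP[/ltW h1 /ltW h2]; apply: fd; apply: sub; rewrite h1.
    apply: continuous_in_subspaceT => t; rewrite inE/= in_itv/= => tab.
    exact: is_derive_continuous (fd _ (sub _ tab)).
  rewrite distrC E normrM distrC ler_wpM2r//; apply: dfC; apply: sub.
  by move: cab; rewrite in_itv.
move=> xI yI; have [xy|/ltW yx] := leP x y; first exact: main.
by rewrite distrC (distrC x); exact: main.
Qed.

(** * Super- and subsolutions for the branching equation *)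

Section bbm_equation.
Context {R : realType} (beta : R) (p : nat -> R) (m rho : R).
Implicit Types (a c u x y z : R).
Hypotheses (beta_gt0 : 0 < beta) (p_pmf : is_pmf p) (m_mean : offspring_mean p = m%:E)
  (m_gt0 : 0 < m) (m_lt1 : m < 1).

Local Notation g := (offspring_success p).

Definition bbm_gamma : R := Num.sqrt (2 * (beta * (1 - m)) + rho ^+ 2).
Definition bbm_eta (u : R) : R := 2 * beta * (m * u - g u).

Local Notation gamma := bbm_gamma.
Local Notation eta := bbm_eta.
Let lam := rho + gamma.
Let mu := rho - gamma.
Let K := 2 * beta * m.
Let alpha := beta * (1 - m).

Let alpha_gt0 : 0 < alpha. Proof. by rewrite mulr_gt0// subr_gt0. Qed.

Let gamma_sqr : gamma ^+ 2 = 2 * alpha + rho ^+ 2.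
Proof. by rewrite sqr_sqrtr// addr_ge0 ?sqr_ge0// mulr_ge0// ltW. Qed.

Lemma rho_lt_gamma : `|rho| < gamma.
Proof.
rewrite -sqrtr_sqr ltr_sqrt; first by rewrite ltrDr mulr_gt0.
by rewrite ltr_wpDr ?sqr_ge0// mulr_gt0.
Qed.

Lemma bbm_lam_gt0 : 0 < rho + gamma.
Proof. by have := rho_lt_gamma; rewrite ltr_norml => /andP[]; lra. Qed.

Lemma bbm_mu_lt : rho - gamma < rho + gamma.
Proof. by have := rho_lt_gamma; rewrite ltr_norml => /andP[]; lra. Qed.

Lemma bbm_K_ge0 : 0 <= 2 * beta * m.
Proof. by rewrite mulr_ge0 ?(ltW m_gt0)// mulr_ge0// ltW. Qed.

Lemma bbm_eta0 : eta 0 = 0.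
Proof. by rewrite /bbm_eta (offspring_success0 p_pmf) mulr0 subr0 mulr0. Qed.

Let b2 : 0 <= 2 * beta. Proof. by rewrite mulr_ge0// ltW. Qed.

Lemma bbm_eta_nd : {homo eta : x y / x <= y}.
Proof.
move=> x y xy; rewrite /bbm_eta ler_wpM2l//.
by have := offspring_success_lip p_pmf m_mean xy; lra.
Qed.

Lemma bbm_eta_lip x y : x <= y -> eta y - eta x <= 2 * beta * m * (y - x).
Proof.
move=> xy; have := ler_wpM2l b2 (offspring_success_nd p_pmf xy).
by rewrite /bbm_eta; lra.
Qed.

Lemma bbm_eta_star c u : 0 <= c <= 1 -> 0 <= u -> eta (c * u) <= c * eta u.
Proof.
move=> c01 u0; have := ler_wpM2l b2 (offspring_success_star p_pmf c01 u0).
by rewrite /bbm_eta; lra.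
Qed.

Local Notation kpp := (kpp lam mu eta).
Local Notation slope := (kpp_slope lam mu eta).

Let kpp1 a x := mu * kpp a x + slope a x.
Let kpp2 a x := mu * kpp1 a x + (lam * slope a x + eta (kpp a x)).

Let kD a x : 0 <= a -> 0 <= x -> is_derive x 1 (kpp a) (kpp1 a x).
Proof. by move=> a0 x0; apply: (is_derive_kpp bbm_lam_gt0 bbm_mu_lt bbm_K_ge0 bbm_eta0 bbm_eta_nd bbm_eta_lip). Qed.

Let sD a x : 0 <= a -> 0 <= x -> is_derive x 1 (slope a) (lam * slope a x + eta (kpp a x)).
Proof. by move=> a0 x0; apply: (is_derive_kpp_slope bbm_lam_gt0 bbm_mu_lt bbm_K_ge0 bbm_eta0 bbm_eta_nd bbm_eta_lip). Qed.

Let k1D a x : 0 <= a -> 0 <= x -> is_derive x 1 (kpp1 a) (kpp2 a x).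
Proof.
move=> a0 x0.
have := is_derive_affine 1 (is_derive_affine mu (is_derive_cst (0 : R) x 1) (kD a0 x0)) (sD a0 x0).
move=> H; have -> : kpp2 a x = 0 + mu * kpp1 a x + 1 * (lam * slope a x + eta (kpp a x)).
  by rewrite /kpp2; ring.
by apply: is_derive_ext H => t; rewrite /kpp1 /=; ring.
Qed.

(** Generator form of the equation: [gamma ^+ 2] carries the linear part [alpha] of the branching
    term, and [eta] its remainder. *)
Let kpp_ode a x : kpp2 a x / 2 - rho * kpp1 a x = beta * (kpp a x - g (kpp a x)).
Proof.
have := gamma_sqr; rewrite /kpp2 /kpp1 /lam /mu /bbm_eta /alpha => h.
have -> : (rho - gamma) * ((rho - gamma) * kpp a x + slope a x) + ((rho + gamma) * slope a x + 2 * beta * (m * kpp a x - g (kpp a x))) = (rho ^+ 2 + gamma ^+ 2 - 2 * rho * gamma) * kpp a x + 2 * rho * slope a x + 2 * beta * (m * kpp a x - g (kpp a x)) by ring.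
by rewrite h; field.
Qed.

Let k0 a x : 0 <= a -> 0 <= x -> 0 <= kpp a x.
Proof. exact: (kpp_ge0 bbm_lam_gt0 bbm_mu_lt bbm_K_ge0 bbm_eta0 bbm_eta_nd bbm_eta_lip). Qed.

Let s0 a x : 0 <= a -> 0 <= x -> 0 <= slope a x.
Proof. exact: (kpp_slope_ge0 bbm_lam_gt0 bbm_mu_lt bbm_K_ge0 bbm_eta0 bbm_eta_nd bbm_eta_lip). Qed.

Let k_nd a x y : 0 <= a -> 0 <= x -> x <= y -> kpp a x <= kpp a y.
Proof. exact: (kpp_ndx bbm_lam_gt0 bbm_mu_lt bbm_K_ge0 bbm_eta0 bbm_eta_nd bbm_eta_lip). Qed.

Let s_nd a x y : 0 <= a -> 0 <= x -> x <= y -> slope a x <= slope a y.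
Proof.
move=> a0 x0 xy; apply: (ge0_derive_le xy (fun t ty => sD a0 (le_trans x0 (andP ty).1))) => t /andP[xt _].
have t0 := le_trans x0 xt.
rewrite addr_ge0//; first by rewrite mulr_ge0 ?s0// ltW// bbm_lam_gt0.
by rewrite (eta_ge0 bbm_eta0 bbm_eta_nd)// k0.
Qed.

(** The Lipschitz bound for the second derivative is read off the equation, which expresses [kpp2]
    through [kpp], the slope and the Lipschitz function [eta]; no third derivative is taken. *)
Let kpp_taylor_bounds a X : 0 <= a -> 0 <= X -> exists B Lip : R, [/\ 0 <= B, 0 <= Lip,
  forall x, 0 <= x <= X -> `|kpp1 a x| <= B /\ `|kpp2 a x| <= B &
  forall x y, 0 <= x <= X -> 0 <= y <= X -> `|kpp2 a x - kpp2 a y| <= Lip * `|x - y|].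
Proof.
move=> a0 X0.
have lam0 : 0 <= lam by exact: ltW bbm_lam_gt0.
have K0 : 0 <= K by exact: bbm_K_ge0.
pose k := kpp a X; pose s := slope a X.
have kX : 0 <= k by exact: k0.
have sX : 0 <= s by exact: s0.
have kx x : 0 <= x <= X -> 0 <= kpp a x <= k by move=> /andP[x0 xX]; rewrite k0// k_nd.
have sx x : 0 <= x <= X -> 0 <= slope a x <= s by move=> /andP[x0 xX]; rewrite s0// s_nd.
pose B1 := `|mu| * k + s; pose S1 := lam * s + K * k; pose B2 := `|mu| * B1 + S1.
have B10 : 0 <= B1 by rewrite addr_ge0// mulr_ge0.
have S10 : 0 <= S1 by rewrite addr_ge0// mulr_ge0.
have B20 : 0 <= B2 by rewrite addr_ge0// mulr_ge0.
have h1 x : 0 <= x <= X -> `|kpp1 a x| <= B1.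
  move=> xX; have /andP[? ?] := kx x xX; have /andP[? ?] := sx x xX.
  rewrite (le_trans (ler_normD _ _))// lerD//; last by rewrite ger0_norm.
  by rewrite normrM ler_wpM2l// ger0_norm.
have hs x : 0 <= x <= X -> `|lam * slope a x + eta (kpp a x)| <= S1.
  move=> xX; have /andP[k1 k2] := kx x xX; have /andP[s1 s2] := sx x xX.
  have e0 : 0 <= eta (kpp a x) by exact: (eta_ge0 bbm_eta0 bbm_eta_nd).
  rewrite ger0_norm; last by rewrite addr_ge0// mulr_ge0.
  rewrite lerD// ?ler_wpM2l//.
  have := bbm_eta_lip k1; rewrite bbm_eta0 !subr0 => /le_trans; apply.
  by rewrite ler_wpM2l.
have h2 x : 0 <= x <= X -> `|kpp2 a x| <= B2.
  move=> xX; rewrite (le_trans (ler_normD _ _))// lerD ?hs//.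
  by rewrite normrM ler_wpM2l// h1.
exists (B1 + B2), (`|mu| * B2 + (lam * S1 + K * B1)); split => //.
- by rewrite addr_ge0.
- by rewrite !addr_ge0// mulr_ge0.
- by move=> x xX; split; [rewrite (le_trans (h1 x xX))// lerDl|rewrite (le_trans (h2 x xX))// lerDr].
move=> x y xX yX.
have l1 := derive_bounded_lipschitz (fun t (tX : 0 <= t <= X) => k1D a0 (andP tX).1) h2 xX yX.
have l2 := derive_bounded_lipschitz (fun t (tX : 0 <= t <= X) => sD a0 (andP tX).1) hs xX yX.
have l3 := derive_bounded_lipschitz (fun t (tX : 0 <= t <= X) => kD a0 (andP tX).1) h1 xX yX.
have l4 : `|eta (kpp a x) - eta (kpp a y)| <= K * `|kpp a x - kpp a y|.
  have [xy|/ltW yx] := leP (kpp a x) (kpp a y).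
    rewrite distrC (distrC (kpp a x)) !ger0_norm ?subr_ge0 ?bbm_eta_nd//.
    exact: bbm_eta_lip.
  by rewrite !ger0_norm ?subr_ge0 ?bbm_eta_nd//; exact: bbm_eta_lip.
have -> : kpp2 a x - kpp2 a y = mu * (kpp1 a x - kpp1 a y) +
    (lam * (slope a x - slope a y) + (eta (kpp a x) - eta (kpp a y))) by rewrite /kpp2; ring.
rewrite (le_trans (ler_normD _ _))// [leRHS]mulrDl lerD//.
  by rewrite normrM -mulrA ler_wpM2l.
rewrite (le_trans (ler_normD _ _))// [leRHS]mulrDl lerD//.
  by rewrite normrM (ger0_norm lam0) -mulrA ler_wpM2l.
by rewrite (le_trans l4)// -mulrA ler_wpM2l.
Qed.

Lemma offspring_success_continuous : continuous g.
Proof.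
apply: (nd_lipschitz_continuous (ltW m_gt0)) => x y; first exact: offspring_success_nd.
exact: offspring_success_lip.
Qed.

Let kpp_max_continuous a c : 0 <= a -> continuous (fun x => kpp a (Num.max 0 (x + c))).
Proof.
move=> a0 x; have h : continuous_ge0 (kpp a).
  by apply: (derive_continuous_ge0 (df := kpp1 a)) => t t0; exact: kD.
apply: (@continuous_comp R R R (fun x => x + c) (fun x => kpp a (Num.max 0 x)) x); last exact: h.
by apply: cvgD; [exact: cvg_id|exact: cvg_cst].
Qed.

Let measurable_continuous (f : R -> R) : continuous f -> measurable_fun setT f.
Proof. exact: continuous_measurable_fun. Qed.

(* The shifts by [eps] leave room for the walk read off on a grid to overshoot [0] or [y]. *)
Definition super_profile a eps x := Num.min 1 (kpp a (Num.max 0 (x + eps))).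

(** Subtracting [kpp a eps] makes the profile vanish for [x <= eps], where the discretised walk
    counts as killed. *)
Definition sub_profile a eps x := Num.max 0 (Num.min 1 (kpp a (Num.max 0 x) - kpp a eps)).

Lemma super_profile01 a eps x : 0 <= a -> 0 <= super_profile a eps x <= 1.
Proof. by move=> a0; rewrite le_min ler01 k0 ?le_max ?lexx//= ge_min lexx. Qed.

Lemma sub_profile01 a eps x : 0 <= sub_profile a eps x <= 1.
Proof. by rewrite le_max lexx ge_max ler01 ge_min lexx. Qed.

Lemma super_profile_continuous a eps : 0 <= a -> continuous (super_profile a eps).
Proof.
move=> a0; pose V x := kpp a (Num.max 0 (x + eps)).
have -> : super_profile a eps = (fun x => (1 + V x - `|1 - V x|) / 2).
  by apply/funext => x; rewrite /super_profile minr_absE.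
move=> x; apply: cvgM; last exact: cvg_cst.
have cV := @kpp_max_continuous a eps a0 x.
apply: cvgB; first by apply: cvgD => //; exact: cvg_cst.
by apply: cvg_norm; apply: cvgB => //; exact: cvg_cst.
Qed.

Lemma sub_profile_continuous a eps : 0 <= a -> continuous (sub_profile a eps).
Proof.
move=> a0; pose V x := kpp a (Num.max 0 (x + 0)).
have -> : sub_profile a eps = (fun x => (0 + (1 + (V x - kpp a eps) - `|1 - (V x - kpp a eps)|) / 2 +
    `|0 - (1 + (V x - kpp a eps) - `|1 - (V x - kpp a eps)|) / 2|) / 2).
  by apply/funext => x; rewrite /sub_profile /V addr0 maxr_absE minr_absE.
move=> x.
have cV : V t - kpp a eps @[t --> x] --> V x - kpp a eps.
  by apply: cvgB; [exact: (@kpp_max_continuous a 0 a0 x)|exact: cvg_cst].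
have cm : (1 + (V t - kpp a eps) - `|1 - (V t - kpp a eps)|) / 2 @[t --> x] -->
    (1 + (V x - kpp a eps) - `|1 - (V x - kpp a eps)|) / 2.
  apply: cvgM; last exact: cvg_cst.
  apply: cvgB; first by apply: cvgD => //; exact: cvg_cst.
  by apply: cvg_norm; apply: cvgB => //; exact: cvg_cst.
apply: cvgM; last exact: cvg_cst.
apply: cvgD; first by apply: cvgD => //; exact: cvg_cst.
by apply: cvg_norm; apply: cvgB => //; exact: cvg_cst.
Qed.

Context {d : measure_display} {T : measurableType d}.
Variables (P : probability T R) (W : R -> {RV P >-> R}) (L : {RV P >-> R}).
Hypotheses (L0 : forall w, 0 < L w)
  (L_law : forall A : set R, measurable A -> P (L @^-1` A) = exponential_prob beta A)
  (W_BM : standard_brownian_motion W)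
  (LW : independent_classes P (sigma_of L)
     <<s \bigcup_(t in [set t : R | 0 <= t]) sigma_of (W t) >>).

Lemma expected_payoff_up a eps y z : 0 <= a -> 0 < eps -> 0 < y -> kpp a (y + eps) = 1 ->
  (\int[P]_w (payoff y (path rho W z w) (L w) 1 0 (fun x => g (super_profile a eps x)))%:E
    <= (super_profile a eps z)%:E)%E.
Proof.
move=> a0 eps0 y0 kY; set U := super_profile a eps.
pose V x := kpp a (Num.max 0 (x + eps)).
have V0 x : 0 <= V x by rewrite k0// le_max lexx.
have VE x : - eps <= x -> V x = kpp a (x + eps) by move=> xe; rewrite /V max_r//; lra.
have U01 x : 0 <= U x <= 1 by rewrite /U /super_profile le_min ler01 V0/= ge_min lexx.
have cU : continuous U by exact: super_profile_continuous.
have cgU : continuous (fun x => g (U x)) by move=> x; apply: (@continuous_comp _ _ _ U g); [exact: cU|exact: offspring_success_continuous].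
have gU01 x : 0 <= g (U x) <= 1 by exact: offspring_success01.
have mgU := measurable_continuous cgU.
(* The arguments of [kpp] lie in [[0, y + 2 * eps]]: a point of [D], the shift by [eps], and a jump
   of size at most [eps]. *)
have X0 : 0 <= y + 2 * eps by lra.
have [B [Lip [B0 Lip0 hB hL]]] := kpp_taylor_bounds a0 X0.
pose D x := (0 < x) && (x <= y).
have VD x : D x -> V x <= 1 /\ 0 <= x + eps <= y + 2 * eps.
  move=> /andP[x1 x2]; split; last by apply/andP; split; lra.
  by rewrite VE; [rewrite -kY k_nd//; lra|lra].
have UD x : D x -> U x = V x by move=> /VD[h _]; rewrite /U /super_profile min_r.
apply: (@expected_payoff_le _ _ _ P beta rho W L beta_gt0 L0 L_law W_BM LW y 1 0 B
  (fun x => g (U x)) D (fun x => if x <= 0 then 0 else if y < x then 1 else g (U x)) U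
  (fun x => kpp1 a (x + eps)) (fun x => kpp2 a (x + eps)) z) => //.
- by move=> x; case/andP: (gU01 x).
- by apply: measurable_and; [exact: measurable_fun_ltr|exact: measurable_fun_ler].
- apply: measurable_fun_ifT; [exact: measurable_fun_ler|exact: measurable_cst|].
  by apply: measurable_fun_ifT => //; exact: measurable_fun_ltr.
- exact: measurable_continuous.
- by move=> x; case: ifP => // _; case: ifP => // _; case/andP: (gU01 x).
- move=> x; rewrite negb_and -leNgt -ltNge => /orP[x0|yx].
    by rewrite x0; case/andP: (U01 x).
  have x0 : 0 < x by exact: lt_trans y0 yx.
  rewrite (leNgt x 0) x0/= yx /U /super_profile le_min lexx/= -kY -/(V x) VE; last by lra.
  by apply: k_nd => //; lra.
- by move=> x /VD[_ h]; exact: hB.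
- move=> x Dx; rewrite kpp_ode (UD x Dx) -VE; last by case/andP: Dx; lra.
  case/andP: (Dx) => x1 x2; rewrite (leNgt x 0) x1/= (ltNge y) x2/=.
  by lra.
- move=> om om0.
  have [h0 h00 hT] := hyperbolic_taylor (u := kpp a) B0 Lip0
    (fun t (tX : 0 <= t <= y + 2 * eps) => kD a0 (andP tX).1)
    (fun t (tX : 0 <= t <= y + 2 * eps) => k1D a0 (andP tX).1) hB hL om0.
  exists (Num.min h0 eps); first by rewrite lt_min h00.
  move=> x h Dx; rewrite le_min => /andP[hh he].
  have [_ xI] := VD x Dx; case/andP: (Dx) => x1 x2.
  have /andP[he1 he2] : - eps <= h <= eps by rewrite -ler_norml.
  have xhI : 0 <= x + eps + h <= y + 2 * eps by apply/andP; split; lra.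
  rewrite (UD x Dx) VE; last by lra.
  apply: le_trans (hT _ _ xI xhI hh).
  rewrite /U /super_profile ge_min; apply/orP; right; rewrite -/(V _) VE; last by lra.
  by rewrite addrAC.
- move=> X l xi cX l0 Xxi e e0.
  exact: (@payoff_le_stopped_up R X l y (fun x => g (U x)) cX l0 cgU gU01 xi Xxi e e0).
Qed.

(** [1 - sub_profile] is a supersolution for failure, so the same upper-bound argument applies. *)
Lemma expected_payoff_low a eps y z : 0 <= a -> 0 < eps -> 0 < y -> kpp a (y + 2 * eps) = 1 ->
  (\int[P]_w (payoff y (path rho W z w) (L w) 0 1 (fun x => 1 - g (sub_profile a eps x)))%:E
    <= (1 - sub_profile a eps z)%:E)%E.
Proof.
move=> a0 eps0 y0 kY; have eps0' := ltW eps0.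
pose U x := 1 - sub_profile a eps x.
pose V x := kpp a (Num.max 0 (x + 0)).
have UVE x : U x = 1 - Num.max 0 (Num.min 1 (V x - kpp a eps)) by rewrite /V addr0.
have subE x : sub_profile a eps x = 1 - U x by rewrite /U; ring.
under eq_integral do under eq_fun do rewrite subE.
rewrite subE (_ : 1 - (1 - U z) = U z); last by ring.
have VE x : 0 <= x -> V x = kpp a x by move=> x0; rewrite /V addr0 max_r.
have U01 x : 0 <= U x <= 1.
  by rewrite subr_ge0 gerBl le_max lexx ge_max ler01 ge_min lexx.
have cU : continuous U by move=> x; apply: cvgB; [exact: cvg_cst|exact: sub_profile_continuous].
pose gam x := 1 - g (1 - U x).
have cgam : continuous gam.
  move=> x; apply: cvgB; first exact: cvg_cst.
  apply: (@continuous_comp _ _ _ (fun x => 1 - U x) g); last exact: offspring_success_continuous.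
  by apply: cvgB; [exact: cvg_cst|exact: cU].
have gam01 x : 0 <= gam x <= 1.
  by have /andP[g1 g2] := offspring_success01 p_pmf (1 - U x); rewrite /gam; apply/andP; split; lra.
have mgam := measurable_continuous cgam.
have X0 : 0 <= y + 2 * eps by lra.
have [B [Lip [B0 Lip0 hB hL]]] := kpp_taylor_bounds a0 X0.
pose D x := (eps < x) && (x <= y + eps).
have UD x : eps <= x -> x <= y + 2 * eps -> 1 - U x = kpp a x - kpp a eps.
  move=> x1 x2; rewrite UVE VE; last by lra.
  have h1 : kpp a eps <= kpp a x by apply: k_nd => //; lra.
  have h2 : kpp a x <= 1 by rewrite -kY; apply: k_nd => //; lra.
  have h3 := k0 a0 eps0'.
  by rewrite min_r; [rewrite max_r; lra|lra].
have Ule x : 0 <= x -> x <= y + 2 * eps -> U x <= 1 - (kpp a x - kpp a eps).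
  move=> x1 x2; rewrite UVE VE//.
  have h2 : kpp a x <= 1 by rewrite -kY; apply: k_nd => //; lra.
  have h3 := k0 a0 eps0'.
  by rewrite min_r; [rewrite lerB// le_max lexx orbT|lra].
apply: (@expected_payoff_le _ _ _ P beta rho W L beta_gt0 L0 L_law W_BM LW y 0 1 B
  gam D (fun x => if x <= eps then 1 else if y + eps < x then 0 else gam x) U
  (fun x => - kpp1 a x) (fun x => - kpp2 a x) z) => //.
- by move=> x; case/andP: (gam01 x).
- by apply: measurable_and; [exact: measurable_fun_ltr|exact: measurable_fun_ler].
- apply: measurable_fun_ifT; [exact: measurable_fun_ler|exact: measurable_cst|].
  by apply: measurable_fun_ifT => //; exact: measurable_fun_ltr.
- exact: measurable_continuous.
- by move=> x; case: ifP => // _; case: ifP => // _; case/andP: (gam01 x).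
- move=> x; rewrite negb_and -leNgt -ltNge => /orP[xe|yx].
    rewrite xe UVE.
    have [x0|x0] := leP 0 x.
      rewrite VE// max_l; first by rewrite subr0.
      by rewrite ge_min; apply/orP; right; rewrite subr_le0 k_nd.
    have -> : V x = 0 by rewrite /V addr0 max_l ?(ltW x0)// kpp0.
    rewrite max_l; first by rewrite subr0.
    by rewrite ge_min; apply/orP; right; rewrite sub0r oppr_le0 k0.
  by case: ifP => [xe|_]; [lra|rewrite yx; case/andP: (U01 x)].
- move=> x /andP[x1 x2]; rewrite !normrN; apply: hB; apply/andP; split; lra.
- move=> x /andP[x1 x2]; rewrite (leNgt x eps) x1/= (ltNge (y + eps)) x2/= /gam.
  have := kpp_ode a x; have -> : U x = 1 - (1 - U x) by ring.
  rewrite (_ : 1 - (1 - (1 - U x)) = 1 - U x); last by ring.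
  rewrite UD; [|lra|lra].
  have ek := k0 a0 eps0'.
  have le : kpp a x - kpp a eps <= kpp a x by lra.
  have gl := offspring_success_lip p_pmf m_mean le.
  (* Lowering the profile by the constant [kpp a eps] preserves the inequality because [g] is
     Lipschitz with constant [m <= 1]. *)
  have gl2 : g (kpp a x) - g (kpp a x - kpp a eps) <= kpp a eps.
    by apply: (le_trans gl); rewrite opprB addrC subrK ler_piMl// ltW.
  have := ler_wpM2l (ltW beta_gt0) gl2; lra.
- move=> om om0.
  have nB x : 0 <= x <= y + 2 * eps -> `|- kpp1 a x| <= B /\ `|- kpp2 a x| <= B.
    by move=> xI; rewrite !normrN; exact: hB.
  have nL x x' : 0 <= x <= y + 2 * eps -> 0 <= x' <= y + 2 * eps ->
      `|- kpp2 a x - - kpp2 a x'| <= Lip * `|x - x'|.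
    by move=> xI x'I; rewrite -opprD normrN; exact: hL.
  have nD t : 0 <= t <= y + 2 * eps -> is_derive t 1 (fun x => - kpp1 a x) (- kpp2 a t).
    move=> /andP[t0 _]; have := is_derive_affine (-1) (is_derive_cst (0 : R) t 1) (k1D a0 t0).
    by rewrite add0r mulN1r; apply: is_derive_ext => x /=; rewrite add0r mulN1r.
  have [h0 h00 hT] := hyperbolic_taylor (u := fun x => 0 + (-1) * kpp a x)
    (u1 := fun x => - kpp1 a x) (u2 := fun x => - kpp2 a x) B0 Lip0
    (fun t (tX : 0 <= t <= y + 2 * eps) => is_derive_eq (is_derive_affine (-1) (is_derive_cst (0 : R) t 1) (kD a0 (andP tX).1)) (etrans (add0r _) (mulN1r _)))
    nD nB nL om0.
  exists (Num.min h0 eps); first by rewrite lt_min h00.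
  move=> x h /andP[x1 x2]; rewrite le_min => /andP[hh he].
  have /andP[he1 he2] : - eps <= h <= eps by rewrite -ler_norml.
  have xI : 0 <= x <= y + 2 * eps by apply/andP; split; lra.
  have xhI : 0 <= x + h <= y + 2 * eps by apply/andP; split; lra.
  have := hT _ _ xI xhI hh.
  have := UD x; have := Ule (x + h).
  case/andP: xhI => xh1 xh2 => /(_ xh1 xh2) u1 u2.
  have {}u2 : 1 - U x = kpp a x - kpp a eps by apply: u2; lra.
  by lra.
- move=> X l xi cX l0 Xxi e e0.
  exact: (@payoff_le_stopped_low R X l y gam cX l0 cgam gam01 xi Xxi eps e eps0 e0).
Qed.

End bbm_equation.

(** * Recursion over generations *)

Section reach.
Context {R : realType} {S : Type}.
Variables (rho y : R) (ell : particle -> S -> R) (off : particle -> S -> nat)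
  (mot : particle -> R -> S -> R).

Definition track (v : particle) (z : R) (s : S) (t : R) := z + (mot v t s - rho * t).

(* Some particle among [v] and its first [n] generations of descendants exceeds
   [y], its line of descent from [v] on having stayed positive, when [v] is born at [z]. *)
Fixpoint reach (n : nat) (v : particle) (z : R) (s : S) : Prop :=
  if n is n'.+1 then
    hits y (track v z s) (ell v s) \/
    (positive_until (track v z s) (ell v s) /\
     exists i, (i < off v s)%N /\ reach n' (i :: v) (track v z s (ell v s)) s)
  else False.

Lemma reachS n v z s : reach n v z s -> reach n.+1 v z s.
Proof.
elim: n v z => [//|n IH] v z [h|[h1 [i [h2 h3]]]]; first by left.
by right; split => //; exists i; split => //; exact: IH.
Qed.

End reach.

(** Used with [h := snd], to read the inputs of the progeny as functions on a product space. *)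
Lemma reach_comp {R : realType} {S S' : Type} (h : S -> S') (rho y : R)
    (ell : particle -> S' -> R) (off : particle -> S' -> nat) (mot : particle -> R -> S' -> R) n v z s :
  reach rho y (fun u s => ell u (h s)) (fun u s => off u (h s)) (fun u t s => mot u t (h s)) n v z s =
  reach rho y ell off mot n v z (h s).
Proof.
elim: n v z => [//|n IH] v z /=.
by under eq_exists do rewrite IH.
Qed.

Section measurable_reach.
Context {R : realType} {dS : measure_display} {S : measurableType dS}.
Variables (rho y : R) (ell : particle -> S -> R) (off : particle -> S -> nat)
  (mot : particle -> R -> S -> R).
Hypotheses (ell0 : forall v s, 0 <= ell v s)
  (cmot : forall v s, continuous_ge0 (fun t => mot v t s)).

Lemma track_continuous v z s : continuous_ge0 (track rho mot v z s).
Proof.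
move=> x; have h : mot v (Num.max 0 t) s - rho * Num.max 0 t @[t --> x] -->
    mot v (Num.max 0 x) s - rho * Num.max 0 x.
  apply: cvgB; first exact: cmot.
  by apply: cvgM; [exact: cvg_cst|exact: continuous_maxl].
by apply: cvgD => //; exact: cvg_cst.
Qed.

(** Measurability is asked only of the inputs at labels [u ++ v], so the result holds in the
    sigma-algebra generated by the subtree of [v] alone; independence of siblings rests on this. *)
Lemma measurable_reach n v (z : S -> R) :
  (forall u, measurable_fun setT (ell (u ++ v))) ->
  (forall u, measurable_fun setT (off (u ++ v))) ->
  (forall u t, 0 <= t -> measurable_fun setT (mot (u ++ v) t)) ->
  measurable_fun setT z -> measurable [set s | reach rho y ell off mot n v (z s) s].
Proof.
elim: n v z => [|n IH] v z mell moff mmot mz /=; first by rewrite (_ : [set _ | _] = set0).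
have mtr t : 0 <= t -> measurable_fun setT (fun s => track rho mot v (z s) s t).
  by move=> t0; apply: measurable_funD => //; apply: measurable_funB => //; exact: (mmot [::]).
have ctr s : continuous_ge0 (track rho mot v (z s) s) by exact: track_continuous.
have mZ : measurable_fun setT (fun s => track rho mot v (z s) s (ell v s)).
  exact: (measurable_path_at (X := fun s => track rho mot v (z s) s) mtr ctr (mell [::]) (ell0 v)).
rewrite (_ : [set s | _] = [set s | hits y (track rho mot v (z s) s) (ell v s)] `|`
  ([set s | positive_until (track rho mot v (z s) s) (ell v s)] `&`
   \bigcup_i ([set s | (i < off v s)%N] `&`
     [set s | reach rho y ell off mot n (i :: v) (track rho mot v (z s) s (ell v s)) s]))); last first.
  apply/seteqP; split => s /=.
    by move=> [h|[h1 [i [h2 h3]]]]; [left|right; split => //; exists i].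
  by move=> [h|[h1 [i _ [h2 h3]]]]; [left|right; split => //; exists i].
apply: measurableU.
  exact: (measurable_hits (X := fun s => track rho mot v (z s) s) mtr ctr y (mell [::])).
apply: measurableI.
  exact: (measurable_positive_until (X := fun s => track rho mot v (z s) s) mtr ctr (mell [::]) (ell0 v)).
apply: bigcupT_measurable => i; apply: measurableI.
  rewrite -[X in measurable X]setTI.
  exact: (moff [::] measurableT [set k | (i < k)%N]).
have catE u : u ++ i :: v = (u ++ [:: i]) ++ v by rewrite -catA.
by apply: IH => // [u|u|u t t0]; rewrite catE; auto.
Qed.

End measurable_reach.

(** * From the killed maximum to the recursive event *)

Section killed_maximum.
Context {R : realType} {beta : R} {p : nat -> R} {d : measure_display}
  {T : measurableType d} {P : probability T R}.
Variables (N : branching_inputs beta p P) (rho x : R) (w : T).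

Let life v := lifetime N v w.
Let bp v := birth_place N rho x v w.
Let bt v := birth_time N v w.
Let tr v := track rho (fun v t w => motion N v t w) v (bp v) w.

Let displacement0 v : displacement N rho v 0 w = 0.
Proof. by rewrite /displacement; have [-> _ _ _] := motion_law N v; rewrite mulr0 subr0. Qed.

Let bt_ge0 v : 0 <= bt v.
Proof.
elim: v => [|i v IH] /=; first by rewrite /bt.
by rewrite /bt /= addr_ge0// ltW// lifetime_gt0.
Qed.

Let position_after v s : bt v <= s -> position N rho x v s w = tr v (s - bt v).
Proof. by case: v => [|i v] h; rewrite /= -/(bt _) h. Qed.

Fixpoint ancestors_positive (v : particle) : Prop :=
  if v is _ :: v' then ancestors_positive v' /\ positive_until (tr v') (life v') else True.

(** Induction along the ancestral line: the time interval splits at the birth time, before which the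
    position is that of the parent and at which child and parent are at the same place. *)
Let position_positive v t : bt v <= t ->
  (forall s, 0 <= s <= t -> 0 < position N rho x v s w) <->
  (ancestors_positive v /\ positive_until (tr v) (t - bt v)).
Proof.
elim: v t => [|i v IH] t btt.
  split=> [h|[_ h] s /andP[s0 st]]; last first.
    by rewrite position_after//; apply: h; rewrite /bt /= !subr0 s0.
  split => // s; rewrite /bt /= subr0 => st.
  have := h s st; rewrite position_after ?/bt/= ?subr0//.
  by case/andP: st.
have bS : bt (i :: v) = bt v + life v by [].
have L0 : 0 < life v by exact: lifetime_gt0.
have bvt : bt v <= bt (i :: v) by rewrite bS lerDl ltW.
have bE : bt (i :: v) - bt v = life v by rewrite bS addrAC subrr add0r.
have pos_early s : s < bt (i :: v) -> position N rho x (i :: v) s w = position N rho x v s w.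
  by move=> sb; rewrite /= -/(bt v) -/(life v) -bS leNgt sb.
have pos_at : position N rho x (i :: v) (bt (i :: v)) w = position N rho x v (bt (i :: v)) w.
  rewrite !position_after// subrr bE /tr /track /bp /=.
  have := displacement0 (i :: v); rewrite /displacement => ->.
  by rewrite addr0.
have early : (forall s, 0 <= s <= bt (i :: v) -> 0 < position N rho x v s w) <->
   (ancestors_positive v /\ positive_until (tr v) (life v)) by rewrite -bE; exact: IH.
split => [h|[[hv hp'] hp] s /andP[s0 st]].
  split.
    apply: early.1 => s /andP[s0]; rewrite le_eqVlt => /predU1P[->|sb].
      by rewrite -pos_at; apply: h; rewrite bt_ge0.
    by rewrite -(pos_early _ sb); apply: h; rewrite s0 (le_trans (ltW sb)).
  move=> r /andP[r0 rt]; have := h (bt (i :: v) + r).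
  rewrite position_after; last by rewrite lerDl.
  rewrite [_ + r]addrC addrK; apply.
  by rewrite addr_ge0 ?bt_ge0//= -lerBrDr.
have [bs|sb] := leP (bt (i :: v)) s.
  by rewrite position_after//; apply: hp; rewrite subr_ge0 bs lerD2r.
by rewrite pos_early//; apply: (early.2 (conj hv hp')); rewrite s0 ltW.
Qed.

Let alive v : Prop := is_born N v w /\ ancestors_positive v.

Let reachN y n v z := reach rho y (lifetime N) (offspring N) (fun v t w => motion N v t w) n v z w.

Let alive_reach_root y n v : alive v -> reachN y n v (bp v) -> exists n', reachN y n' [::] x.
Proof.
elim: v n => [|i v IH] n; first by exists n.
move=> [/andP[bv iv] [av pv]] h; apply: (IH n.+1) => //.
by right; split => //; exists i.
Qed.

Let reach_alive y n v : alive v -> reachN y n v (bp v) ->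
  exists u, alive u /\ hits y (tr u) (life u).
Proof.
elim: n v => [|n IH] v av //= [h|[h1 [i [h2 h3]]]]; first by exists v.
apply: (IH (i :: v)) => //; case: av => bv av; split => //=.
by rewrite bv.
Qed.

(** A number strictly below a supremum is exceeded by some member, so the two nested suprema
    dissolve into a time and a particle. That particle is then reached from the root along its
    ancestral line. *)
Lemma killed_all_time_max_reach y : (y%:E < killed_all_time_max N rho x w)%E <->
  exists n, reach rho y (lifetime N) (offspring N) (fun v t w => motion N v t w) n [::] x w.
Proof.
transitivity (exists u, alive u /\ hits y (tr u) (life u)); last first.
  split; last by move=> [n h]; apply: (reach_alive _ h).
  by move=> [u [au hu]]; apply: (@alive_reach_root y 1 u) => //; left.
transitivity (exists t, 0 <= t /\ exists u, killed_population N rho x t w u /\ y < position N rho x u t w).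
  split.
    move=> /ereal_sup_gt[_ [t /= t0 <-] /ereal_sup_gt[_ [u /= ku <-]]].
    by rewrite lte_fin => yu; exists t; split => //; exists u.
  move=> [t [t0 [u [ku yu]]]].
  have h1 : (y%:E < killed_max_position N rho x t w)%E.
    apply: (@lt_le_trans _ _ (position N rho x u t w)%:E); first by rewrite lte_fin.
    by apply: ereal_sup_ubound; exists u.
  by apply: (lt_le_trans h1); apply: ereal_sup_ubound; exists t.
split.
  move=> [t [t0 [u [[[bu /andP[b1 b2]] pu] yu]]]]; exists u.
  have [au pu'] := (position_positive b1).1 pu; split => //.
  exists (t - bt u); split => //; last by rewrite -position_after.
  by rewrite subr_ge0 b1 ltrBlDl.
move=> [u [[bu au] [a [/andP[a0 aL] ya pa]]]].
exists (bt u + a); split; first by rewrite addr_ge0 ?bt_ge0.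
have bta : bt u <= bt u + a by rewrite lerDl.
have aE : bt u + a - bt u = a by rewrite addrAC subrr add0r.
exists u; split; last by rewrite position_after// aE.
split; first by split => //; rewrite bta /death_time ltrD2l.
by apply: (position_positive bta).2; rewrite aE.
Qed.

End killed_maximum.

HB.instance Definition _ := gen_eqMixin source.

Definition source_particle (e : source) : particle :=
  match e with LifetimeOf u => u | OffspringOf u => u | MotionOf u => u end.

(** Names carry the most recent rank first, so the descendants of [v] are the names with suffix [v],
    including [v] itself. *)
Definition descent (v : particle) : set source :=
  [set e | exists u, source_particle e = u ++ v].

Definition own_path (v : particle) : set source := [set e | e = LifetimeOf v \/ e = MotionOf v].

(** What [own_path v] leaves out of [descent v]: the inputs that matter from the death of [v] on,
    its offspring number among them. *)
Definition progeny (v : particle) : set source :=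
  [set e | e = OffspringOf v \/ exists i, descent (i :: v) e].

Lemma descent_inj i j v e : descent (i :: v) e -> descent (j :: v) e -> i = j.
Proof.
move=> [s es] [t]; rewrite {}es -!cat_rcons => st.
have := congr1 size st; rewrite !size_cat => /addIn szE.
by move/eqP: st; rewrite eqseq_cat// => /andP[/eqP/rcons_inj[]].
Qed.

Lemma descent_child_neq i v e : descent (i :: v) e -> source_particle e <> v.
Proof.
move=> [u ->] /(congr1 size); rewrite size_cat /= => h.
by have : (size v < size u + (size v).+1)%N by [rewrite addnS ltnS leq_addl]; rewrite h ltnn.
Qed.

Lemma own_path_progeny v : own_path v `&` progeny v = set0.
Proof.
apply/seteqP; split => // e [[->|->] [//|[i]]] /descent_child_neq; exact.
Qed.

(** * The branching property and induction over generations *)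

Section recursion.
Context {R : realType} {beta : R} {p : nat -> R} {d : measure_display}
  {T : measurableType d} {P : probability T R}.
Variables (N : branching_inputs beta p P) (rho y : R).

Let Fs (e : source) : set (set T) :=
  match e with
  | LifetimeOf u => sigma_of (lifetime N u)
  | OffspringOf u => sigma_of (offspring N u)
  | MotionOf u => <<s \bigcup_(t in [set t : R | 0 <= t]) sigma_of (motion N u t) >>
  end.

Let motion_m u : \bigcup_(t in [set t : R | 0 <= t]) sigma_of (motion N u t) `<=` measurable.
Proof. by move=> A [t _]; exact: sigma_of_measurable. Qed.

Let Fs_m e : Fs e `<=` measurable.
Proof.
case: e => u /=; [exact: sigma_of_measurable|exact: sigma_of_measurable|].
by apply: smallest_sub; [exact: sigma_algebra_measurable|exact: motion_m].
Qed.

Let Fs_I e : setI_closed (Fs e).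
Proof.
case: e => u /=; [exact: sigma_ofI|exact: sigma_ofI|].
move=> A B; exact: (@measurableI _ (g_sigma_algebraType (\bigcup_(t in [set t : R | 0 <= t]) sigma_of (motion N u t)))).
Qed.

Let Fs_T e : Fs e setT.
Proof.
case: e => u /=; [exact: sigma_ofT|exact: sigma_ofT|].
exact: (@measurableT _ (g_sigma_algebraType (\bigcup_(t in [set t : R | 0 <= t]) sigma_of (motion N u t)))).
Qed.

Let sb (A : set source) := sigma_block Fs A.

Let sb_m A : sb A `<=` measurable. Proof. exact: sigma_block_measurable. Qed.

Let sbs_m A : <<s sb A >> `<=` measurable.
Proof. by apply: smallest_sub; [exact: sigma_algebra_measurable|exact: sb_m]. Qed.

Let sb_indep A B : A `&` B = set0 -> independent_classes P <<s sb A >> <<s sb B >>.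
Proof. by move=> AB; apply: sigma_block_independent => //; exact: inputs_independent. Qed.

Let Fs_sb A e : A e -> Fs e `<=` <<s sb A >>.
Proof. by move=> Ae X FX; apply: sub_sigma_algebra; exists e. Qed.

Let m_life A u : A (LifetimeOf u) ->
  measurable_fun setT (lifetime N u : g_sigma_algebraType (sb A) -> R).
Proof. by move=> h; apply: measurable_sigma_of; exact: (@Fs_sb A (LifetimeOf u)). Qed.

Let m_off A u : A (OffspringOf u) ->
  measurable_fun setT (offspring N u : g_sigma_algebraType (sb A) -> nat).
Proof. by move=> h; apply: measurable_sigma_of; exact: (@Fs_sb A (OffspringOf u)). Qed.

Let m_mot A u t : A (MotionOf u) -> 0 <= t ->
  measurable_fun setT (motion N u t : g_sigma_algebraType (sb A) -> R).
Proof.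
move=> h t0; apply: measurable_sigma_of => X sX; apply: (@Fs_sb A (MotionOf u)) => //=.
by apply: sub_sigma_algebra; exists t.
Qed.

Let life0 u w : 0 <= lifetime N u w. Proof. exact/ltW/lifetime_gt0. Qed.

Let mot_continuous u w : continuous_ge0 (fun t => motion N u t w).
Proof.
by have [_ c _ _] := motion_law N u; exact: within_continuous_ge0 (c w).
Qed.

Let rch n v z : set T := [set w | reach rho y (lifetime N) (offspring N) (fun v t w => motion N v t w) n v z w].

Let rch_sb A n v z : descent v `<=` A -> <<s sb A >> (rch n v z).
Proof.
move=> vA; have h e u : source_particle e = u ++ v -> A e by move=> eE; apply: vA; exists u.
apply: (@measurable_reach R _ (g_sigma_algebraType (sb A)) rho y (lifetime N) (offspring N)
  (fun v t w => motion N v t w) _ _ n v (fun=> z)) => //.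
- by move=> u; apply: m_life; exact: (h _ u).
- by move=> u; apply: m_off; exact: (h _ u).
- by move=> u t t0; apply: m_mot => //; exact: (h _ u).
Qed.

Let rch_m n v z : measurable (rch n v z).
Proof. by apply: (sbs_m (A := setT)); exact: rch_sb. Qed.

Let some n v x k : set T := [set w | exists i, (i < k)%N /\ rch n (i :: v) x w].

Let someE n v x k : some n v x k = \bigcup_(i < k) rch n (i :: v) x.
Proof. by apply/seteqP; split => w [i]; [case=> ik h; exists i|move=> ik h; exists i]. Qed.

Let some_sb A n v x k : (forall i, (i < k)%N -> descent (i :: v) `<=` A) -> <<s sb A >> (some n v x k).
Proof.
move=> h; rewrite someE.
apply: (@bigcup_measurable _ (g_sigma_algebraType (sb A))) => i ik.
by apply: rch_sb; exact: h.
Qed.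

Let some_m n v x k : measurable (some n v x k).
Proof. by apply: (sbs_m (A := setT)); exact: some_sb. Qed.

Let pr A := fine (P A).

Let prE A : measurable A -> P A = (pr A)%:E.
Proof. by move=> mA; rewrite fineK// fin_num_measure. Qed.

Let pr01 A : measurable A -> 0 <= pr A <= 1.
Proof. by move=> mA; rewrite -!lee_fin -prE// measure_ge0 probability_le1. Qed.

Let q n v x k := pr (some n v x k).

Let q0 n v x : q n v x 0 = 0.
Proof.
rewrite /q /pr (_ : some n v x 0 = set0) ?measure0//.
by apply/seteqP; split => // w [i []].
Qed.

(** Inclusion-exclusion; the line of child [k] uses other inputs than those of its elder siblings
    and is independent of them. *)
Let qS n v x k : q n v x k.+1 = q n v x k + (1 - q n v x k) * pr (rch n (k :: v) x).
Proof.
set A := some n v x k; set B := rch n (k :: v) x.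
have mA : measurable A by exact: some_m.
have mB : measurable B by exact: rch_m.
have SE : some n v x k.+1 = A `|` B.
  apply/seteqP; split => w.
    move=> [i []]; rewrite ltnS leq_eqVlt => /predU1P[->|ik] h; [by right|by left; exists i].
  by move=> [[i [ik h]]|h]; [exists i; split => //; exact: ltnW|exists k].
have AB : P (A `&` B) = (P A * P B)%E.
  apply: (sb_indep (A := \bigcup_(i in [set i | (i < k)%N]) descent (i :: v)) (B := descent (k :: v))).
  - by apply/seteqP; split => // e [[i ik /descent_inj h] /h ik']; move: ik; rewrite /= ik' ltnn.
  - by apply: some_sb => i ik e h; exists i.
  - exact: rch_sb.
have : (q n v x k.+1)%:E = ((pr A + pr B - pr A * pr B)%R)%:E.
  rewrite -prE; last exact: some_m.
  have UE : P (A `|` B) = (P A + P B - P (A `&` B))%E.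
    by rewrite measureUfinr//; exact: le_lt_trans (probability_le1 P mB) (ltry 1).
  by rewrite SE UE AB !prE// -EFinM -EFinD -EFinB.
by move=> [->]; rewrite /q -/A; ring.
Qed.

Let q01 n v x k : 0 <= q n v x k <= 1. Proof. by apply: pr01; exact: some_m. Qed.

Let q_le n v x u k : 0 <= u <= 1 -> (forall i, pr (rch n (i :: v) x) <= u) ->
  q n v x k <= some_of k u.
Proof.
move=> u01 hu; rewrite some_ofE//; elim: k => [|k IH]; first by rewrite q0 expr0 subrr.
have /andP[h0 h1] := q01 n v x k; have := hu k; rewrite qS exprS.
have := ler_wpM2r; move: u01 => /andP[u0 u1].
set P1 := pr _ => _ Pu.
have /andP[P0 P11] : 0 <= P1 <= 1 by apply: pr01; exact: rch_m.
have e1 : (1 - q n v x k) * P1 <= (1 - q n v x k) * u by rewrite ler_wpM2l// subr_ge0.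
have e2 : (1 - u) * q n v x k <= (1 - u) * (1 - (1 - u) ^+ k) by rewrite ler_wpM2l// subr_ge0.
by lra.
Qed.

(** Each child loses at most [dl], so the error is linear in [k] and averages to [m * dl] under the
    offspring law. *)
Let q_ge n v x u dl k : 0 <= u <= 1 -> 0 <= dl -> (forall i, u - dl <= pr (rch n (i :: v) x)) ->
  some_of k u <= q n v x k + dl * k%:R.
Proof.
move=> u01 dl0 hu; rewrite some_ofE//; elim: k => [|k IH]; first by rewrite q0 expr0 subrr mulr0 addr0.
have /andP[h0 h1] := q01 n v x k; have := hu k; rewrite qS exprS -natr1.
move: u01 => /andP[u0 u1]; set P1 := pr _ => Pu.
have e1 : (1 - q n v x k) * (u - dl) <= (1 - q n v x k) * P1 by rewrite ler_wpM2l// subr_ge0.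
have e2 : (1 - u) * (1 - (1 - u) ^+ k) <= (1 - u) * (q n v x k + dl * k%:R) by rewrite ler_wpM2l// subr_ge0.
have e3 : 0 <= u * (dl * k%:R) by rewrite !mulr_ge0.
have e4 : 0 <= q n v x k * dl by rewrite mulr_ge0.
by lra.
Qed.

Let child n v x : set T := [set w | exists i, (i < offspring N v w)%N /\ rch n (i :: v) x w].

Let child_sb n v x : <<s sb (progeny v) >> (child n v x).
Proof.
have -> : child n v x = \bigcup_i ([set w | (i < offspring N v w)%N] `&` rch n (i :: v) x).
  by apply/seteqP; split => [w [i [h1 h2]]|w [i _ [h1 h2]]]; exists i.
apply: (@bigcupT_measurable _ (g_sigma_algebraType (sb (progeny v)))) => i.
apply: measurableI; last by apply: rch_sb => e h; right; exists i.
rewrite -[X in measurable X]setTI.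
have mo : measurable_fun setT (offspring N v : g_sigma_algebraType (sb (progeny v)) -> nat).
  by apply: m_off; left.
exact: (mo measurableT [set k | (i < k)%N]).
Qed.

Let childE n v x : P (child n v x) = offspring_avg p (q n v x).
Proof.
pose B k := offspring N v @^-1` [set k] `&` some n v x k.
have mo k : sigma_of (offspring N v) (offspring N v @^-1` [set k]).
  by exists [set k] => //; rewrite setTI.
have mB k : measurable (B k).
  by apply: measurableI; [exact: (@Fs_m (OffspringOf v) _ (mo k))|exact: some_m].
have -> : child n v x = \bigcup_k B k.
  apply/seteqP; split => [w [i [h1 h2]]|w [k _ [/= <- [i h]]]]; last by exists i.
  by exists (offspring N v w) => //; split => //; exists i.
have tB : trivIset setT B.
  by apply/trivIsetP => i j _ _ ij; apply/seteqP; split => // w [[/= E1 _] [/= E2 _]]; rewrite -E1 -E2 eqxx in ij.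
rewrite measure_bigcup// /offspring_avg.
rewrite (eq_eseriesl (Q := xpredT)); last by move=> k; rewrite in_setT.
apply: eq_eseriesr => k _.
rewrite EFinM -(offspring_law N v) -prE; last exact: some_m.
apply: (sb_indep (A := [set OffspringOf v]) (B := \bigcup_i descent (i :: v))).
- by apply/seteqP; split => // e [/= -> [i _ /descent_child_neq]]; exact.
- by apply: (@Fs_sb _ (OffspringOf v)) => //; exact: mo.
- by apply: some_sb => i ik e h; exists i.
Qed.

Let gam n v x := pr (child n v x).

Let child_m n v x : measurable (child n v x). Proof. by apply: (sbs_m (A := progeny v)); exact: child_sb. Qed.

Let gam01 n v x : 0 <= gam n v x <= 1. Proof. exact: pr01. Qed.

Let pay n v z w := payoff y (path rho (motion N v) z w) (lifetime N v w) 1 0 (gam n v).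

Section one_generation.
Variables (n : nat) (v : particle) (z : R).

(** The same sample space with two smaller sigma-algebras. The event of one generation becomes a
    subset of [TA * TB], evaluated on the diagonal. *)
Let TA := g_sigma_algebraType (sb (own_path v)).
Let TB := g_sigma_algebraType (sb (progeny v)).
Let X (a : T) := path rho (motion N v) z a.
Let Z a := X a (lifetime N v a).

Let first_step (s : TA * TB) : Prop := hits y (X s.1) (lifetime N v s.1) \/
  (positive_until (X s.1) (lifetime N v s.1) /\ child n v (Z s.1) s.2).

Let X_continuous a : continuous_ge0 (X a).
Proof. exact: path_continuous (motion_law N v) z a. Qed.

Let m_lifeA : measurable_fun setT (lifetime N v : TA -> R).
Proof. by apply: m_life; left. Qed.

Let mX t : 0 <= t -> measurable_fun setT (fun a : TA => X a t).
Proof.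
move=> t0; apply: measurable_funD => //; apply: measurable_funB => //.
by apply: m_mot => //; right.
Qed.

Let measurable_first_step : measurable [set s | first_step s].
Proof.
have mX1 t : 0 <= t -> measurable_fun setT (fun s : TA * TB => X s.1 t).
  by move=> t0; apply: measurableT_comp (mX t0) measurable_fst.
have mL1 : measurable_fun setT (fun s : TA * TB => lifetime N v s.1).
  exact: measurableT_comp m_lifeA measurable_fst.
have cX1 (s : TA * TB) : continuous_ge0 (X s.1) by exact: X_continuous.
have L1 (s : TA * TB) : 0 <= lifetime N v s.1 by exact: life0.
have -> : [set s | first_step s] = [set s : TA * TB | hits y (X s.1) (lifetime N v s.1)] `|`
  ([set s | positive_until (X s.1) (lifetime N v s.1)] `&`
   \bigcup_i ([set s | (i < offspring N v s.2)%N] `&` [set s | rch n (i :: v) (Z s.1) s.2])).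
  apply/seteqP; split => s /=.
    by move=> [h|[h1 [i [h2 h3]]]]; [left|right; split => //; exists i].
  by move=> [h|[h1 [i _ [h2 h3]]]]; [left|right; split => //; exists i].
apply: measurableU; first exact: (measurable_hits (X := fun s : TA * TB => X s.1) mX1 cX1 y mL1).
apply: measurableI.
  exact: (measurable_positive_until (X := fun s : TA * TB => X s.1) mX1 cX1 mL1 L1).
apply: bigcupT_measurable => i; apply: measurableI.
  rewrite -[X in measurable X]setTI.
  have mo : measurable_fun setT (fun s : TA * TB => offspring N v s.2).
    have h : measurable_fun setT (offspring N v : TB -> nat) by apply: m_off; left.
    exact: measurableT_comp h measurable_snd.
  exact: (mo measurableT [set k | (i < k)%N]).
have mZ : measurable_fun setT (fun s : TA * TB => Z s.1).
  exact: (measurable_path_at (X := fun s : TA * TB => X s.1) mX1 cX1 mL1 L1).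
have below e u : source_particle e = u ++ i :: v -> progeny v e.
  by move=> h; right; exists i, u.
have -> : [set s : TA * TB | rch n (i :: v) (Z s.1) s.2] = [set s | reach rho y (fun u s => lifetime N u s.2)
    (fun u s => offspring N u s.2) (fun u t s => motion N u t s.2) n (i :: v) (Z s.1) s].
  apply/funext => s; apply/esym.
  exact: (reach_comp snd rho y (lifetime N) (offspring N) (fun u t w => motion N u t w)).
apply: (@measurable_reach R _ (TA * TB)%type rho y (fun u s => lifetime N u s.2)
  (fun u s => offspring N u s.2) (fun u t s => motion N u t s.2) (fun u s => life0 u s.2)
  (fun u s => @mot_continuous u s.2) n (i :: v) (fun s => Z s.1)) => // u.
- have h : measurable_fun setT (lifetime N (u ++ i :: v) : TB -> R) by apply: m_life; exact: (below _ u).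
  exact: measurableT_comp h measurable_snd.
- have h : measurable_fun setT (offspring N (u ++ i :: v) : TB -> nat) by apply: m_off; exact: (below _ u).
  exact: measurableT_comp h measurable_snd.
- move=> t t0; have h : measurable_fun setT (motion N (u ++ i :: v) t : TB -> R).
    by apply: m_mot => //; exact: (below _ u).
  exact: measurableT_comp h measurable_snd.
Qed.

Let F (s : TA * TB) : \bar R := (\1_[set s | first_step s] s)%:E.

Let mF : measurable_fun setT F. Proof. by apply/measurable_EFinP; exact: measurable_indic. Qed.

Let F0 s : (0 <= F s)%E. Proof. by rewrite lee_fin. Qed.

Let F_frozen w : (\int[P]_w' F (w, w'))%E = (pay n v z w)%:E.
Proof.
have -> : (\int[P]_w' F (w, w'))%E = (\int[P]_w' (\1_[set w' | first_step (w, w')] w')%:E)%E.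
  by apply: eq_integral.
rewrite integral_indic//; last first.
  have h : measurable [set s | first_step s] := measurable_first_step.
  by have := sbs_m (measurable_xsection w h); rewrite /xsection/=; under eq_set do rewrite in_setE.
rewrite setIT /pay /payoff -/(X w); case: asboolP => h1.
  have -> : [set w' | first_step (w, w')] = setT by apply/seteqP; split => // w' _; left.
  exact: (probability_setT P).
case: asboolP => h2; last first.
  have -> : [set w' | first_step (w, w')] = set0 by apply/seteqP; split => // w' [|[]].
  exact: (measure0 P).
have -> : [set w' | first_step (w, w')] = child n v (Z w).
  by apply/seteqP; split => // w'; [move=> [|[]]|right].
exact: prE.
Qed.

Lemma measurable_pay : measurable_fun setT (fun w => (pay n v z w)%:E).
Proof.
have := measurable_frozen P (measurable_id_sigma (@sb_m (progeny v))) mF F0.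
under eq_fun do rewrite F_frozen.
by move=> h; apply: (measurableT_comp h (measurable_id_sigma (@sb_m (own_path v)))).
Qed.

(** The branching property: own path and progeny are independent, so on the diagonal of [first_step]
    the progeny can be averaged first with the path frozen, which gives [pay]. *)
Lemma reach_payoff : P (rch n.+1 v z) = (\int[P]_w (pay n v z w)%:E)%E.
Proof.
under eq_integral do rewrite -F_frozen.
rewrite -(freezing (measurable_id_sigma (@sb_m (own_path v))) (measurable_id_sigma (@sb_m (progeny v))) mF F0).
  have -> : (\int[P]_w F (w, w))%E = (\int[P]_w (\1_(rch n.+1 v z) w)%:E)%E by apply: eq_integral.
  by rewrite integral_indic ?setIT.
move=> A B; exact: sb_indep (own_path_progeny v) A B.
Qed.

End one_generation.

Lemma lifetime_motion_independent v : independent_classes P (sigma_of (lifetime N v))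
  <<s \bigcup_(t in [set t : R | 0 <= t]) sigma_of (motion N v t) >>.
Proof.
move=> A B FA FB; apply: (sb_indep (A := [set LifetimeOf v]) (B := [set MotionOf v])).
- by apply/seteqP; split => // e [/= ->].
- exact: (@Fs_sb _ (LifetimeOf v)).
- exact: (@Fs_sb _ (MotionOf v)).
Qed.

Lemma measurable_reach_event n v z :
  measurable [set w | reach rho y (lifetime N) (offspring N) (fun v t w => motion N v t w) n v z w].
Proof. exact: rch_m. Qed.

Hypothesis p_pmf : is_pmf p.
Variable m : R.
Hypotheses (m_mean : offspring_mean p = m%:E) (m_ge0 : 0 <= m).

Local Notation g := (offspring_success p).

Let gamE n v x : (gam n v x)%:E = offspring_avg p (q n v x).
Proof. by rewrite -childE prE. Qed.

Let gam_le n v x u : 0 <= u <= 1 -> (forall i, pr (rch n (i :: v) x) <= u) -> gam n v x <= g u.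
Proof.
move=> u01 hu; rewrite -lee_fin gamE (offspring_successE p_pmf).
apply: le_offspring_avg => // k; rewrite q_le// andbT.
by case/andP: (q01 n v x k).
Qed.

Let gam_ge n v x u dl : 0 <= u <= 1 -> 0 <= dl -> (forall i, u - dl <= pr (rch n (i :: v) x)) ->
  g u <= gam n v x + m * dl.
Proof.
move=> u01 dl0 hu; rewrite -lee_fin EFinD gamE (offspring_successE p_pmf).
rewrite [m * dl]mulrC EFinM -(offspring_avg_id m_mean) -(offspring_avgZ p_pmf)//.
rewrite -(offspring_avgD p_pmf)//; last 2 first.
  by move=> k; case/andP: (q01 n v x k).
  by move=> k; rewrite mulr_ge0.
apply: le_offspring_avg => // k; rewrite q_ge// andbT.
by case/andP: (some_of01 k u).
Qed.

Let rch0 v z : pr (rch 0 v z) = 0.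
Proof. by rewrite /pr (_ : rch 0 v z = set0) ?measure0//; apply/seteqP; split. Qed.

Let payoff_ge0 X L c1 c0 (f : R -> R) : 0 <= c1 -> 0 <= c0 -> (forall x, 0 <= f x) ->
  0 <= payoff y X L c1 c0 f.
Proof. by move=> c10 c00 f0; rewrite /payoff; case: ifP => // _; case: ifP. Qed.

Let measurable_payoff_path v z c1 c0 (f : R -> R) : measurable_fun setT f ->
  measurable_fun setT (fun w => (payoff y (path rho (motion N v) z w) (lifetime N v w) c1 c0 f)%:E).
Proof.
move=> mf; apply/measurable_EFinP; apply: measurable_payoff => //.
- by move=> t t0; exact: measurable_path.
- by move=> w; exact: path_continuous (motion_law N v) z w.
Qed.

Let pay_ge0 n v z w : 0 <= pay n v z w.
Proof. by apply: payoff_ge0 => // x; case/andP: (gam01 n v x). Qed.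

(** Induction over generations: if each child succeeds with probability at most [u] at its birth
    place, then [gam] is at most [g \o u], and the one-generation inequality closes the loop. *)
Lemma reach_prob_le (u : R -> R) n v z : (forall x, 0 <= u x <= 1) ->
  measurable_fun setT (g \o u) ->
  (forall v z, (\int[P]_w (payoff y (path rho (motion N v) z w) (lifetime N v w) 1 0 (g \o u))%:E
     <= (u z)%:E)%E) ->
  (P [set w | reach rho y (lifetime N) (offspring N) (fun v t w => motion N v t w) n v z w] <= (u z)%:E)%E.
Proof.
move=> u01 mgu hu; rewrite -/(rch n v z) prE// lee_fin.
elim: n v z => [|n IH] v z; first by rewrite rch0; case/andP: (u01 z).
rewrite -lee_fin -prE// reach_payoff; apply: le_trans (hu v z).
apply: ge0_le_integral => //.
- by move=> w _; rewrite lee_fin pay_ge0.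
- exact: measurable_pay.
- exact: measurable_payoff_path.
- move=> w _; rewrite lee_fin /pay /payoff; case: ifP => // _; case: ifP => // _.
  by apply: gam_le => // i.
Qed.

(* In the subcritical case the generations beyond [n] contribute at most [m ^+ n]. *)
Lemma reach_prob_ge (u : R -> R) n v z : m <= 1 -> (forall x, 0 <= u x <= 1) ->
  measurable_fun setT (g \o u) ->
  (forall v z, (\int[P]_w (payoff y (path rho (motion N v) z w) (lifetime N v w) 0 1
     (fun x => 1 - g (u x)))%:E <= (1 - u z)%:E)%E) ->
  ((u z - m ^+ n)%:E <=
   P [set w | reach rho y (lifetime N) (offspring N) (fun v t w => motion N v t w) n v z w])%E.
Proof.
move=> m1 u01 mgu hu; rewrite -/(rch n v z) prE// lee_fin.
elim: n v z => [|n IH] v z.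
  by rewrite rch0 expr0 subr_le0; case/andP: (u01 z).
(* Stated as a sum, so that success and failure payoffs are added path by path: together they are at
   least [1 - m ^+ n.+1]. *)
suff : ((1 - m ^+ n.+1)%:E <= (pr (rch n.+1 v z) + (1 - u z))%:E)%E by rewrite lee_fin; lra.
have -> : ((pr (rch n.+1 v z) + (1 - u z))%:E = P (rch n.+1 v z) + (1 - u z)%:E)%E.
  by rewrite prE.
rewrite reach_payoff.
apply: le_trans (leeD (lexx _) (hu v z)).
have mgu' : measurable_fun setT (fun x => 1 - g (u x)).
  by apply: measurable_funB => //.
have gu01 x : 0 <= 1 - g (u x).
  by rewrite subr_ge0; case/andP: (offspring_success01 p_pmf (u x)).
rewrite -ge0_integralD//; last 4 first.
- by move=> w _; rewrite lee_fin pay_ge0.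
- exact: measurable_pay.
- by move=> w _; rewrite lee_fin payoff_ge0.
- exact: measurable_payoff_path.
have mn1 : 0 <= 1 - m ^+ n.+1 by rewrite subr_ge0 exprn_ile1.
have -> : ((1 - m ^+ n.+1)%:E = \int[P]_w (1 - m ^+ n.+1)%:E)%E.
  by rewrite integral_cst//= probability_setT mule1.
apply: ge0_le_integral => //.
- by apply: emeasurable_funD; [exact: measurable_pay|exact: measurable_payoff_path].
- have mn0 : 0 <= m ^+ n.+1 by rewrite exprn_ge0.
  move=> w _; rewrite -EFinD lee_fin /pay /payoff; case: ifP => // _; first by lra.
  case: ifP => // _; last by lra.
  set x := path _ _ _ _ _.
  have := @gam_ge n v x (u x) (m ^+ n) (u01 x) (exprn_ge0 n m_ge0) (fun i => IH (i :: v) x).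
  by rewrite exprS; lra.
Qed.

End recursion.

(** * Tail of the killed maximum *)

Lemma squeezed_dist {R : realFieldType} (a b v c e : R) : 0 < e ->
  c - e / 2 < a -> a <= v -> v <= b -> b < c + e / 2 -> `|c - v| < e.
Proof. by move=> *; rewrite distrC ltr_norml; apply/andP; split; lra. Qed.

Section tail.
Context {R : realType} {beta : R} {p : nat -> R} {m : R} (rho : R).
Hypotheses (beta_gt0 : 0 < beta) (p_pmf : is_pmf p) (m_mean : offspring_mean p = m%:E)
  (m_gt0 : 0 < m) (m_lt1 : m < 1).

Local Notation gamma := (bbm_gamma beta m rho).
Local Notation eta := (bbm_eta beta p m).
Let lam := rho + gamma.
Let mu := rho - gamma.
Local Notation kpp := (kpp lam mu eta).
Local Notation shoot := (shoot lam mu eta).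
Local Notation g := (offspring_success p).

Let lam_gt0 : 0 < lam. Proof. exact: bbm_lam_gt0. Qed.
Let mu_lt : mu < lam. Proof. exact: bbm_mu_lt. Qed.
Let K_ge0 : 0 <= 2 * beta * m. Proof. exact: bbm_K_ge0. Qed.
Let eta0 : eta 0 = 0. Proof. exact: bbm_eta0. Qed.
Let eta_nd : {homo eta : x y / x <= y}. Proof. exact: bbm_eta_nd. Qed.
Let eta_lip x y : x <= y -> eta y - eta x <= 2 * beta * m * (y - x).
Proof. exact: bbm_eta_lip. Qed.

Let shootP y : 0 < y -> 0 < shoot y /\ kpp (shoot y) y = 1.
Proof. exact: (shoot_spec lam_gt0 mu_lt K_ge0 eta0 eta_nd eta_lip). Qed.

Let kpp_nonneg a x : 0 <= a -> 0 <= x -> 0 <= kpp a x.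
Proof. exact: (kpp_ge0 lam_gt0 mu_lt K_ge0 eta0 eta_nd eta_lip). Qed.

Let kpp_nd_x a x y : 0 <= a -> 0 <= x -> x <= y -> kpp a x <= kpp a y.
Proof. exact: (kpp_ndx lam_gt0 mu_lt K_ge0 eta0 eta_nd eta_lip). Qed.

Section process.
Context {d : measure_display} {T : measurableType d} {P : probability T R}.
Variable N : branching_inputs beta p P.

Local Notation rch y n x :=
  [set w | reach rho y (lifetime N) (offspring N) (fun v t w => motion N v t w) n [::] x w].

Let exceed y x : set T := [set w | (y%:E < killed_all_time_max N rho x w)%E].

Let exceedE y x : exceed y x = \bigcup_n rch y n x.
Proof.
apply/seteqP; split => w.
  by move=> /killed_all_time_max_reach[n h]; exists n.
by move=> [n _ h]; apply/killed_all_time_max_reach; exists n.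
Qed.

Let exceed_m y x : measurable (exceed y x).
Proof. by rewrite exceedE; apply: bigcupT_measurable => n; exact: measurable_reach_event. Qed.

Let exceed_cvg y x : P (rch y n x) @[n --> \oo] --> P (exceed y x).
Proof.
rewrite exceedE; apply: nondecreasing_cvg_mu.
- by move=> n; exact: measurable_reach_event.
- by rewrite -exceedE.
- by apply/nondecreasing_seqP => n; rewrite subsetEset => w; exact: reachS.
Qed.

Let measurable_success (u : R -> R) : continuous u -> measurable_fun setT (g \o u).
Proof.
move=> cu; apply: continuous_measurable_fun => x; apply: continuous_comp; first exact: cu.
exact: (offspring_success_continuous p_pmf m_mean m_gt0).
Qed.

Lemma exceed_prob_le x y eps : 0 < x -> 0 < y -> 0 < eps ->
  fine (P (exceed y x)) <= kpp (shoot (y + eps)) (x + eps).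
Proof.
move=> x0 y0 eps0; have [a0 ka] := shootP (addr_gt0 y0 eps0).
set a := shoot _ in a0 ka *; have a0' := ltW a0.
pose u := super_profile beta p m rho a eps.
apply: (@le_trans _ _ (u x)); last first.
  by rewrite /u /super_profile ge_min max_r ?lexx ?orbT// addr_ge0// ltW.
rewrite -lee_fin fineK ?fin_num_measure//.
rewrite -(cvg_lim _ (@exceed_cvg y x))//.
apply: lime_le; first by apply/cvg_ex; eexists; exact: exceed_cvg.
apply: nearW => n; apply: (reach_prob_le p_pmf (u := u)).
- by move=> z; exact: super_profile01.
- by apply: measurable_success; exact: super_profile_continuous.
- move=> v z; apply: expected_payoff_up => //.
  + exact: lifetime_gt0.
  + exact: lifetime_law.
  + exact: motion_law.
  + exact: lifetime_motion_independent.
Qed.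

Lemma exceed_prob_ge x y eps : 0 < x -> x <= y -> 0 < eps ->
  kpp (shoot (y + 2 * eps)) x - kpp (shoot (y + 2 * eps)) eps <= fine (P (exceed y x)).
Proof.
move=> x0 xy eps0; have y0 : 0 < y by exact: lt_le_trans xy.
have y20 : 0 < y + 2 * eps by lra.
have [a0 ka] := shootP y20.
set a := shoot _ in a0 ka *; have a0' := ltW a0.
pose u := sub_profile beta p m rho a eps.
apply: (@le_trans _ _ (u x)).
  rewrite /u /sub_profile (max_r (ltW x0)) le_max le_min lexx andbT.
  apply/orP; right; have : kpp a x <= 1 by rewrite -ka; apply: kpp_nd_x; lra.
  by have := @kpp_nonneg a eps a0' (ltW eps0); lra.
rewrite -lee_fin fineK ?fin_num_measure//.
(* Stopping after [n] generations only shrinks the event and costs at most [m ^+ n], which vanishes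
   in the limit. *)
have lb n : ((u x - m ^+ n)%:E <= P (exceed y x))%E.
  apply: (@le_trans _ _ (P (rch y n x))).
    apply: (reach_prob_ge p_pmf m_mean (ltW m_gt0) (u := u)); first exact: ltW.
    - by move=> z; exact: sub_profile01.
    - by apply: measurable_success; exact: sub_profile_continuous.
    - move=> v z; apply: expected_payoff_low => //.
      + exact: lifetime_gt0.
      + exact: lifetime_law.
      + exact: motion_law.
      + exact: lifetime_motion_independent.
  apply: le_measure; rewrite ?inE//; first exact: measurable_reach_event.
  by rewrite exceedE => w h; exists n.
have cm : (u x - m ^+ n)%:E @[n --> \oo] --> (u x)%:E.
  apply: cvg_EFin; first by near=> n.
  rewrite -[X in _ --> X]subr0; apply: cvgB; first exact: cvg_cst.
  by apply: cvg_expr; rewrite ger0_norm// ltW.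
rewrite -(cvg_lim _ cm)//; apply: lime_le; first by apply/cvg_ex; eexists; exact: cm.
exact: nearW.
Unshelve. all: by end_near. Qed.

Let s x := (expR (lam * x) - expR (mu * x)) / (lam - mu).

Let s_continuous : continuous s.
Proof.
move=> x; apply: cvgM; last exact: cvg_cst.
have h c : expR (c * t) @[t --> x] --> expR (c * x).
  apply: (@continuous_comp _ _ _ (fun t => c * t) expR); last exact: continuous_expR.
  by apply: cvgM; [exact: cvg_cst|exact: cvg_id].
by apply: cvgB; exact: h.
Qed.

Let s0 : s 0 = 0. Proof. by rewrite /s !mulr0 subrr mul0r. Qed.

Lemma exceed_tail C : (forall x, 0 < x -> expR (lam * L) * kpp (shoot L) x @[L --> +oo] --> C * s x) ->
  forall x, 0 < x -> expR (lam * y) * fine (P (exceed y x)) @[y --> +oo] --> C * s x.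
Proof.
move=> lim x x0; apply/cvgrPdist_lt => e e0; have e20 : 0 < e / 2 by rewrite divr_gt0.
(* Limits of the two bounds as [y] grows with [eps] fixed; the exponential prefactors compensate for
   shooting at [y + eps] and [y + 2 * eps]. Both tend to [C * s x] with [eps], so [eps] is fixed
   before [y]. *)
pose h1 eps := expR (- lam * eps) * (C * s (x + eps)).
pose h2 eps := expR (- lam * (2 * eps)) * (C * s x - C * s eps).
have ce c : expR (- lam * (c * t)) @[t --> (0 : R)] --> (1 : R).
  rewrite -expR0 -[X in expR X](mulr0 (- lam)) -[X in - lam * X](mulr0 c).
  apply: (@continuous_comp R _ _ (fun t => - lam * (c * t)) expR); last exact: continuous_expR.
  apply: cvgM; first exact: cvg_cst.
  by apply: cvgM; [exact: cvg_cst|exact: cvg_id].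
have c1 : h1 t @[t --> (0 : R)] --> C * s x.
  rewrite -[X in _ --> X]mul1r; apply: cvgM.
    by have := ce 1; under eq_fun do rewrite mul1r.
  apply: cvgM; first exact: cvg_cst.
  rewrite -{2}[x]addr0; apply: (@continuous_comp R _ _ (fun t => x + t) s); last exact: s_continuous.
  by apply: cvgD; [exact: cvg_cst|exact: cvg_id].
have c2 : h2 t @[t --> (0 : R)] --> C * s x.
  have -> : C * s x = 1 * (C * s x - C * s 0) by rewrite s0 mulr0 subr0 mul1r.
  apply: cvgM; first exact: ce.
  apply: cvgB; first exact: cvg_cst.
  by apply: cvgM; [exact: cvg_cst|exact: s_continuous].
have [eps eps0 [b1 b2]] : exists2 eps, 0 < eps & h1 eps < C * s x + e / 2 /\ C * s x - e / 2 < h2 eps.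
  have : \forall t \near (0 : R), h1 t < C * s x + e / 2 /\ C * s x - e / 2 < h2 t.
    near=> t; split; near: t.
      by apply: (cvgr_lt _ c1); rewrite ltrDl.
    by apply: (cvgr_gt _ c2); rewrite gtrBl.
  move=> /nbhs_ballP[r /= r0 hr]; exists (r / 2); first by rewrite divr_gt0.
  by apply: hr; rewrite /ball/= sub0r normrN gtr0_norm ?divr_gt0// ltr_pdivrMr// ltr_pMr// ltr1n.
have lim1 : expR (- lam * eps) * (expR (lam * (y + eps)) * kpp (shoot (y + eps)) (x + eps))
    @[y --> +oo] --> h1 eps.
  apply: cvgM; first exact: cvg_cst.
  rewrite (@cvg_shiftr R eps _ (fun L => expR (lam * L) * kpp (shoot L) (x + eps))).
  by apply: lim; rewrite addr_gt0.
have lim2 : expR (- lam * (2 * eps)) * (expR (lam * (y + 2 * eps)) * kpp (shoot (y + 2 * eps)) x -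
    expR (lam * (y + 2 * eps)) * kpp (shoot (y + 2 * eps)) eps) @[y --> +oo] --> h2 eps.
  apply: cvgM; first exact: cvg_cst.
  rewrite (@cvg_shiftr R (2 * eps) _ (fun L => expR (lam * L) * kpp (shoot L) x - expR (lam * L) * kpp (shoot L) eps)).
  by apply: cvgB; exact: lim.
have expE y c : expR (- lam * c) * expR (lam * (y + c)) = expR (lam * y).
  by rewrite -expRD; congr expR; ring.
near=> y.
have xy : x <= y by near: y; apply: nbhs_pinfty_ge; exact: num_real.
have u1 : expR (lam * y) * kpp (shoot (y + eps)) (x + eps) < C * s x + e / 2.
  rewrite -(expE y eps) -mulrA; near: y; exact: (cvgr_lt _ lim1 _ b1).
have u2 : C * s x - e / 2 < expR (lam * y) * (kpp (shoot (y + 2 * eps)) x - kpp (shoot (y + 2 * eps)) eps).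
  rewrite -(expE y (2 * eps)) -mulrA mulrBr; near: y; exact: (cvgr_gt _ lim2 _ b2).
have v1 := ler_wpM2l (expR_ge0 (lam * y)) (exceed_prob_le x0 (lt_le_trans x0 xy) eps0).
have v2 := ler_wpM2l (expR_ge0 (lam * y)) (exceed_prob_ge x0 xy eps0).
exact: (squeezed_dist e0 u2 v2 v1 u1).
Unshelve. all: by end_near. Qed.

End process.
End tail.

Theorem theorem1p2 (R : realType) (beta : R) (p : nat -> R)
    (beta_gt0 : 0 < beta) (p_pmf : is_pmf p)
    (m : R) (m_mean : offspring_mean p = m%:E) (m_gt0 : 0 < m) (m_lt1 : m < 1)
    (p_klogk : (\sum_(1 <= k <oo) (k%:R * ln k%:R * p k)%:E < +oo)%E)
    (rho : R) :
  let alpha := beta * (1 - m) in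
  let gamma := Num.sqrt (2 * alpha + rho ^+ 2) in
  exists C : R, 0 < C /\
    forall x : R, 0 < x ->
    forall (d : measure_display) (T : measurableType d) (P : probability T R)
      (N : branching_inputs beta p P),
      expR ((rho + gamma) * y)
        * fine (P [set w | (y%:E < killed_all_time_max N rho x w)%E])
        @[y --> +oo] --> 2 * C * expR (rho * x) * sinh (x * gamma).
Proof.
move=> alpha gamma.
have lam0 := bbm_lam_gt0 rho beta_gt0 m_lt1.
have gam0 : 0 < gamma by exact: le_lt_trans (normr_ge0 rho) (rho_lt_gamma rho beta_gt0 m_lt1).
have [S hS] := offspring_defect_sum p_pmf m_mean lam0 p_klogk.
have eta_sum n : \sum_(0 <= j < n) bbm_eta beta p m (expR (- (rho + gamma) * j%:R)) /
    expR (- (rho + gamma) * j%:R) <= 2 * beta * S.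
  rewrite /bbm_eta; under eq_bigr do rewrite -mulrA.
  by rewrite -mulr_sumr ler_wpM2l// mulr_ge0// ltW.
have eta_nd : {homo bbm_eta beta p m : x y / x <= y} by exact: bbm_eta_nd.
have eta_lip x y : x <= y -> bbm_eta beta p m y - bbm_eta beta p m x <= 2 * beta * m * (y - x).
  exact: bbm_eta_lip.
have eta_star c u : 0 <= c <= 1 -> 0 <= u -> bbm_eta beta p m (c * u) <= c * bbm_eta beta p m u.
  exact: bbm_eta_star.
have [C C0 lim] := kpp_shoot_limit lam0 (bbm_mu_lt rho beta_gt0 m_lt1) (bbm_K_ge0 beta_gt0 m_gt0)
  (bbm_eta0 beta m p_pmf) eta_nd eta_lip eta_star eta_sum.
(* The linear solution equals [e^(rho x) sinh (gamma x) / gamma], and the factor 2 of the claim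
   accounts for the rest. The constant comes from the differential equation alone, hence is chosen
   before [x] and the probability space. *)
exists (C / (2 * gamma)); split; first by rewrite divr_gt0// mulr_gt0.
move=> x x0 d T P N.
rewrite (_ : 2 * _ * _ * _ = C * ((expR ((rho + gamma) * x) - expR ((rho - gamma) * x)) / (rho + gamma - (rho - gamma)))).
  exact: (@exceed_tail R beta p m rho beta_gt0 p_pmf m_mean m_gt0 m_lt1 d T P N C lim x x0).
have -> : rho + gamma - (rho - gamma) = 2 * gamma by ring.
have -> : (rho + gamma) * x = rho * x + x * gamma by ring.
have -> : (rho - gamma) * x = rho * x + - (x * gamma) by ring.
rewrite !expRD /sinh; field.
by rewrite gt_eqF.
Qed.
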